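(* Let $d\ge 3$, let $B\subset\mathbb{R}^d$ be an admissible rotation domain, and let $\Omega$ be a finite collection of distinct circles $S=\{(r_0,\theta,\mathbf{x}'_0):0\le\theta\le 2\pi\}$ (with fixed $r_0>0$ and $\mathbf{x}'_0\in J$ for each circle) lying in $B$. Let $0\le\theta_0<\theta_1<\dots<\theta_{m-1}<2\pi$ be arbitrary real numbers. Let $X=\{\mathbf{x}_k\}_{k=1}^n$ be the collection of all distinct points at which the circles from $\Omega$ intersect the half-planes $L_j=\{(r,\theta,\mathbf{x}'):\theta=\theta_j\}$, $j=0,\dots,m-1$, and let $X^*=\{\mathbf{x}^*_k\}_{k=1}^n$ be the collection of all points at which the circles from $\Omega$ intersect the half-planes $L^*_j=\{(r,\theta,\mathbf{x}'):\theta=2\pi j/m\}$, $j=0,\dots,m-1$. Let $\Delta=\{\delta_k\}_{k=1}^n$ be a collection of real numbers such that $\delta_k=\delta_l$ whenever the points $\mathbf{x}_k,\mathbf{x}_l\in X$ lie on the same circle from $\Omega$. Suppose furthermore that the points are numbered so that, for each $k=1,\dots,n$, the points $\mathbf{x}_k\in X$ and $\mathbf{x}^*_k\in X^*$ lie on the same circle from $\Omega$. Then $$E(X,\Delta,B)\ge E(X^*,\Delta,B).$$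
   Context: Points of $\mathbb{R}^d$, $d\ge3$, are written $\mathbf{x}=(x_1,\dots,x_d)$, and $\|\cdot\|$ is the Euclidean norm. $J$ denotes the $(d-2)$-dimensional plane $\{\mathbf{x}\in\mathbb{R}^d:\mathbf{x}=(0,0,x_3,\dots,x_d)\}$. Cylindrical coordinates $(r,\theta,\mathbf{x}')$ of $\mathbf{x}$ are given by $x_1=r\cos\theta$, $x_2=r\sin\theta$, $\mathbf{x}'=(0,0,x_3,\dots,x_d)\in J$. A domain $B\subset\mathbb{R}^d$ is a rotation domain (with respect to the axis $J$) if for any point $(r,\theta,\mathbf{x}')\in B$ and any $\varphi$ the point $(r,\varphi,\mathbf{x}')$ belongs to $B$. A domain $B\subset\mathbb{R}^d$ is admissible if it has a Green function for the Laplace operator vanishing at the points of the boundary $\partial B$ (and, if $B$ is unbounded, at infinity). The Green function with pole at $\mathbf{x}_0\in B$ is denoted $g_B(\mathbf{x},\mathbf{x}_0)$; it is harmonic in $\mathbf{x}\in B\setminus\{\mathbf{x}_0\}$ and is normalized so that, as $\mathbf{x}\to\mathbf{x}_0$, $$g_B(\mathbf{x},\mathbf{x}_0)=\lambda_d\left(\|\mathbf{x}-\mathbf{x}_0\|^{2-d}-c(B,\mathbf{x}_0)+o(1)\right)$$ for a constant $c(B,\mathbf{x}_0)$ (equal to $r(B,\mathbf{x}_0)^{2-d}$, where $r(B,\mathbf{x}_0)$ is the harmonic radius of $B$ with respect to $\mathbf{x}_0$). Here $\lambda_d=((d-2)\omega_{d-1})^{-1}$ and $\omega_{d-1}=2\pi^{d/2}/\Gamma(d/2)$.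 For a collection $X=\{\mathbf{x}_k\}_{k=1}^n$ of distinct points of $B$ and a collection of real numbers $\Delta=\{\delta_k\}_{k=1}^n$ (a discrete charge with value $\delta_k$ at $\mathbf{x}_k$), the Green energy with respect to $B$ is $$E(X,\Delta,B)=\sum_{k=1}^n\ \sum_{l=1,\ l\ne k}^n\delta_k\delta_l\,g_B(\mathbf{x}_k,\mathbf{x}_l).$$ $E(X^*,\Delta,B)$ is defined in the same way with $\mathbf{x}^*_k$ in place of $\mathbf{x}_k$ (value $\delta_k$ at $\mathbf{x}^*_k$). *)

(* Defs.v *)
From HB Require Import structures.
From mathcomp Require Import all_boot all_order all_algebra.
From mathcomp Require Import all_classical all_reals all_analysis.

Set Implicit Arguments.
Unset Strict Implicit.
Unset Printing Implicit Defensive.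

Import Order.TTheory GRing.Theory Num.Theory.
Import numFieldNormedType.Exports.

Local Open Scope classical_set_scope.
Local Open Scope ring_scope.

(* The coordinates of a row vector are numbered from 0: x_1 and x_2 have       *)
(* indices 0 and 1. The library norm on 'rV[R]_d is the sup norm; it induces   *)
(* the usual topology and the usual bounded sets, but lengths must be measured *)
(* with enorm.                                                                 *)
Definition enorm (R : realType) (d : nat) (x : 'rV[R]_d) : R :=
  Num.sqrt (\sum_(i < d) x ord0 i ^+ 2).

Definition J (R : realType) (d : nat) : set 'rV[R]_d :=
  [set x | forall i : 'I_d, (i < 2)%N -> x ord0 i = 0].

(* The point with cylindrical coordinates (r, theta, x'), where x' is in J. *)
Definition cyl (R : realType) (d : nat) (r theta : R) (x' : 'rV[R]_d)
    : 'rV[R]_d :=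
  \row_(i < d) (if i == 0%N :> nat then r * cos theta
                else if i == 1%N :> nat then r * sin theta
                else x' ord0 i).

Definition domain (R : realType) (d : nat) (B : set 'rV[R]_d) : Prop :=
  [/\ B !=set0, open B & connected B].

Definition rotation_domain (R : realType) (d : nat) (B : set 'rV[R]_d) : Prop :=
  domain B /\
  forall (r theta phi : R) (x' : 'rV[R]_d),
    0 <= r -> J x' -> B (cyl r theta x') -> B (cyl r phi x').

Definition partial (R : realType) (d : nat) (i : 'I_d) (u : 'rV[R]_d -> R)
    : 'rV[R]_d -> R :=
  fun x => 'D_(delta_mx ord0 i) u x.

Definition has_partial (R : realType) (d : nat) (i : 'I_d) (u : 'rV[R]_d -> R)
    (x : 'rV[R]_d) : Prop :=
  derivable u x (delta_mx ord0 i).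

(* For an open set D, the first and third clauses hold throughout D, so that  *)
(* the second partial derivatives only depend on u on D.                      *)
Definition C2_on (R : realType) (d : nat) (D : set 'rV[R]_d)
    (u : 'rV[R]_d -> R) : Prop :=
  forall x, D x ->
    [/\ forall i, has_partial i u x,
        forall i, {for x, continuous (partial i u)},
        forall i j, has_partial j (partial i u) x
      & forall i j, {for x, continuous (partial j (partial i u))}].

Definition laplacian (R : realType) (d : nat) (u : 'rV[R]_d -> R)
    (x : 'rV[R]_d) : R :=
  \sum_(i < d) partial i (partial i u) x.

Definition harmonic_on (R : realType) (d : nat) (D : set 'rV[R]_d)
    (u : 'rV[R]_d -> R) : Prop :=
  C2_on D u /\ forall x, D x -> laplacian u x = 0.

Definition Gamma (R : realType) (s : R) : R :=
  \int[@lebesgue_measure R]_(t in `]0, +oo[) (t `^ (s - 1) * expR (- t)).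

(* The area of the unit sphere of R^d, usually written omega_{d-1}: the index  *)
(* here is the dimension of the ambient space, not of the sphere.              *)
Definition omega (R : realType) (d : nat) : R :=
  2 * pi `^ (d%:R / 2) / Gamma (d%:R / 2).

Definition lambda (R : realType) (d : nat) : R :=
  ((d%:R - 2) * omega R d)^-1.

Definition boundary (T : topologicalType) (B : set T) : set T :=
  closure B `\` interior B.

Definition vanishes_at_infinity (R : realType) (d : nat) (B : set 'rV[R]_d)
    (g : 'rV[R]_d -> R) : Prop :=
  forall e : R, 0 < e ->
    exists M : R, forall x, B x -> M < enorm x -> `|g x| < e.

(* The third clause is the expansion                                           *)
(* g x = lambda_d (||x - x0||^(2-d) - c + o(1)) as x tends to x0; the constant *)
(* lambda_d is absorbed in the o(1).                                           *)
Definition is_green_function (R : realType) (d : nat) (B : set 'rV[R]_d)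
    (x0 : 'rV[R]_d) (g : 'rV[R]_d -> R) : Prop :=
  [/\ harmonic_on (B `\ x0) g,
      forall y, boundary B y -> g x @[x --> within B (nbhs y)] --> (0 : R),
      exists c : R,
        g x - lambda R d * (enorm (x - x0) ^- (d - 2) - c)
          @[x --> x0^'] --> (0 : R)
    & ~ bounded_set B -> vanishes_at_infinity B g].

Definition admissible (R : realType) (d : nat) (B : set 'rV[R]_d) : Prop :=
  domain B /\ forall x0, B x0 -> exists g, is_green_function B x0 g.

(* g_B(x, x0) is green B x0 x. For an admissible B and a pole x0 in B, the     *)
(* Green function exists and, by the maximum principle, is unique on           *)
(* B \ {x0}; xget selects it (its values elsewhere are arbitrary).             *)
Definition green (R : realType) (d : nat) (B : set 'rV[R]_d) (x0 : 'rV[R]_d)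
    : 'rV[R]_d -> R :=
  xget (fun=> 0) [set g | is_green_function B x0 g].

Definition green_energy (R : realType) (d n : nat) (x : 'I_n -> 'rV[R]_d)
    (delta : 'I_n -> R) (B : set 'rV[R]_d) : R :=
  \sum_(k < n) \sum_(l < n | l != k) delta k * delta l * green B (x l) (x k).

Definition circle (R : realType) (d : nat) (r0 : R) (x0' : 'rV[R]_d)
    : set 'rV[R]_d :=
  [set cyl r0 theta x0' | theta in `[0, 2 * pi]].

Definition is_circle (R : realType) (d : nat) (S : set 'rV[R]_d) : Prop :=
  exists (r0 : R) (x0' : 'rV[R]_d), [/\ 0 < r0, J x0' & S = circle r0 x0'].

Definition half_plane (R : realType) (d : nat) (theta : R) : set 'rV[R]_d :=
  [set x | exists (r : R) (x' : 'rV[R]_d),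
      [/\ 0 <= r, J x' & x = cyl r theta x']].

Definition intersection_points (R : realType) (d m : nat)
    (Omega : set (set 'rV[R]_d)) (theta : 'I_m -> R) : set 'rV[R]_d :=
  [set x | exists (S : set 'rV[R]_d) (j : 'I_m),
      [/\ Omega S, S x & half_plane (theta j) x]].

(* Main.v *)
Require Import Defs.
From HB Require Import structures.
From mathcomp Require Import all_boot all_order all_algebra.
From mathcomp Require Import all_classical all_reals all_analysis.
From mathcomp Require Import ring lra zify.

Set Implicit Arguments.
Unset Strict Implicit.
Unset Printing Implicit Defensive.

Import Order.TTheory GRing.Theory Num.Theory.
Import numFieldNormedType.Exports.

Local Open Scope classical_set_scope.
Local Open Scope ring_scope.

(* Let G be the Green function and, for the weights D_a of the circles
   (r_a, x'_a), let K(t) be the sum over a, b of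
   D_a D_b G((r_a, t, x'_a), (r_b, 0, x'_b)).
   Invariance of G under the symmetries of B makes the energy of a configuration
   with angles theta_i equal to the sum of K(theta_i - theta_j) over i <> j plus
   a term independent of the angles. The kernel K is 2 pi-periodic, and it is
   midpoint convex on ]0, 2 pi[; by Jensen's inequality applied to the differences
   theta_(i+s) - theta_i mod 2 pi, whose sum over i is 2 pi s, equal spacing
   minimizes the sum.

   Midpoint convexity is reflection positivity: for points p_i with x_2 > 0 and
   the reflection sigma in x_2 = 0, the sum over i, j of c_i c_j G(sigma p_i, p_j)
   is nonnegative. Indeed, let v be the potential of the charges c_i at p_i, and
   let e be v on x_2 <= 0 and v o sigma on x_2 > 0. The Dirichlet integral of e is
   nonnegative and equals the pairing of - Laplace v with v o sigma at the poles.
   To avoid integration, v is truncated near its poles and near the boundary of B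
   and the pairing is computed with lattice sums and the discrete Laplacian, the
   mesh tending to 0. *)

(** * Calculus on lines and row vectors *)

(** The exact mass that a truncated Green function carries at its pole is never computed. It is
    enough that this mass is nearly the same for all poles and bounded away from 0 and infinity:
    near the pole the function is compared with [lam] times a smoothed Newton kernel, whose
    Laplacian is, up to sign, a translate of one continuous source. The common mass then factors out
    of the Dirichlet form.

    The boundary of B carries no regularity, so near it only the approximate sign of the Laplacian
    of the truncation is available. But the discrete Laplacian of a compactly supported function
    sums to 0, so the negative mass near the boundary is controlled by the positive mass at the
    pole, and it suffices that the test function be small there.

    The test function is itself built from the truncations, which threatens a circle: the truncation
    level has to lie below the Green function wherever the test function is not small. The circle is
    broken by describing that region through a compact set K defined by the untruncated Green
    functions; the dependence runs from the radius r to K, to the truncation levels, to the mesh. *)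

Section LineCalculus.
Variables (R : realType) (V : normedModType R).
Implicit Types (u : V -> R) (x y v : V).

Lemma cvg_eps (T : pseudoMetricNormedZmodType R) (F : set_system T) (f : T -> R) (l : R) :
  Filter F -> (f x @[x --> F] --> l) <->
    (forall e : R, 0 < e -> \forall x \near F, `|f x - l| < e).
Proof.
move=> FF; split.
  by move=> /cvgrPdist_lt h e e0; near do rewrite distrC; exact: h.
by move=> h; apply/cvgrPdist_lt => e e0; near do rewrite distrC; exact: h.
Unshelve. all: by end_near. Qed.

Lemma continuous_forP (u : V -> R) x : {for x, continuous u} <->
  forall e : R, 0 < e -> exists2 d : R, 0 < d & forall y, `|y - x| < d -> `|u y - u x| < e.
Proof.
rewrite /continuous_at; split.
  move=> /cvg_eps h e e0; have /nbhs_ballP[d /= d0 dh] := h e e0.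
  exists d => // y yx; apply: dh; rewrite -ball_normE /=.
  by rewrite distrC.
move=> h; apply/cvg_eps => e e0; have [d d0 dh] := h e e0.
apply/nbhs_ballP; exists d => //= y; rewrite -ball_normE /= distrC; exact: dh.
Qed.

Lemma is_derive_epsP u x v (l : R) : is_derive x v u l <->
  forall e : R, 0 < e -> exists2 d : R, 0 < d &
    forall h : R, h != 0 -> `|h| < d -> `|h^-1 * (u (h *: v + x) - u x) - l| < e.
Proof.
split.
  case=> dv <- e e0.
  have /cvgrPdist_lt /(_ e e0) : h^-1 *: ((u \o shift x) (h *: v) - u x) @[h --> 0^'] --> 'D_v u x by [].
  move=> /nbhs_ballP [d /= d0 dh]; exists d => // h h0 hd.
  rewrite distrC; apply: dh => //; rewrite -ball_normE /= sub0r normrN //.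
move=> H.
have C : h^-1 *: ((u \o shift x) (h *: v) - u x) @[h --> 0^'] --> l.
  apply/cvgrPdist_lt => e e0; have [d d0 dh] := H e e0.
  apply/nbhs_ballP; exists d => //= h; rewrite -ball_normE /= sub0r normrN => hd h0.
  by rewrite distrC; apply: dh.
apply: DeriveDef; first by apply/cvg_ex; exists l.
exact/cvg_lim.
Qed.

Lemma is_derive_line u x v (t0 l : R) :
  is_derive (x + t0 *: v) v u l -> is_derive t0 (1 : R) (fun t => u (x + t *: v)) l.
Proof.
move=> /is_derive_epsP H.
have C : h^-1 *: (((fun t => u (x + t *: v)) \o shift t0) (h *: (1:R)) - u (x + t0 *: v)) @[h --> 0^'] --> l.
  apply/cvgrPdist_lt => e e0; have [d d0 dh] := H e e0.
  apply/nbhs_ballP; exists d => //= h; rewrite -ball_normE /= sub0r normrN => hd h0.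
  rewrite distrC; have := dh h h0 hd.
  rewrite addrCA -scalerDl [h%:A]mulr1; exact.
apply: DeriveDef; first by apply/cvg_ex; exists l.
exact/cvg_lim.
Qed.

Lemma MVT_line u (u1 : V -> R) x v (c : R) :
  (forall t : R, `|t| <= `|c| -> is_derive (x + t *: v) v u (u1 (x + t *: v))) ->
  exists2 t : R, `|t| <= `|c| & u (x + c *: v) - u x = c * u1 (x + t *: v).
Proof.
move=> H.
have D (t : R) : `|t| <= `|c| -> is_derive t (1 : R) (fun s => u (x + s *: v)) (u1 (x + t *: v)).
  by move=> tc; apply/is_derive_line/H.
have [c0|c0] := leP 0 c.
  have [||t tc E] := @MVT_segment R (fun s => u (x + s *: v)) (fun t => u1 (x + t *: v)) 0 c c0.
  - move=> t; rewrite in_itv /= => /andP[t0 tc]; apply: D.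
    by rewrite ger0_norm ?ger0_norm // ltW.
  - apply: derivable_within_continuous => t; rewrite in_itv /= => /andP[t0 tc].
    by apply: (@ex_derive _ _ _ _ _ _ _ (D t _)); rewrite ger0_norm ?ger0_norm.
  move: tc; rewrite in_itv /= => /andP[t0 tc].
  exists t; first by rewrite ger0_norm ?ger0_norm.
  by move: E; rewrite scale0r addr0 subr0 mulrC.
have [||t tc E] := @MVT_segment R (fun s => u (x + s *: v)) (fun t => u1 (x + t *: v)) c 0 (ltW c0).
- move=> t; rewrite in_itv /= => /andP[t0 tc]; apply: D.
  by rewrite (ltr0_norm c0) ltr0_norm // lerN2 ltW.
- apply: derivable_within_continuous => t; rewrite in_itv /= => /andP[t0 tc].
  apply: (@ex_derive _ _ _ _ _ _ _ (D t _)). by rewrite (ltr0_norm c0) ler0_norm ?lerN2.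
move: tc; rewrite in_itv /= => /andP[t0 tc].
exists t; first by rewrite (ltr0_norm c0) ler0_norm ?lerN2.
move: E; rewrite scale0r addr0 sub0r => E.
by rewrite -opprB E; ring.
Qed.

(** Rolle's theorem for the even part of u along the line, followed by the mean value theorem for
    [u1]. Only the existence of the second derivative along the line is used, not its continuity. *)
Lemma second_difference u (u1 u2 : V -> R) x v (h : R) : 0 < h ->
  (forall t : R, `|t| <= h -> is_derive (x + t *: v) v u (u1 (x + t *: v))) ->
  (forall t : R, `|t| <= h -> is_derive (x + t *: v) v u1 (u2 (x + t *: v))) ->
  exists2 t : R, `|t| <= h &
    u (x + h *: v) + u (x - h *: v) - 2 * u x = h ^+ 2 * u2 (x + t *: v).
Proof.
move=> h0 H1 H2.
(* A is the coefficient for which the auxiliary function F takes equal values at 0 and h. *)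
pose A := (u (x + h *: v) + u (x - h *: v) - 2 * u x) / h ^+ 2.
pose F := fun t : R => u (x + t *: v) + u (x + t *: (- v)) - A * t ^+ 2.
pose dF := fun t : R => u1 (x + t *: v) - u1 (x + t *: (- v)) - A * (2 * t).
have H1N (t : R) : `|t| <= h -> is_derive (x + t *: (- v)) (- v) u (- u1 (x + t *: (- v))).
  move=> th; have /is_derive_epsP H := H1 (- t) ltac:(by rewrite normrN).
  apply/is_derive_epsP => e e0; have [d d0 dh] := H e e0; exists d => // k k0 kd.
  have := dh (- k) ltac:(by rewrite oppr_eq0) ltac:(by rewrite normrN).
  rewrite !scaleNr !scalerN invrN -normrN opprB [in X in X -> _]mulNr opprK.
  by rewrite opprK addrC.
have D (t : R) : `|t| <= h -> is_derive t (1 : R) F (dF t).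
  move=> th.
  have d1 := is_derive_line (H1 t th).
  have d2 := is_derive_line (H1N t th).
  have d3 : is_derive t (1 : R) (fun s : R => A * s ^+ 2) (A * (2 * t)).
    have : is_derive t (1 : R) (A *: (@id R) ^+ 2) (A * (2 * t)).
      by apply: is_derive_eq; rewrite /GRing.scale /= expr1 mulr1.
    by [].
  exact: is_deriveB.
have D1 (t : R) : `|t| <= h -> derivable F t 1 by move=> /D[].
have [||s shh E] := @MVT R F dF 0 h h0.
- move=> t; rewrite in_itv /= => /andP[t0 tc]; apply: D.
  by rewrite ger0_norm // ltW.
- apply: derivable_within_continuous => t; rewrite in_itv /= => /andP[t0 tc].
  by apply: D1; rewrite ger0_norm.
move: shh; rewrite in_itv /= => /andP[s0 sh].
have dFs : dF s = 0.
  have : F h - F 0 = 0.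
    rewrite /F /A !scale0r !addr0 scalerN expr0n /= mulr0 subr0.
    rewrite divfK ?expf_neq0 ?gt_eqF //; ring.
  by move/eqP: E => /[swap] ->; rewrite subr0 eq_sym mulf_eq0 (gt_eqF h0) orbF => /eqP.
have [||r rs E2] := @MVT R (fun t => u1 (x + t *: v)) (fun t => u2 (x + t *: v)) (- s) s ltac:(lra).
- move=> t; rewrite in_itv /= => /andP[t0 tc]; apply/is_derive_line/H2.
  rewrite ler_norml; lra.
- apply: derivable_within_continuous => t; rewrite in_itv /= => /andP[t0 tc].
  apply: (@ex_derive _ _ _ _ _ _ _ (is_derive_line (H2 t _))).
  rewrite ler_norml; lra.
move: rs; rewrite in_itv /= => /andP[r0 rs].
exists r; first by rewrite ler_norml; lra.
have : A = u2 (x + r *: v).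
  move: dFs; rewrite /dF scalerN -scaleNr E2 => /eqP; rewrite opprK.
  have -> : u2 (x + r *: v) * (s + s) - A * (2 * s) = (2 * s) * (u2 (x + r *: v) - A) by ring.
  rewrite mulf_eq0 mulf_eq0 (gt_eqF s0) pnatr_eq0 /= subr_eq0 => /eqP ->; ring.
by move=> <-; rewrite /A mulrCA mulfV ?mulr1 // expf_neq0 ?gt_eqF.
Qed.

End LineCalculus.

Section PointwiseContinuity.
Variables (R : realType) (T : topologicalType) (x : T) (f g : T -> R).
Hypotheses (cf : {for x, continuous f}) (cg : {for x, continuous g}).

Lemma continuous_forD : {for x, continuous (fun y => f y + g y)}.
Proof. exact: (continuousD cf cg). Qed.

Lemma continuous_forM : {for x, continuous (fun y => f y * g y)}.
Proof. exact: (continuousM cf cg). Qed.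

Lemma continuous_forZ (a : R) : {for x, continuous (fun y => a * f y)}.
Proof. apply: (@continuousM R T (fun=> a)) => //; exact: cst_continuous. Qed.

End PointwiseContinuity.

(** * Compactness arguments *)

Section CompactUniform.
Variables (R : realType) (V : normedModType R).
Implicit Types (K O : set V) (u : V -> R).

Lemma compact_near_diag K (Q : V -> V -> Prop) : compact K ->
  (forall x, K x -> exists2 d : R, 0 < d &
     forall y z, `|y - x| < d -> `|z - x| < d -> Q y z) ->
  exists2 d : R, 0 < d & forall x y, K x -> `|y - x| < d -> Q x y.
Proof.
move=> /compact_near_coveringP cK H.
have [|d /= d0 Hd] := cK R (0 : R)^'+ (fun (d : R) x => forall y, `|y - x| < d -> Q x y) _.
  move=> x Kx; have [d d0 dh] := H x Kx.
  exists (ball x (d / 2), [set r : R | r < d / 2]) => /=.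
    split; first by apply: nbhsx_ballx; lra.
    by apply: nbhs_right_lt; lra.
  case=> y r [/= + rd] z zy; rewrite -ball_normE /= => xy.
  apply: dh; first by rewrite distrC; lra.
  have := ler_distD y z x; rewrite (distrC y x); lra.
exists (d / 2); first lra.
move=> x y Kx yx; apply: (Hd (d / 2)) => //=.
  rewrite sub0r normrN ger0_norm; lra.
lra.
Qed.

Lemma compact_open_margin K O : compact K -> open O -> K `<=` O ->
  exists2 d : R, 0 < d & forall x y, K x -> `|y - x| < d -> O y.
Proof.
move=> cK oO KO; apply: (compact_near_diag (Q := fun _ y => O y)) => // x Kx.
have : nbhs x O by exact: open_nbhs_nbhs (conj oO (KO _ Kx)).
move=> /nbhs_ballP[d /= d0 dO]; exists d => // y z _ zx; apply: dO.
by rewrite -ball_normE /= distrC.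
Qed.

Lemma compact_uniform K u : compact K -> (forall x, K x -> {for x, continuous u}) ->
  forall e : R, 0 < e ->
  exists2 d : R, 0 < d & forall x y, K x -> `|y - x| < d -> `|u y - u x| < e.
Proof.
move=> cK cu e e0.
apply: (compact_near_diag (Q := fun x y => `|u y - u x| < e)) => // x Kx.
have /continuous_forP /(_ (e / 2)) [|d d0 dh] := cu x Kx; first lra.
exists d => // y z /dh yx /dh zx.
have := ler_distD (u x) (u z) (u y); rewrite (distrC (u x) (u y)); lra.
Qed.

Lemma compact_max K u : compact K -> (forall x, K x -> {for x, continuous u}) ->
  K !=set0 -> exists2 x, K x & forall y, K y -> u y <= u x.
Proof.
move=> cK cu K0; have [|x] := @compact_EVT_max V R u K K0 cK _.
  by apply: continuous_in_subspaceT => x; rewrite inE; exact: cu.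
rewrite inE => Kx H; exists x => // y Ky; apply: H; rewrite inE //.
Qed.

Lemma compact_min_pos K u : compact K -> (forall x, K x -> {for x, continuous u}) ->
  (forall x, K x -> 0 < u x) -> exists2 m : R, 0 < m & forall x, K x -> m <= u x.
Proof.
move=> cK cu up; have [K0|K0] := pselect (K !=set0); last first.
  by exists 1 => // x Kx; case: K0; exists x.
have [x Kx H] := compact_max (u := fun x => - u x) cK (fun x Kx => continuousN (cu x Kx)) K0.
by exists (u x); [exact: up | move=> y /H; rewrite lerN2].
Qed.

Lemma compact_bounded_fun K u : compact K -> (forall x, K x -> {for x, continuous u}) ->
  exists2 M : R, 0 < M & forall x, K x -> `|u x| <= M.
Proof.
move=> cK cu; have [K0|K0] := pselect (K !=set0); last first.
  by exists 1 => // x Kx; case: K0; exists x.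
have [|x Kx H] := compact_max (u := fun x => `|u x|) cK _ K0.
  move=> x Kx; apply: (continuous_comp (cu x Kx)); exact: norm_continuous.
exists (`|u x| + 1); first by rewrite ltr_wpDl.
by move=> y /H; lra.
Qed.

Lemma compact_norm_bounded K : compact K -> exists2 A : R, 0 < A & forall x, K x -> `|x| <= A.
Proof.
move=> cK; have [|A A0 H] := @compact_bounded_fun K (fun x => `|x|) cK.
  by move=> x _; exact: norm_continuous.
by exists A => // x /H; rewrite normr_id.
Qed.

End CompactUniform.

(** * Partial derivatives, the discrete Laplacian and the maximum principle *)

Section RowVectors.
Variables (R : realType) (d : nat).
Local Notation V := 'rV[R]_d.
Local Notation e_ i := (delta_mx ord0 i : V).
Implicit Types (K O : set V) (x y v w : V).

Lemma rv_norm_le x (r : R) : 0 <= r -> (`|x| <= r) <-> (forall i, `|x ord0 i| <= r).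
Proof.
move=> r0; have -> : `|x| = \big[Order.max/0]_ij `|x ij.1 ij.2| by rewrite {1}/Num.norm /= mx_normrE.
split.
  move=> /bigmax_leP[_ H] i; exact: (H (ord0, i)).
by move=> H; apply/bigmax_leP; split => // -[i j] _ /=; rewrite (ord1 i).
Qed.

Lemma rv_coord_le x i : `|x ord0 i| <= `|x|.
Proof. by have /rv_norm_le := lexx `|x|; apply. Qed.

Lemma rv_norm_axis i : `|e_ i| = 1.
Proof.
apply/eqP; rewrite eq_le; apply/andP; split.
  apply/rv_norm_le => // j; rewrite mxE eqxx /=; case: eqP; rewrite ?normr1 ?normr0 //.
by have := rv_coord_le (e_ i) i; rewrite mxE !eqxx normr1.
Qed.

Lemma bounded_closed_compact_rv K (A : R) :
  (forall x, K x -> `|x| <= A) -> closed K -> compact K.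
Proof.
move=> KA cK; apply: bounded_closed_compact => //.
exists A; split; first exact: num_real.
by move=> M AM x Kx; apply: le_trans (ltW AM); exact: KA.
Qed.

Lemma C1_expansion (u : V -> R) (u1 : 'I_d -> V -> R) x :
  (exists2 r : R, 0 < r & forall y, `|y - x| < r -> forall i, is_derive y (e_ i) u (u1 i y)) ->
  (forall i, {for x, continuous (u1 i)}) ->
  forall e : R, 0 < e -> exists2 r : R, 0 < r & forall w, `|w| < r ->
    `|u (x + w) - u x - \sum_i w ord0 i * u1 i x| <= e * `|w|.
Proof.
move=> [r r0 ur] cu e e0.
have [d0 dpos dh] : exists2 s : R, 0 < s &
    forall i y, `|y - x| < s -> `|u1 i y - u1 i x| < e / d.+1%:R.
  have H i : exists s : R, 0 < s /\ forall y, `|y - x| < s -> `|u1 i y - u1 i x| < e / d.+1%:R.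
    have /continuous_forP /(_ (e / d.+1%:R)) [|s s0 sh] := cu i; first by rewrite divr_gt0.
    by exists s.
  have [s sP] := choice H.
  exists (\big[Order.min/1]_i s i).
    by apply: lt_bigmin => // i _; case: (sP i).
  move=> i y yx; apply: (sP i).2; apply: lt_le_trans yx _.
  by rewrite (bigminD1 i) // ge_min lexx.
exists (Num.min r d0); first by rewrite lt_min r0 dpos.
move=> w; rewrite lt_min => /andP[wr wd].
(* The point [z k] has the first k coordinates of x + w and the remaining ones of x, so consecutive
   points differ along one axis and the mean value theorem applies to each increment. *)
pose z k : V := x + \row_i (if (i < k)%N then w ord0 i else 0).
have z0 : z 0%N = x by rewrite /z; apply/rowP => i; rewrite !mxE addr0.
have zd : z d = x + w by rewrite /z; apply/rowP => i; rewrite !mxE ltn_ord.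
have zS (i : 'I_d) : z i.+1 = z i + w ord0 i *: e_ i.
  apply/rowP => j; rewrite !mxE eqxx /= ltnS -addrA; congr (_ + _).
  case: (ltngtP j i) => [ji|ji|/val_inj ->].
  - have -> : (j == i) = false by apply/eqP => E; rewrite E ltnn in ji.
    by rewrite mulr0 addr0.
  - have -> : (j == i) = false by apply/eqP => E; rewrite E ltnn in ji.
    by rewrite mulr0 addr0.
  - by rewrite eqxx mulr1 add0r.
have zin (i : 'I_d) (t : R) : `|t| <= `|w ord0 i| -> `|z i + t *: e_ i - x| <= `|w|.
  move=> tw; apply/rv_norm_le => // j; rewrite !mxE eqxx /=.
  case: (ltngtP j i) => [ji|ji|/val_inj ->].
  - have -> : (j == i) = false by apply/eqP => E; rewrite E ltnn in ji.
    rewrite mulr0 addr0 addrC addKr; exact: rv_coord_le.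
  - have -> : (j == i) = false by apply/eqP => E; rewrite E ltnn in ji.
    by rewrite mulr0 !addr0 subrr normr0.
  - rewrite eqxx mulr1 addr0 addrC addKr; apply: le_trans tw _; exact: rv_coord_le.
have E : u (x + w) - u x = \sum_(i < d) (u (z i.+1) - u (z i)).
  have -> : u x = u (z 0%N) by rewrite z0.
  by rewrite -zd -(telescope_sumr (fun k => u (z k))) // big_mkord.
rewrite E -sumrB.
apply: (@le_trans _ _ (\sum_(i < d) (e / d.+1%:R * `|w|))); last first.
  rewrite sumr_const card_ord -[_ *+ d]mulr_natl mulrA ler_wpM2r //.
  rewrite mulrCA ler_piMr ?(ltW e0) // ler_pdivrMr ?mul1r ?ler_nat //.
apply: le_trans (ler_norm_sum _ _ _) _; apply: ler_sum => i _.
have [t tw Et] : exists2 t : R, `|t| <= `|w ord0 i| &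
    u (z i + w ord0 i *: e_ i) - u (z i) = w ord0 i * u1 i (z i + t *: e_ i).
  apply: MVT_line => t tw; apply: ur; exact: le_lt_trans (zin i t tw) _.
rewrite zS Et -mulrBr normrM mulrC ler_pM //; last exact: rv_coord_le.
by apply/ltW/dh; exact: le_lt_trans (zin i t tw) _.
Qed.

(** Pure second derivatives along the axes are all that the discrete Laplacian sees. The derivatives
    are explicit functions rather than limits, so that formulas for glued radial profiles can be
    supplied directly. *)
Definition axis_C2 O (u : V -> R) (u1 u2 : 'I_d -> V -> R) := forall x, O x ->
  {for x, continuous u} /\
  forall i, [/\ is_derive x (e_ i) u (u1 i x), is_derive x (e_ i) (u1 i) (u2 i x)
             & {for x, continuous (u2 i)}].

(** Mixed derivatives enter only because an orthogonal change of variables mixes the axes. *)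
Definition full_C2 O (u : V -> R) (u1 : 'I_d -> V -> R) (u2 : 'I_d -> 'I_d -> V -> R) :=
  forall x, O x -> forall i,
  [/\ is_derive x (e_ i) u (u1 i x), {for x, continuous (u1 i)},
      forall j, is_derive x (e_ j) (u1 i) (u2 i j x)
    & forall j, {for x, continuous (u2 i j)}].

Lemma open_ball O x : open O -> O x -> exists2 r : R, 0 < r & forall y, `|y - x| < r -> O y.
Proof.
move=> oO Ox; have /nbhs_ballP[r /= r0 rO] : nbhs x O by exact: open_nbhs_nbhs.
by exists r => // y yx; apply: rO; rewrite -ball_normE /= distrC.
Qed.

Lemma C1_continuous (u : V -> R) (u1 : 'I_d -> V -> R) x :
  (exists2 r : R, 0 < r & forall y, `|y - x| < r -> forall i, is_derive y (e_ i) u (u1 i y)) ->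
  (forall i, {for x, continuous (u1 i)}) -> {for x, continuous u}.
Proof.
move=> ur cu; apply/continuous_forP => e e0.
have [r r0 H] := C1_expansion ur cu (ltr01).
pose C := 1 + \sum_i `|u1 i x|.
have C1 : 1 <= C by rewrite lerDl sumr_ge0.
exists (Num.min r (e / C)); first by rewrite lt_min r0 divr_gt0 //; lra.
move=> y; rewrite lt_min => /andP[yr ye].
have := H _ yr; rewrite addrCA subrr addr0 mul1r => h.
apply: (@le_lt_trans _ _ (C * `|y - x|)); last first.
  by rewrite mulrC -ltr_pdivlMr //; lra.
rewrite mulrDl mul1r.
set S := \sum_i _ in h.
have -> : u y - u x = (u y - u x - S) + S by rewrite subrK.
apply: le_trans (ler_normD _ _) _; apply: lerD => //.
rewrite mulr_suml; apply: le_trans (ler_norm_sum _ _ _) _.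
by apply: ler_sum => i _; rewrite normrM mulrC ler_wpM2l // rv_coord_le.
Qed.

Lemma C1_derive (u : V -> R) (u1 : 'I_d -> V -> R) x v :
  (exists2 r : R, 0 < r & forall y, `|y - x| < r -> forall i, is_derive y (e_ i) u (u1 i y)) ->
  (forall i, {for x, continuous (u1 i)}) ->
  is_derive x v u (\sum_i v ord0 i * u1 i x).
Proof.
move=> ur cu; apply/is_derive_epsP => e e0.
have v0 : 0 < `|v| + 1 by rewrite ltr_wpDl.
have [|r r0 H] := C1_expansion ur cu (e := e / (2 * (`|v| + 1))); first by rewrite divr_gt0 // mulr_gt0.
exists (r / (`|v| + 1)); first by rewrite divr_gt0.
move=> h h0; rewrite ltr_pdivlMr // => hr.
have hv : `|h *: v| < r.
  by apply: le_lt_trans hr; rewrite normrZ ler_wpM2l // lerDl.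
have := H _ hv; rewrite [x + _]addrC => Hh.
have -> : h^-1 * (u (h *: v + x) - u x) - \sum_i v ord0 i * u1 i x =
   h^-1 * (u (h *: v + x) - u x - \sum_i (h *: v) ord0 i * u1 i x).
  rewrite [RHS]mulrBr; congr (_ - _); rewrite mulr_sumr; apply: eq_bigr => i _.
  by rewrite mxE -!mulrA mulKf.
rewrite normrM normfV mulrC ltr_pdivrMr ?normr_gt0 //.
apply: (le_lt_trans Hh).
have h0' : 0 < `|h| by rewrite normr_gt0.
rewrite normrZ [ltLHS]mulrCA [ltRHS]mulrC (ltr_pM2l h0').
rewrite mulrAC ltr_pdivrMr ?mulr_gt0 // ltr_pM2l //; have := normr_ge0 v; lra.
Qed.

Lemma full_C2_axis O (u : V -> R) u1 u2 : open O -> full_C2 O u u1 u2 ->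
  axis_C2 O u u1 (fun i => u2 i i).
Proof.
move=> oO H x Ox; split.
  apply: (@C1_continuous u u1) => [|i]; last by case: (H x Ox i).
  have [r r0 rO] := open_ball oO Ox; exists r => // y yx i.
  by case: (H y (rO y yx) i).
by move=> i; case: (H x Ox i).
Qed.

Lemma axis_C2_sub O O' (u : V -> R) u1 u2 : O' `<=` O -> axis_C2 O u u1 u2 -> axis_C2 O' u u1 u2.
Proof. by move=> sub H x /sub; exact: H. Qed.

Lemma axis_C2_lin O (u v : V -> R) u1 u2 (v1 v2 : 'I_d -> V -> R) (a b : R) :
  axis_C2 O u u1 u2 -> axis_C2 O v v1 v2 ->
  axis_C2 O (fun x => a * u x + b * v x) (fun i x => a * u1 i x + b * v1 i x)
    (fun i x => a * u2 i x + b * v2 i x).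
Proof.
move=> Hu Hv x Ox; have [cu du] := Hu x Ox; have [cv dv] := Hv x Ox.
have C (f g : V -> R) : {for x, continuous f} -> {for x, continuous g} ->
    {for x, continuous (fun x => a * f x + b * g x)}.
  by move=> cf cg; apply: continuous_forD; exact: continuous_forZ.
have D (f g : V -> R) i f' g' : is_derive x (e_ i) f f' -> is_derive x (e_ i) g g' ->
    is_derive x (e_ i) (fun x => a * f x + b * g x) (a * f' + b * g').
  move=> df dg; have : is_derive x (e_ i) (a *: f + b *: g) (a *: f' + b *: g') by exact: is_deriveD.
  by [].
split; first exact: C.
move=> i; have [du1 du2 cu2] := du i; have [dv1 dv2 cv2] := dv i.
by split; [exact: D|exact: D|exact: C].
Qed.

Lemma axis_C2_cst O (c : R) : axis_C2 O (fun=> c) (fun _ _ => 0) (fun _ _ => 0).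
Proof.
move=> x _; split; first exact: cst_continuous.
by move=> i; split; [exact: is_derive_cst|exact: is_derive_cst|exact: cst_continuous].
Qed.

Definition dlap (h : R) (u : V -> R) x : R :=
  h ^- 2 * \sum_i (u (x + h *: e_ i) + u (x - h *: e_ i) - 2 * u x).

(** Each second difference is exactly a second derivative at a point within h of x; uniform
    continuity of [u2 i] near K then gives a rate independent of x. *)
Lemma dlap_uniform O K (u : V -> R) u1 u2 : open O -> compact K -> K `<=` O ->
  axis_C2 O u u1 u2 -> forall e : R, 0 < e ->
  exists2 r : R, 0 < r & forall h x, 0 < h -> h < r -> K x ->
    `|dlap h u x - \sum_i u2 i x| <= e.
Proof.
move=> oO cK KO Hu e e0.
have [r0 r00 rO] := compact_open_margin cK oO KO.
have H i : exists s : R, 0 < s /\ forall x y, K x -> `|y - x| < s -> `|u2 i y - u2 i x| < e / d.+1%:R.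
  have [||s s0 sh] := @compact_uniform _ _ K (u2 i) cK _ (e / d.+1%:R).
  - by move=> x /KO /Hu [_ /(_ i)[]].
  - by rewrite divr_gt0.
  by exists s.
have [s sP] := choice H.
exists (Num.min r0 (\big[Order.min/1]_i s i)).
  by rewrite lt_min r00; apply: lt_bigmin => // i _; case: (sP i).
move=> h x h0; rewrite lt_min => /andP[hr hs] Kx.
have near i (t : R) : `|t| <= h -> `|x + t *: e_ i - x| <= h.
  by move=> th; rewrite addrC addKr normrZ rv_norm_axis mulr1.
have inO i (t : R) : `|t| <= h -> O (x + t *: e_ i).
  by move=> /(near i) th; apply: (rO x) => //; exact: le_lt_trans hr.
rewrite /dlap mulr_sumr -sumrB.
apply: le_trans (ler_norm_sum _ _ _) _.
apply: (@le_trans _ _ (\sum_(i < d) (e / d.+1%:R))); last first.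
  rewrite sumr_const card_ord -[_ *+ d]mulr_natl mulrCA ler_piMr ?(ltW e0) //.
  by rewrite ler_pdivrMr ?mul1r ?ler_nat.
apply: ler_sum => i _.
have [||t th ->] := @second_difference R V u (u1 i) (u2 i) x (e_ i) h h0.
- by move=> t /(inO i) /Hu [_ /(_ i)[]].
- by move=> t /(inO i) /Hu [_ /(_ i)[]].
rewrite mulKf ?expf_neq0 ?gt_eqF //; apply: ltW; apply: (sP i).2 => //.
apply: le_lt_trans (near i t th) _; apply: lt_le_trans hs _.
by rewrite (bigminD1 i) // ge_min lexx.
Qed.

Definition sqn x : R := \sum_i x ord0 i ^+ 2.

Lemma sqn_continuous : continuous sqn.
Proof.
rewrite /sqn; elim: (index_enum _) => [|i s IH] x.
  rewrite (_ : (fun _ => _) = cst 0); first exact: cst_continuous.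
  by apply/funext => y; rewrite big_nil.
rewrite (_ : (fun _ => _) = (fun y : V => y ord0 i * y ord0 i + \sum_(j <- s) y ord0 j ^+ 2)).
  apply: (continuous_forD (f := fun y => y ord0 i * y ord0 i)); last exact: IH.
  by apply: (continuous_forM (f := fun y : V => y ord0 i)); exact: coord_continuous.
by apply/funext => y; rewrite big_cons expr2.
Qed.

Lemma dlap_sqn h x : h != 0 -> dlap h sqn x = 2 * d%:R.
Proof.
move=> h0; rewrite /dlap.
have E i : sqn (x + h *: e_ i) + sqn (x - h *: e_ i) - 2 * sqn x = 2 * h ^+ 2.
  rewrite /sqn -big_split /= mulr_sumr -sumrB (bigD1 i) //= big1.
    by rewrite !mxE !eqxx mulr1 addr0; ring.
  move=> j ji; rewrite !mxE eqxx (negbTE ji) /= mulr0; ring.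
under eq_bigr do rewrite E.
rewrite sumr_const card_ord -mulr_natr; field.
by rewrite h0.
Qed.

Lemma dlapD h (u v : V -> R) x (a b : R) :
  dlap h (fun y => a * u y + b * v y) x = a * dlap h u x + b * dlap h v x.
Proof.
rewrite /dlap !(mulrCA _ (h ^- 2)) -mulrDr; congr (_ * _).
rewrite !mulr_sumr -big_split /=; apply: eq_bigr => i _; ring.
Qed.

(** At an interior maximum every second difference is nonpositive, while adding a small multiple of
    [sqn] makes the Laplacian strictly positive. The compactness condition on superlevel sets stands
    for boundary values at most 0, including those at infinity and at a removed pole. *)
Lemma max_principle O (u : V -> R) u1 u2 : (0 < d)%N -> open O -> axis_C2 O u u1 u2 ->
  (forall x, O x -> 0 <= \sum_i u2 i x) ->
  (forall e : R, 0 < e -> exists K, [/\ compact K, K `<=` O & forall x, O x -> e <= u x -> K x]) ->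
  forall x, O x -> u x <= 0.
Proof.
move=> dgt0 oO Hu lap0 HK a Oa; rewrite leNgt; apply/negP => ua.
have [K [cK KO KP]] := HK (u a / 2) ltac:(lra).
have Ka : K a by apply: KP => //; lra.
have [M M0 MK] := compact_bounded_fun (u := sqn) cK (fun x _ => @sqn_continuous x).
(* With this e the perturbation is at most [u a / 4] on K. Hence u exceeds [u a / 2] at the maximum
   b of F, and continuity puts a whole neighbourhood of b inside K. *)
pose e := u a / (4 * M).
have e0 : 0 < e by rewrite divr_gt0 // mulr_gt0.
pose F x := 1 * u x + e * sqn x.
have cF x : O x -> {for x, continuous F}.
  move=> /Hu[cu _]; apply: continuous_forD; apply: continuous_forZ => //.
  exact: sqn_continuous.
have [||b Kb bmax] := @compact_max _ _ K F cK.
- by move=> x /KO; exact: cF.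
- by exists a.
have sqn0 x : 0 <= sqn x by apply: sumr_ge0 => i _; exact: sqr_ge0.
have eM : e * M = u a / 4 by rewrite /e; field; rewrite gt_eqF.
have ub : u a / 2 < u b.
  have := bmax a Ka; rewrite /F !mul1r => Hb.
  have Mb : e * sqn b <= e * M by rewrite ler_pM2l // -[X in X <= _]ger0_norm // MK.
  have := mulr_ge0 (ltW e0) (sqn0 a); lra.
have Ob := KO _ Kb.
have [cub _] := Hu _ Ob.
have [r r0 rP] : exists2 r : R, 0 < r & forall y, `|y - b| < r -> K y.
  have [r1 r10 rO] := open_ball oO Ob.
  have /continuous_forP /(_ (u b - u a / 2)) [|r2 r20 rC] := cub; first lra.
  exists (Num.min r1 r2); first by rewrite lt_min r10.
  move=> y; rewrite lt_min => /andP[y1 y2]; apply: KP; first exact: rO.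
  have := rC y y2; rewrite ltr_norml => /andP[]; lra.
have cb : compact [set b] by exact: compact_set1.
have bO : [set b] `<=` O by move=> _ ->.
have [|s s0 sP] := dlap_uniform oO cb bO Hu (e := e / 2); first by rewrite divr_gt0.
pose h := Num.min r s / 2.
have rs0 : 0 < Num.min r s by rewrite lt_min r0.
have h0 : 0 < h by rewrite /h; lra.
have hr : h < r by rewrite /h; have : Num.min r s <= r by [rewrite ge_min lexx]; lra.
have hs : h < s by rewrite /h; have : Num.min r s <= s by [rewrite ge_min lexx orbT]; lra.
have := sP h b h0 hs erefl; have := lap0 b Ob => lb.
have : dlap h F b <= 0.
  rewrite /dlap pmulr_rle0 ?exprn_gt0 ?invr_gt0 ?exprn_gt0 //.
  apply: sumr_le0 => i _.
  have N (t : R) : `|t| = h -> K (b + t *: e_ i).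
    by move=> th; apply: rP; rewrite addrC addKr normrZ rv_norm_axis mulr1 th.
  have B1 := bmax _ (N h (gtr0_norm h0)).
  have B2 := bmax _ (N (- h) (etrans (normrN _) (gtr0_norm h0))).
  move: B2; rewrite scaleNr; lra.
rewrite dlapD dlap_sqn ?gt_eqF // mul1r => L.
rewrite ler_norml => /andP[L2 _].
have : 1 <= d%:R :> R by rewrite ler1n.
nra.
Qed.

End RowVectors.

(** * The Newton kernel and its smoothing *)

Section Glue.
Variable R : realType.
Implicit Types (f g : R -> R) (c s l : R).

Definition glue c f g := fun s : R => if c <= s then f s else g s.

Lemma glue_near_right c f g s : c < s -> \forall t \near s, f t = glue c f g t.
Proof.
move=> cs; near=> t; rewrite /glue ifT //; apply: ltW; near: t.
exact: lt_nbhsr.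
Unshelve. all: by end_near. Qed.

Lemma glue_near_left c f g s : s < c -> \forall t \near s, g t = glue c f g t.
Proof.
move=> cs; near=> t; rewrite /glue ifF //; apply/negbTE; rewrite -ltNge; near: t.
exact: lt_nbhsl.
Unshelve. all: by end_near. Qed.

Lemma glue_derive c f g df dg s :
  (c <= s -> is_derive s (1 : R) f (df s)) -> (s <= c -> is_derive s (1 : R) g (dg s)) ->
  f c = g c -> df c = dg c -> is_derive s (1 : R) (glue c f g) (glue c df dg s).
Proof.
move=> Hf Hg fg dfg; case: (ltrgtP s c) => [sc|cs|sc].
- rewrite {2}/glue leNgt sc /=; apply: near_eq_is_derive (glue_near_left _ _ sc) _.
  exact/Hg/ltW.
- rewrite {2}/glue (ltW cs); apply: near_eq_is_derive (glue_near_right _ _ cs) _.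
  exact/Hf/ltW.
- subst s; rewrite {2}/glue lexx; apply/is_derive_epsP => e e0.
  have /is_derive_epsP /(_ e e0) [r r0 Hr] := Hf (lexx _).
  have /is_derive_epsP /(_ e e0) [t t0 Ht] := Hg (lexx _).
  exists (Num.min r t); first by rewrite lt_min r0.
  move=> h h0; rewrite lt_min => /andP[hr ht].
  rewrite /glue lexx; case: ifP => _; first exact: Hr.
  by rewrite fg dfg; exact: Ht.
Qed.

Lemma glue_continuous c f g s :
  (c <= s -> {for s, continuous f}) -> (s <= c -> {for s, continuous g}) ->
  f c = g c -> {for s, continuous (glue c f g)}.
Proof.
move=> Hf Hg fg; apply/continuous_forP => e e0; case: (ltrgtP s c) => [sc|cs|sc].
- have /continuous_forP /(_ e e0) [r r0 Hr] := Hg (ltW sc).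
  exists (Num.min r (c - s)); first by rewrite lt_min r0 subr_gt0.
  move=> y; rewrite lt_min => /andP[yr]; rewrite ltr_norml => /andP[y1 y2].
  rewrite /glue !ifF; first exact: Hr.
    by apply/negbTE; rewrite -ltNge.
  by apply/negbTE; rewrite -ltNge; lra.
- have /continuous_forP /(_ e e0) [r r0 Hr] := Hf (ltW cs).
  exists (Num.min r (s - c)); first by rewrite lt_min r0 subr_gt0.
  move=> y; rewrite lt_min => /andP[yr]; rewrite ltr_norml => /andP[y1 y2].
  rewrite /glue !ifT; first exact: Hr.
    exact: ltW.
  lra.
- subst s; have /continuous_forP /(_ e e0) [r r0 Hr] := Hf (lexx _).
  have /continuous_forP /(_ e e0) [t t0 Ht] := Hg (lexx _).
  exists (Num.min r t); first by rewrite lt_min r0.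
  move=> y; rewrite lt_min => /andP[hr ht].
  rewrite /glue lexx; case: ifP => _; first exact: Hr.
  by rewrite fg; exact: Ht.
Qed.

Lemma is_derive_sqrtVX (k : nat) s : 0 < s ->
  is_derive s (1 : R) (fun t => Num.sqrt t ^- k) (- (k%:R / 2) * Num.sqrt s ^- k.+2).
Proof.
move=> s0; have q0 : Num.sqrt s != 0 by rewrite gt_eqF // sqrtr_gt0.
have D1 : is_derive s (1 : R) Num.sqrt (2 * Num.sqrt s)^-1 by exact: is_derive1_sqrt.
have D2 : is_derive (Num.sqrt s) (1 : R) (fun t => t ^- k) (- k%:R * Num.sqrt s ^- k.+1).
  have E : @id R ^+ k = (fun t => t ^+ k) by apply/funext => t; rewrite exprfctE.
  have qk : (fun t : R => t ^+ k) (Num.sqrt s) != 0 by rewrite expf_neq0.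
  have Dk : derivable (fun t : R => t ^+ k) (Num.sqrt s) 1 by rewrite -E; exact: derivableX.
  have D : is_derive (Num.sqrt s) (1 : R) (fun t => (t ^+ k)^-1)
      (- (Num.sqrt s ^+ k) ^- 2 *: 'D_1 (fun t : R => t ^+ k) (Num.sqrt s)).
    by apply: DeriveDef; [exact: derivableV Dk|exact: deriveV Dk].
  apply: (is_derive_eq D).
  rewrite exp_derive /GRing.scale /= mulr1; case: k {E qk Dk D} => [|k].
    by rewrite !mul0r mulr0 oppr0 mul0r.
  rewrite /= !exprS; field.
  by rewrite expf_neq0 // q0.
have D3 := is_derive1_comp D2 D1.
apply: (is_derive_eq D3).
rewrite !exprS; field.
by rewrite expf_neq0 // q0.
Qed.

End Glue.

Section Radial.
Variables (R : realType) (d : nat).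
Local Notation V := 'rV[R]_d.
Local Notation e_ i := (delta_mx ord0 i : V).
Implicit Types (x a v : V).

Lemma is_derive_of_line (u : V -> R) x v (l : R) :
  is_derive (0 : R) (1 : R) (fun t => u (x + t *: v)) l -> is_derive x v u l.
Proof.
move=> /is_derive_epsP H; apply/is_derive_epsP => e /H[r r0 Hr]; exists r => // h h0 hr.
by have := Hr h h0 hr; rewrite addr0 scale0r addr0 [x + _]addrC [h%:A]mulr1.
Qed.

Lemma sqn_line x a i (t : R) :
  sqn (x + t *: e_ i - a) = sqn (x - a) + 2 * t * (x - a) ord0 i + t ^+ 2.
Proof.
rewrite /sqn (bigD1 i) //= [in RHS](bigD1 i) //=.
rewrite [X in _ + X = _](eq_bigr (fun j => (x - a) ord0 j ^+ 2)).
  by rewrite !mxE !eqxx mulr1; ring.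
by move=> j ji; rewrite !mxE eqxx (negbTE ji) /= mulr0 addr0.
Qed.

Lemma sqn_ge0 x : 0 <= sqn x.
Proof. by apply: sumr_ge0 => i _; exact: sqr_ge0. Qed.

Lemma sqn_sub_continuous a : continuous (fun x => sqn (x - a)).
Proof.
move=> x; apply: (continuous_comp (f := fun x : V => x - a)); last exact: sqn_continuous.
by apply: continuousD; [exact: cvg_id|exact: cst_continuous].
Qed.

(** Profiles are functions of the squared distance, which is a quadratic polynomial along every
    axis; the centre a thus needs no separate treatment. *)
Lemma radial_axis_C2 (O : set V) a (P P1 P2 : R -> R) :
  (forall x, O x -> [/\ is_derive (sqn (x - a)) (1 : R) P (P1 (sqn (x - a))),
     is_derive (sqn (x - a)) (1 : R) P1 (P2 (sqn (x - a))) & {for sqn (x - a), continuous P2}]) ->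
  axis_C2 O (fun x => P (sqn (x - a)))
    (fun i x => 2 * (x - a) ord0 i * P1 (sqn (x - a)))
    (fun i x => 2 * P1 (sqn (x - a)) + 4 * (x - a) ord0 i ^+ 2 * P2 (sqn (x - a))).
Proof.
move=> H x Ox; have [D1 D2 C2] := H x Ox.
have Dq i : is_derive (0 : R) (1 : R) (fun t => sqn (x - a) + 2 * t * (x - a) ord0 i + t ^+ 2)
    (2 * (x - a) ord0 i).
  apply/is_derive_epsP => e e0; exists e => // h h0 he.
  have -> : h^-1 * (sqn (x - a) + 2 * (h *: 1 + 0) * (x - a) ord0 i + (h *: 1 + 0) ^+ 2 -
    (sqn (x - a) + 2 * 0 * (x - a) ord0 i + 0 ^+ 2)) - 2 * (x - a) ord0 i = h.
    by rewrite addr0 [h *: 1]mulr1; field.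
  by [].
have Dcomp i (Q : R -> R) (l : R) : is_derive (sqn (x - a)) (1 : R) Q l ->
    is_derive x (e_ i) (fun x => Q (sqn (x - a))) (l * (2 * (x - a) ord0 i)).
  move=> DQ; apply: is_derive_of_line.
  under eq_fun do rewrite sqn_line.
  apply: (is_derive1_comp (f := Q)) => //.
  by rewrite mulr0 mul0r addr0 expr0n addr0.
have Dcoord i : is_derive x (e_ i) (fun x => 2 * (x - a) ord0 i) 2.
  apply/is_derive_epsP => e e0; exists e => // h h0 he.
  rewrite (_ : _ - 2 = 0) ?normr0 // !mxE !eqxx mulr1; by field.
have cont1 (Q : R -> R) (l : R) : is_derive (sqn (x - a)) (1 : R) Q l -> {for sqn (x - a), continuous Q}.
  by move=> [] /derivable1_diffP /differentiable_continuous.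
have cQ (Q : R -> R) : {for sqn (x - a), continuous Q} -> {for x, continuous (fun x => Q (sqn (x - a)))}.
  by move=> cQ; apply: continuous_comp => //; exact: sqn_sub_continuous.
have cx i : {for x, continuous (fun x => (x - a) ord0 i)}.
  rewrite (_ : (fun _ => _) = (fun x => x ord0 i + - a ord0 i)).
    by apply: continuous_forD; [exact: coord_continuous|exact: cst_continuous].
  by apply/funext => y; rewrite !mxE.
split; first exact: cQ (cont1 _ _ D1).
move=> i; split.
- by have := Dcomp i _ _ D1; rewrite mulrC.
- apply: (is_derive_eq (is_deriveM (Dcoord i) (Dcomp i _ _ D2))).
  rewrite /GRing.scale /=; ring.
- apply: continuous_forD; first by apply: continuous_forZ; apply: cQ; exact: (cont1 _ _ D2).
  apply: continuous_forM; last exact: cQ.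
  by apply: continuous_forZ; apply: continuous_forM.
Qed.

Lemma radial_laplacian a (P1 P2 : R -> R) x :
  \sum_i (2 * P1 (sqn (x - a)) + 4 * (x - a) ord0 i ^+ 2 * P2 (sqn (x - a))) =
  2 * d%:R * P1 (sqn (x - a)) + 4 * sqn (x - a) * P2 (sqn (x - a)).
Proof.
rewrite big_split /= sumr_const card_ord -[_ *+ d]mulr_natl -mulr_suml -mulr_sumr -/(sqn _).
ring.
Qed.

End Radial.

Section NewtonKernel.
Variables (R : realType) (k : nat).
Local Notation d := k.+2.
Local Notation V := 'rV[R]_d.
Implicit Types (x a : V) (s rho : R).

(** The Newton kernel of dimension d = k + 2 as a function of the squared distance s, that is, s to
    the power -k/2; the next two functions are its derivatives in s. *)
Definition newt0 s : R := Num.sqrt s ^- k.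
Definition newt1 s : R := - (k%:R / 2) * Num.sqrt s ^- k.+2.
Definition newt2 s : R := k%:R * k.+2%:R / 4 * Num.sqrt s ^- k.+4.

Lemma newt0_derive s : 0 < s -> is_derive s (1 : R) newt0 (newt1 s).
Proof. exact: is_derive_sqrtVX. Qed.

Lemma newt1_derive s : 0 < s -> is_derive s (1 : R) newt1 (newt2 s).
Proof.
move=> s0; apply: (is_derive_eq (is_deriveZ (- (k%:R / 2)) (is_derive_sqrtVX k.+2 s0))).
by rewrite /newt2 /GRing.scale /=; field; rewrite expf_neq0 // gt_eqF // sqrtr_gt0.
Qed.

Lemma newt2_continuous s : 0 < s -> {for s, continuous newt2}.
Proof.
move=> s0; apply: continuous_forZ.
by have [/derivable1_diffP /differentiable_continuous] := is_derive_sqrtVX k.+4 s0.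
Qed.

Definition newton a x : R := newt0 (sqn (x - a)).

Definition newton1 a (i : 'I_d) x : R := 2 * (x - a) ord0 i * newt1 (sqn (x - a)).
Definition newton2 a (i : 'I_d) x : R :=
  2 * newt1 (sqn (x - a)) + 4 * (x - a) ord0 i ^+ 2 * newt2 (sqn (x - a)).

Lemma sqn_gt0 x : x != 0 -> 0 < sqn x.
Proof.
move=> x0; rewrite lt_neqAle sqn_ge0 andbT eq_sym; apply: contraNN x0.
rewrite /sqn psumr_eq0; last by move=> i _; exact: sqr_ge0.
move=> /allP H; apply/eqP/rowP => i; apply/eqP.
by have := H i (mem_index_enum _); rewrite /= sqrf_eq0 mxE.
Qed.

Lemma newton_C2 a : axis_C2 [set x | x != a] (newton a) (newton1 a) (newton2 a).
Proof.
apply: radial_axis_C2 => x /= xa; have s0 : 0 < sqn (x - a) by apply: sqn_gt0; rewrite subr_eq0.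
by split; [exact: newt0_derive|exact: newt1_derive|exact: newt2_continuous].
Qed.

Lemma newton_harmonic a x : x != a -> \sum_i newton2 a i x = 0.
Proof.
move=> xa; rewrite radial_laplacian.
have s0 : 0 < sqn (x - a) by apply: sqn_gt0; rewrite subr_eq0.
have q0 : Num.sqrt (sqn (x - a)) != 0 by rewrite gt_eqF // sqrtr_gt0.
rewrite /newt1 /newt2 -[in 4 * _](sqr_sqrtr (ltW s0)).
move: (Num.sqrt _) q0 => q q0; rewrite !exprS; field.
by rewrite expf_neq0 // q0.
Qed.

(* The second order Taylor polynomial of [newt0] at [rho ^ 2], as a function
   of the squared distance; it makes the smoothed kernel C^2. *)
Definition smooth0 rho : R -> R := glue (rho ^+ 2) newt0 (fun s =>
  newt0 (rho ^+ 2) + newt1 (rho ^+ 2) * (s - rho ^+ 2)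
  + newt2 (rho ^+ 2) / 2 * (s - rho ^+ 2) ^+ 2).
Definition smooth1 rho : R -> R := glue (rho ^+ 2) newt1 (fun s =>
  newt1 (rho ^+ 2) + newt2 (rho ^+ 2) * (s - rho ^+ 2)).
Definition smooth2 rho : R -> R := glue (rho ^+ 2) newt2 (fun=> newt2 (rho ^+ 2)).

Lemma is_derive_quadratic (c0 c1 c2 r s : R) :
  is_derive s (1 : R) (fun t => c0 + c1 * (t - r) + c2 * (t - r) ^+ 2) (c1 + 2 * c2 * (s - r)).
Proof.
apply/is_derive_epsP => e e0; exists (e / (`|c2| + 1)).
  by rewrite divr_gt0 // ltr_wpDl.
move=> h h0; rewrite ltr_pdivlMr ?ltr_wpDl // => he.
rewrite (_ : _ - (c1 + _) = h * c2).
  by rewrite normrM; have := normr_ge0 h; nra.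
by rewrite [h%:A]mulr1; field.
Qed.

Definition newton_smooth rho a x : R := smooth0 rho (sqn (x - a)).
Definition newton_smooth1 rho a (i : 'I_d) x : R := 2 * (x - a) ord0 i * smooth1 rho (sqn (x - a)).
Definition newton_smooth2 rho a (i : 'I_d) x : R :=
  2 * smooth1 rho (sqn (x - a)) + 4 * (x - a) ord0 i ^+ 2 * smooth2 rho (sqn (x - a)).

Lemma newton_smooth_C2 rho a : 0 < rho ->
  axis_C2 setT (newton_smooth rho a) (newton_smooth1 rho a) (newton_smooth2 rho a).
Proof.
move=> r0; have r2 : 0 < rho ^+ 2 by rewrite exprn_gt0.
apply: radial_axis_C2 => x _; split.
- apply: glue_derive => [h|h||]; rewrite ?subrr ?expr0n /= ?mulr0 ?addr0 //.
    by apply: newt0_derive; exact: lt_le_trans h.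
  apply: (is_derive_eq (is_derive_quadratic (newt0 (rho ^+ 2)) (newt1 (rho ^+ 2)) (newt2 (rho ^+ 2) / 2) (rho ^+ 2) (sqn (x - a)))).
  by field.
- apply: (@glue_derive R (rho ^+ 2) newt1 _ newt2 (fun=> newt2 (rho ^+ 2))) => [h|h||]; last first.
  - by [].
  - by rewrite subrr mulr0 addr0.
  - have := is_derive_quadratic (newt1 (rho ^+ 2)) (newt2 (rho ^+ 2)) 0 (rho ^+ 2) (sqn (x - a)).
    rewrite mulr0 mul0r addr0.
    by under eq_fun do rewrite mul0r addr0.
  - by apply: newt1_derive; exact: lt_le_trans h.
- apply: glue_continuous => // h; first by apply: newt2_continuous; exact: lt_le_trans h.
  exact: cst_continuous.
Qed.

(** The density whose potential is the smoothed kernel, up to normalization: continuous, nonnegative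
    and supported in the ball of radius rho. *)
Definition source rho a x : R :=
  (2 * d%:R + 4) * newt2 (rho ^+ 2) * Num.max (rho ^+ 2 - sqn (x - a)) 0.

Lemma newton_smooth_laplacian rho a x : 0 < rho ->
  \sum_i newton_smooth2 rho a i x = - source rho a x.
Proof.
move=> r0; have r2 : 0 < rho ^+ 2 by rewrite exprn_gt0.
rewrite radial_laplacian /source /smooth1 /smooth2 /glue; case: (leP (rho ^+ 2)) => h.
  have xa : x != a.
    by apply: contraTN h => /eqP ->; rewrite subrr -ltNge /sqn big1 // => i _; rewrite mxE expr0n.
  have := newton_harmonic xa; rewrite radial_laplacian => ->.
  by rewrite max_r ?mulr0 ?oppr0 // subr_le0.
rewrite max_l; last by rewrite subr_ge0 ltW.
have q0 : rho != 0 by rewrite gt_eqF.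
(* Harmonicity of the Newton kernel at distance rho. It makes the Laplacian of the inner quadratic
   profile vanish on the sphere, so that the density is continuous there. *)
have -> : newt1 (rho ^+ 2) = - 2 * rho ^+ 2 / d%:R * newt2 (rho ^+ 2).
  rewrite /newt1 /newt2 sqrtr_sqr gtr0_norm // !exprS; field.
  by rewrite expf_neq0 ?q0 //= pnatr_eq0.
have dn0 : d%:R != 0 :> R by rewrite pnatr_eq0.
by move: (d%:R) dn0 => D D0; field.
Qed.

Lemma newton_smooth_far rho a x : rho ^+ 2 <= sqn (x - a) -> newton_smooth rho a x = newton a x.
Proof. by move=> h; rewrite /newton_smooth /smooth0 /glue h. Qed.

End NewtonKernel.

(** * Cutoff functions with explicit bounds *)

Section Cutoff.
Variables (R : realType).
Implicit Types (s t : R).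

Definition pos3 : R -> R := glue 0 (fun t => t ^+ 3) (fun=> 0).
Definition pos2 : R -> R := glue 0 (fun t => 3 * t ^+ 2) (fun=> 0).
Definition pos1 : R -> R := glue 0 (fun t => 6 * t) (fun=> 0).

Lemma pos3_derive t : is_derive t (1 : R) pos3 (pos2 t).
Proof.
apply: (@glue_derive R 0 (fun t => t ^+ 3) _ (fun t => 3 * t ^+ 2) (fun=> 0)).
- move=> _; have D := @is_deriveX R R id 3%N t (1 : R) (1 : R) (is_derive_id _ _).
  apply: (is_derive_eq D); rewrite /GRing.scale /=; ring.
- by rewrite expr0n.
- by rewrite expr0n mulr0.
Qed.

Lemma pos2_derive t : is_derive t (1 : R) pos2 (pos1 t).
Proof.
apply: (@glue_derive R 0 (fun t => 3 * t ^+ 2) _ (fun t => 6 * t) (fun=> 0)).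
- move=> _; have D := is_deriveZ (3 : R) (@is_deriveX R R id 2%N t (1 : R) (1 : R) (is_derive_id _ _)).
  apply: (is_derive_eq D); rewrite /GRing.scale /=; ring.
- by rewrite expr0n mulr0.
- by rewrite mulr0.
Qed.

Lemma pos1_continuous t : {for t, continuous pos1}.
Proof.
apply: glue_continuous => [_|_|]; rewrite ?mulr0 //; last exact: cst_continuous.
by apply: continuous_forZ; exact: cvg_id.
Qed.

(** The truncated cube [pos3] is C^2 at 0. The inner function [1 - pos3 (2 - s)] equals 1 for s >= 2
    and is nonpositive for s <= 1; the outer [pos3] flattens this lower end, which leaves 1 for s <=
    1 and 0 for s >= 2. Being piecewise polynomial, it has derivatives with numerical bounds. *)
Definition cutoff0 s : R := 1 - pos3 (1 - pos3 (2 - s)).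
Definition cutoff1 s : R := - (pos2 (1 - pos3 (2 - s)) * pos2 (2 - s)).
Definition cutoff2 s : R :=
  pos2 (1 - pos3 (2 - s)) * pos1 (2 - s) - pos1 (1 - pos3 (2 - s)) * pos2 (2 - s) ^+ 2.

Lemma derive_comp_of_line (f g : R -> R) (t l m : R) :
  is_derive t (1 : R) g m -> is_derive (g t) (1 : R) f l ->
  is_derive t (1 : R) (fun t => f (g t)) (l * m).
Proof. by move=> Dg Df; exact: (is_derive1_comp Df Dg). Qed.

Lemma derive_reflect c t : is_derive t (1 : R) (fun t => c - t) (- 1).
Proof.
apply/is_derive_epsP => e e0; exists 1 => // h h0 _.
by rewrite [h%:A]mulr1 (_ : _ - (- 1) = 0) ?normr0 //; field.
Qed.

Lemma cutoff_inner_derive s :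
  is_derive s (1 : R) (fun s => 1 - pos3 (2 - s)) (pos2 (2 - s)).
Proof.
have D := derive_comp_of_line (derive_reflect 2 s) (pos3_derive (2 - s)).
have E := derive_comp_of_line (g := fun s => pos3 (2 - s)) D (derive_reflect 1 _).
by apply: (is_derive_eq E); ring.
Qed.

Lemma cutoff0_derive s : is_derive s (1 : R) cutoff0 (cutoff1 s).
Proof.
have D := derive_comp_of_line (cutoff_inner_derive s) (pos3_derive _).
have E := derive_comp_of_line (g := fun s => pos3 (1 - pos3 (2 - s))) D (derive_reflect 1 _).
by apply: (is_derive_eq E); rewrite /cutoff1; ring.
Qed.

Lemma cutoff1_derive s : is_derive s (1 : R) cutoff1 (cutoff2 s).
Proof.
have D1 := derive_comp_of_line (cutoff_inner_derive s) (pos2_derive _).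
have D2 := derive_comp_of_line (derive_reflect 2 s) (pos2_derive (2 - s)).
have E := is_deriveN (is_deriveM D1 D2).
by apply: (is_derive_eq E); rewrite /cutoff2 /GRing.scale /=; ring.
Qed.

Lemma cutoff2_continuous s : {for s, continuous cutoff2}.
Proof.
have cd (f : R -> R) (df : R -> R) : (forall t, is_derive t (1 : R) f (df t)) -> forall t, {for t, continuous f}.
  by move=> D t; have [/derivable1_diffP /differentiable_continuous] := D t.
have c2 : {for s, continuous (fun s : R => 2 - s)} by exact: (cd _ _ (derive_reflect 2)).
have ci : {for s, continuous (fun s => 1 - pos3 (2 - s))} by exact: (cd _ _ cutoff_inner_derive).
have p2 := cd _ _ pos2_derive.
have p1 : forall t : R, {for t, continuous pos1} := pos1_continuous.
apply: continuous_forD.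
  apply: continuous_forM; first exact: (continuous_comp ci (p2 _)).
  exact: (continuous_comp c2 (p1 _)).
have -> : (fun y => - (pos1 (1 - pos3 (2 - y)) * pos2 (2 - y) ^+ 2)) =
  (fun y => - 1 * (pos1 (1 - pos3 (2 - y)) * (pos2 (2 - y) * pos2 (2 - y)))).
  by apply/funext => y; ring.
apply: continuous_forZ; apply: continuous_forM.
  exact: (continuous_comp ci (p1 _)).
by apply: continuous_forM; exact: (continuous_comp c2 (p2 _)).
Qed.

Lemma pos3_le0 t : t <= 0 -> pos3 t = 0.
Proof.
rewrite /pos3 /glue le_eqVlt => /predU1P[->|t0]; first by rewrite lexx expr0n.
by rewrite leNgt t0.
Qed.

Lemma pos3_ge0 t : 0 <= pos3 t.
Proof. by rewrite /pos3 /glue; case: ifP => // t0; rewrite exprn_ge0. Qed.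

Lemma cutoff0_small s : s <= 1 -> cutoff0 s = 1.
Proof.
move=> s1; rewrite /cutoff0 (pos3_le0 (t := 1 - _)) ?subr0 //.
rewrite subr_le0 /pos3 /glue ifT; last lra.
by rewrite -(expr1n _ 3) lerXn2r ?nnegrE //; lra.
Qed.

Lemma cutoff0_large s : 2 <= s -> cutoff0 s = 0.
Proof.
move=> s2; rewrite /cutoff0 (pos3_le0 (t := 2 - _)); last lra.
by rewrite subr0 /pos3 /glue ler01 expr1n subrr.
Qed.

Lemma cutoff0_01 s : 0 <= cutoff0 s <= 1.
Proof.
rewrite /cutoff0; have := pos3_ge0 (1 - pos3 (2 - s)); have p := pos3_ge0 (2 - s).
suff : pos3 (1 - pos3 (2 - s)) <= 1 by lra.
rewrite {1}/pos3 /glue; case: ifP => // t0.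
by rewrite exprn_ile1 //; lra.
Qed.

Lemma cutoff1_bound s : 0 <= s -> `|cutoff1 s| <= 36.
Proof.
move=> s0; rewrite /cutoff1 normrN normrM /pos2 /glue; have p := pos3_ge0 (2 - s).
case: ifP => // h1; last by rewrite normr0 mul0r.
case: ifP => // h2; last by rewrite normr0 mulr0.
rewrite !ger0_norm ?mulr_ge0 ?sqr_ge0 //.
have : (1 - pos3 (2 - s)) ^+ 2 <= 1 by rewrite exprn_ile1 //; lra.
have : (2 - s) ^+ 2 <= 4 by nra.
have := sqr_ge0 (2 - s); have := sqr_ge0 (1 - pos3 (2 - s)).
move: ((2 - s) ^+ 2) ((1 - _) ^+ 2) => a b; nra.
Qed.

(** The two terms of [cutoff2] lie in [0, 36] and [0, 864]; 900 is a round number above both. *)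
Lemma cutoff2_bound s : 0 <= s -> `|cutoff2 s| <= 30 * 30.
Proof.
move=> s0; rewrite /cutoff2 /pos2 /pos1 /glue; have p := pos3_ge0 (2 - s).
case: ifP => h1; last by rewrite !mul0r subr0 normr0 mulr_ge0 ?ler0n.
case: ifP => h2; last by rewrite mulr0 expr0n mulr0 subr0 normr0 mulr_ge0 ?ler0n.
have : (1 - pos3 (2 - s)) ^+ 2 <= 1 by rewrite exprn_ile1 //; lra.
have := sqr_ge0 (1 - pos3 (2 - s)).
have : 1 - pos3 (2 - s) <= 1 by lra.
move: h1; move: (1 - pos3 (2 - s)) => w w0 w1 w2 w3.
have : (2 - s) ^+ 2 <= 4 by nra.
have := sqr_ge0 (2 - s).
move: w2 w3; move: (w ^+ 2) => z z0 z1.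
rewrite exprMn -exprM; have -> : (2 - s) ^+ (2 * 2) = ((2 - s) ^+ 2) ^+ 2 by rewrite -exprM.
move: ((2 - s) ^+ 2) => a a0 a4.
have A2 : 0 <= a ^+ 2 <= 16 by nra.
move: A2; move: (a ^+ 2) => b /andP[b0 b16].
have X1 : 0 <= z * (2 - s) <= 2 by nra.
have X2 : 0 <= w * b <= 16 by nra.
rewrite (_ : _ - _ = 18 * (z * (2 - s)) - 54 * (w * b)); last by ring.
rewrite ler_norml; lra.
Qed.

Variable (d : nat).
Local Notation V := 'rV[R]_d.
Implicit Types (a x : V) (r : R).

Definition bump r a x : R := cutoff0 ((r ^+ 2)^-1 * sqn (x - a)).
Definition bump1 r a (i : 'I_d) x : R :=
  2 * (x - a) ord0 i * (cutoff1 ((r ^+ 2)^-1 * sqn (x - a)) * (r ^+ 2)^-1).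
Definition bump2 r a (i : 'I_d) x : R :=
  2 * (cutoff1 ((r ^+ 2)^-1 * sqn (x - a)) * (r ^+ 2)^-1) + 4 * (x - a) ord0 i ^+ 2 *
     (cutoff2 ((r ^+ 2)^-1 * sqn (x - a)) * (r ^+ 2)^-1 * (r ^+ 2)^-1).

Lemma bump_C2 r a : axis_C2 setT (bump r a) (bump1 r a) (bump2 r a).
Proof.
have DZ (c s : R) : is_derive s (1 : R) (fun s => c * s) c.
  apply/is_derive_epsP => e e0; exists 1 => // h h0 _.
  by rewrite [h%:A]mulr1 (_ : _ - c = 0) ?normr0 //; field.
apply: (@radial_axis_C2 R d setT a (fun s => cutoff0 ((r ^+ 2)^-1 * s))
  (fun s => cutoff1 ((r ^+ 2)^-1 * s) * (r ^+ 2)^-1)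
  (fun s => cutoff2 ((r ^+ 2)^-1 * s) * (r ^+ 2)^-1 * (r ^+ 2)^-1)) => x _; split.
- exact: (derive_comp_of_line (DZ _ _) (cutoff0_derive _)).
- have D := derive_comp_of_line (DZ (r ^+ 2)^-1 (sqn (x - a))) (cutoff1_derive _).
  have E := derive_comp_of_line (g := fun s => cutoff1 ((r ^+ 2)^-1 * s)) D (DZ (r ^+ 2)^-1 _).
  under eq_fun do rewrite mulrC; apply: (is_derive_eq E); ring.
- have -> : (fun s => cutoff2 ((r ^+ 2)^-1 * s) * (r ^+ 2)^-1 * (r ^+ 2)^-1) =
     (fun s => ((r ^+ 2)^-1 * (r ^+ 2)^-1) * cutoff2 ((r ^+ 2)^-1 * s)).
    by apply/funext => s; ring.
  apply: continuous_forZ.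
  apply: (continuous_comp (f := fun s => (r ^+ 2)^-1 * s)); last exact: cutoff2_continuous.
  by apply: continuous_forZ; exact: cvg_id.
Qed.

(** The constants are 2d times the bound 36 for [cutoff1], and 4 times 2 times the bound for
    [cutoff2], where 2 bounds the rescaled squared distance on the support. The scaling by the
    inverse square of r is what the volume of the support compensates later. *)
Lemma bump_laplacian_bound r a x : 0 < r ->
  `|\sum_i bump2 r a i x| <= (72 * d%:R + 8 * (30 * 30)) * (r ^+ 2)^-1.
Proof.
move=> r0; have r2 : 0 < (r ^+ 2)^-1 by rewrite invr_gt0 exprn_gt0.
rewrite (@radial_laplacian R d a (fun s => cutoff1 ((r ^+ 2)^-1 * s) * (r ^+ 2)^-1)
  (fun s => cutoff2 ((r ^+ 2)^-1 * s) * (r ^+ 2)^-1 * (r ^+ 2)^-1)).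
have s0 := sqn_ge0 (x - a).
move: (sqn (x - a)) s0 => q q0; move: (r ^+ 2)^-1 r2 => c c0.
have cq0 : 0 <= c * q by rewrite mulr_ge0 // ltW.
have d0 : 0 <= d%:R :> R by [].
have -> : 2 * d%:R * (cutoff1 (c * q) * c) + 4 * q * (cutoff2 (c * q) * c * c) =
  c * (2 * d%:R * cutoff1 (c * q) + 4 * ((c * q) * cutoff2 (c * q))) by ring.
rewrite normrM gtr0_norm // mulrC ler_wpM2r ?(ltW c0) //.
apply: le_trans (ler_normD _ _) _.
have B1 := cutoff1_bound cq0; have B2 := cutoff2_bound cq0.
apply: lerD.
  by rewrite normrM ger0_norm ?mulr_ge0 //; nra.
rewrite normrM ger0_norm // (normrM (c * q)) (ger0_norm cq0).
have [h|h] := leP (c * q) 2; first by have := normr_ge0 (cutoff2 (c * q)); nra.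
have E0 : (0 <= 2 - c * q) = false by apply/negbTE; rewrite -ltNge; lra.
have -> : cutoff2 (c * q) = 0.
  by rewrite /cutoff2 /pos1 /pos2 /glue E0 mulr0 expr0n mulr0 subr0.
by rewrite normr0 !mulr0; lra.
Qed.

Lemma bump_inner r a x : 0 < r -> sqn (x - a) <= r ^+ 2 -> bump r a x = 1.
Proof.
by move=> r0 h; apply: cutoff0_small; rewrite mulrC ler_pdivrMr ?mul1r // exprn_gt0.
Qed.

Lemma bump_outer r a x : 0 < r -> 2 * r ^+ 2 <= sqn (x - a) -> bump r a x = 0.
Proof.
by move=> r0 h; apply: cutoff0_large; rewrite mulrC ler_pdivlMr // exprn_gt0.
Qed.

Lemma bump_01 r a x : 0 <= bump r a x <= 1.
Proof. exact: cutoff0_01. Qed.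

End Cutoff.

(** * Lattice sums *)

Section LatticeCount.
Variable R : realType.
Implicit Types (a b : R) (n : nat).

Lemma lattice_count_le a b n : a <= b ->
  \sum_(k < n) ((a <= k%:R) && (k%:R <= b))%:R <= b - a + 1.
Proof.
move=> ab.
(* The claim is strengthened to the interval cut off at n - 1, so that induction on n goes
   through. *)
have : \sum_(k < n) ((a <= k%:R) && (k%:R <= b))%:R <= Num.max 0 (Num.min (n%:R - 1) b - a + 1).
  elim: n => [|n IH]; first by rewrite big_ord0 le_max lexx.
  rewrite big_ord_recr /=; case: (boolP (_ && _)) => [/andP[an nb]|_]; last first.
    rewrite addr0; apply: le_trans IH _; rewrite ge_max le_max lexx /= le_max.
    apply/orP; right; rewrite !lerD2r le_min !ge_min lexx orbT andbT.
    by rewrite -natr1 addrK; apply/orP; left; rewrite lerBlDr lerDl.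
  rewrite le_max; apply/orP; right; rewrite -natr1 addrK (min_l nb).
  apply: le_trans (lerD IH (lexx 1)) _.
  rewrite -lerBrDr ge_max; apply/andP; split; first lra.
  have : Num.min (n%:R - 1) b <= n%:R - 1 by rewrite ge_min lexx.
  lra.
move=> /le_trans; apply; rewrite ge_max; apply/andP; split; first lra.
have : Num.min (n%:R - 1) b <= b by rewrite ge_min lexx orbT.
lra.
Qed.

Lemma lattice_count_ge a b n : 0 <= a -> b <= n%:R ->
  b - a - 1 <= \sum_(k < n) ((a <= k%:R) && (k%:R <= b))%:R.
Proof.
move=> a0 bn.
suff : Num.min n%:R b - a - 1 <= \sum_(k < n) ((a <= k%:R) && (k%:R <= b))%:R.
  by rewrite min_r.
elim: n {bn} => [|n IH].
  rewrite big_ord0; have : Num.min 0 b <= 0 by rewrite ge_min lexx.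
  lra.
rewrite big_ord_recr /=.
have s0 : 0 <= \sum_(i < n) ((a <= i%:R) && (i%:R <= b))%:R :> R by apply: sumr_ge0.
move: s0 IH; move: (\sum_(i < n) _) => s s0 IH.
have m1 : Num.min n.+1%:R b <= n%:R + 1 by rewrite ge_min natr1 lexx.
have m2 : Num.min n.+1%:R b <= b by rewrite ge_min lexx orbT.
case: (leP a n%:R) => an; case: (leP n%:R b) => nb /=.
- by move: IH; rewrite (min_l nb); lra.
- by move: IH; rewrite (min_r (ltW nb)); lra.
- by lra.
- by lra.
Qed.

End LatticeCount.

Section LatticeSum.
Variables (R : realType) (d : nat).
Local Notation V := 'rV[R]_d.
Local Notation e_ i := (delta_mx ord0 i : V).
Implicit Types (f g k : V -> R) (x y p : V) (h A : R) (N : nat).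

(** The integer coordinates run from -N to N, so reflections in coordinate hyperplanes permute the
    box and the mirror consists of lattice points. The index type has successor size and hence a
    cyclic addition. *)
Definition lpoint h N (t : {ffun 'I_d -> 'I_(N.*2.+1)}) : V :=
  \row_i (h * ((t i)%:R - N%:R)).

Definition lsum h N f : R := h ^+ d * \sum_t f (@lpoint h N t).

Lemma eq_lsum h N f g : (forall t, f (@lpoint h N t) = g (@lpoint h N t)) ->
  lsum h N f = lsum h N g.
Proof. by move=> E; rewrite /lsum; congr (_ * _); apply: eq_bigr. Qed.

Lemma lsumD h N f g : lsum h N (fun x => f x + g x) = lsum h N f + lsum h N g.
Proof. by rewrite /lsum big_split mulrDr. Qed.

Lemma lsumZ h N (c : R) f : lsum h N (fun x => c * f x) = c * lsum h N f.
Proof. by rewrite /lsum -mulr_sumr mulrCA. Qed.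

Lemma lsumB h N f g : lsum h N (fun x => f x - g x) = lsum h N f - lsum h N g.
Proof. by rewrite /lsum sumrB mulrBr. Qed.

Lemma lsum_sum h N (I : finType) (F : I -> V -> R) :
  lsum h N (fun x => \sum_i F i x) = \sum_i lsum h N (F i).
Proof. by rewrite /lsum exchange_big /= mulr_sumr. Qed.

Lemma lsum_le h N f g : 0 <= h -> (forall x, f x <= g x) -> lsum h N f <= lsum h N g.
Proof. by move=> h0 fg; rewrite /lsum ler_wpM2l ?exprn_ge0 //; apply: ler_sum. Qed.

Lemma lsum_ge0 h N f : 0 <= h -> (forall x, 0 <= f x) -> 0 <= lsum h N f.
Proof. by move=> h0 f0; rewrite /lsum mulr_ge0 ?exprn_ge0 //; apply: sumr_ge0. Qed.

Lemma lsum_norm h N f : 0 <= h -> `|lsum h N f| <= lsum h N (fun x => `|f x|).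
Proof.
move=> h0; rewrite /lsum normrM ger0_norm ?exprn_ge0 // ler_wpM2l ?exprn_ge0 //.
exact: ler_norm_sum.
Qed.

Definition supported A f := forall x, A < `|x| -> f x = 0.

(* The shift is carried out modulo the size of the box; where the indices wrap
   around, both sides vanish. *)
Lemma lsum_shift h N A A' (s : 'I_d -> int) k : 0 < h -> supported A k ->
  (forall i, h * `|(s i)%:~R| <= A') -> 0 <= A -> A + A' < h * N%:R ->
  lsum h N (fun x => k (x + h *: \row_i (s i)%:~R)) = lsum h N k.
Proof.
move=> h0 sk sA A0 AN.
have sN i : (`|s i| < N)%N.
  rewrite -(ltr_nat R) -(ltr_pM2l h0) natr_absz intr_norm.
  by have := sA i; lra.
rewrite /lsum; congr (_ * _).
have nR : (N.*2.+1)%:R = 2 * N%:R + 1 :> R by rewrite -addn1 natrD -muln2 natrM mulrC.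
(* The shift may be negative; adding the size of the box makes it a natural number with the same
   residue. *)
pose u i : nat := absz (s i + (N.*2.+1)%:Z)%R.
pose tau : {ffun 'I_d -> 'I_(N.*2.+1)} := [ffun i => inZp (u i)].
have tauinj : injective (fun t : {ffun 'I_d -> 'I_(N.*2.+1)} => [ffun i => Zp_add (t i) (tau i)]).
  move=> t t' /ffunP E; apply/ffunP => i; have := E i; rewrite !ffunE.
  exact: (@addIr _ (inZp (u i) : 'I_(N.*2.+1))).
rewrite [RHS](reindex_inj tauinj) /=; apply: eq_bigr => t _.
pose m i := (t i + u i)%N.
have valt i : ([ffun i => Zp_add (t i) (tau i)] : {ffun 'I_d -> 'I_(N.*2.+1)}) i = (m i %% N.*2.+1)%N :> nat.
  by rewrite !ffunE /= modnDmr.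
have mE i : (m i)%:Z = (t i)%:Z + s i + (N.*2.+1)%:Z.
  by have := sN i; rewrite /m /u; lia.
have mR i : (m i)%:R = (t i)%:R + (s i)%:~R + 2 * N%:R + 1 :> R.
  have := congr1 (fun z : int => z%:~R : R) (mE i).
  by rewrite !intrD -!pmulrn => ->; rewrite nR; ring.
(* In this range the reduction subtracts the size exactly once, so no index wraps around. Otherwise
   some coordinate shows that both points lie outside the support. *)
have [/forallP inb|/forallPn[i outb]] := boolP [forall i, (N.*2.+1 <= m i < 2 * N.*2.+1)%N].
  congr (k _); apply/rowP => i; rewrite !mxE valt.
  have -> : (m i %% N.*2.+1)%N = (m i - N.*2.+1)%N.
    have /andP[m1 m2] := inb i.
    by rewrite -{1}(subnK m1) modnDr modn_small //; lia.
  have /andP[m1 m2] := inb i.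
  rewrite natrB // mR nR; ring.
have sh : `|h * (s i)%:~R| <= A' by rewrite normrM gtr0_norm.
move: sh; rewrite ler_norml => /andP[sh1 sh2].
have big x (r : R) : x ord0 i = r -> A < `|r| -> k x = 0.
  by move=> <- Ar; apply: sk; apply: lt_le_trans Ar (rv_coord_le _ _).
have tN : (t i <= N.*2)%N by rewrite -ltnS ltn_ord.
have tNR : (t i)%:R <= 2 * N%:R :> R by rewrite -natrM ler_nat mul2n.
have t0R : 0 <= (t i)%:R :> R by [].
have [ml|mg2] : (m i < N.*2.+1)%N \/ (2 * N.*2.+1 <= m i)%N.
  by move: outb; rewrite negb_and => /orP[H|H]; [left; rewrite ltnNge|right; rewrite leqNgt].
- rewrite (big _ _ (erefl _)); last first.
    rewrite !mxE.
    have : (m i)%:R <= 2 * N%:R :> R by rewrite -natrM ler_nat mul2n -ltnS.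
    rewrite mR => ml'; rewrite ltr_normr; apply/orP; right.
    have : h * ((t i)%:R + (s i)%:~R) <= h * (- 1) by rewrite ler_pM2l //; lra.
    by move: h0 AN; lra.
  rewrite (big _ _ (erefl _)) // mxE valt modn_small // mR ltr_normr; apply/orP; left.
  have : 0 <= h * (t i)%:R by rewrite mulr_ge0 // ltW.
  by move: h0 AN sh1; lra.
- have m3 : (m i < 3 * N.*2.+1)%N by have := sN i; move: tN; rewrite /m /u; lia.
  rewrite (big _ _ (erefl _)); last first.
    rewrite !mxE.
    have : (2 * N.*2.+1)%:R <= (m i)%:R :> R by rewrite ler_nat.
    rewrite mR natrM nR => ml'; rewrite ltr_normr; apply/orP; left.
    have : h * (2 * N%:R) <= h * ((t i)%:R + (s i)%:~R) by rewrite ler_pM2l //; lra.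
    by move: h0 AN; lra.
  rewrite (big _ _ (erefl _)) // mxE valt.
  have -> : (m i %% N.*2.+1)%N = (m i - 2 * N.*2.+1)%N.
    by rewrite -{1}(subnKC mg2) modnMDl modn_small //; lia.
  rewrite natrB // mR natrM nR ltr_normr; apply/orP; right.
  have : h * (t i)%:R <= h * (2 * N%:R) by rewrite ler_pM2l.
  by move: h0 AN sh2; lra.
Qed.

Lemma axis_row h i : h *: e_ i = h *: \row_j ((i == j)%:Z)%:~R :> V.
Proof.
congr (_ *: _); apply/rowP => j; rewrite !mxE eqxx /= eq_sym.
by case: (i == j).
Qed.

Lemma lsum_axis h N A i k : 0 < h -> h <= 1 -> supported A k -> 0 <= A ->
  A + 1 < h * N%:R -> lsum h N (fun x => k (x + h *: e_ i)) = lsum h N k.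
Proof.
move=> h0 h1 sk A0 AN; rewrite axis_row; apply: (lsum_shift (A := A) (A' := 1)) => // j.
by case: (i == j); rewrite ?normr1 ?mulr1 // normr0 mulr0.
Qed.

Lemma lsum_axisN h N A i k : 0 < h -> h <= 1 -> supported A k -> 0 <= A ->
  A + 2 < h * N%:R -> lsum h N (fun x => k (x - h *: e_ i)) = lsum h N k.
Proof.
move=> h0 h1 sk A0 AN.
rewrite -(lsum_axis (A := A + 1) i h0 h1 (k := fun x => k (x - h *: e_ i))).
- by apply: eq_lsum => t; rewrite addrK.
- move=> x Ax; apply: sk.
  have := ler_distD 0 x (h *: e_ i); rewrite subr0 sub0r normrN normrZ rv_norm_axis mulr1 gtr0_norm //.
  have := lerB_dist x (h *: e_ i); rewrite normrZ rv_norm_axis mulr1 gtr0_norm //; lra.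
- lra.
- lra.
Qed.

(** Green's second identity on the lattice. One compactly supported factor is enough; the margin 2
    leaves room for a product whose support has already been shifted once. *)
Lemma lsum_dlap_sym h N A f g : 0 < h -> h <= 1 -> supported A f -> 0 <= A ->
  A + 2 < h * N%:R -> lsum h N (fun x => f x * dlap h g x) = lsum h N (fun x => g x * dlap h f x).
Proof.
move=> h0 h1 sf A0 AN.
have E (u v : V -> R) : lsum h N (fun x => u x * dlap h v x) =
    h ^- 2 * \sum_i (lsum h N (fun x => u x * v (x + h *: e_ i)) +
      lsum h N (fun x => u x * v (x - h *: e_ i)) - 2 * lsum h N (fun x => u x * v x)).
  pose F i x := u x * (v (x + h *: e_ i) + v (x - h *: e_ i) - 2 * v x).
  transitivity (h ^- 2 * \sum_i lsum h N (F i)).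
    by rewrite -lsum_sum -lsumZ; apply: eq_lsum => t; rewrite /dlap mulrCA mulr_sumr.
  congr (_ * _); apply: eq_bigr => i _.
  rewrite -lsumD -lsumZ -lsumB; apply: eq_lsum => t; rewrite /F; ring.
rewrite !E; congr (_ * _); apply: eq_bigr => i _; congr (_ - _); last first.
  by congr (_ * _); apply: eq_lsum => t; rewrite mulrC.
rewrite addrC; congr (_ + _).
  rewrite -(lsum_axis (A := A + 1) i h0 h1 (k := fun x => f x * g (x - h *: e_ i))) //; try lra.
    by apply: eq_lsum => t; rewrite addrK mulrC.
  by move=> x Ax; rewrite sf ?mul0r //; lra.
rewrite -(lsum_axisN (A := A) i h0 h1 (k := fun x => f x * g (x + h *: e_ i))) //.
  by apply: eq_lsum => t; rewrite subrK mulrC.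
by move=> x Ax; rewrite sf ?mul0r //; lra.
Qed.

Lemma dlap_cst h (c : R) x : dlap h (fun=> c) x = 0.
Proof. by rewrite /dlap big1 ?mulr0 // => i _; ring. Qed.

Lemma lsum_dlap0 h N A f : 0 < h -> h <= 1 -> supported A f -> 0 <= A ->
  A + 2 < h * N%:R -> lsum h N (dlap h f) = 0.
Proof.
move=> h0 h1 sf A0 AN.
have -> : lsum h N (dlap h f) = lsum h N (fun x => 1 * dlap h f x).
  by apply: eq_lsum => t; rewrite mul1r.
rewrite -(lsum_dlap_sym (fun=> 1) h0 h1 sf A0 AN).
by rewrite /lsum big1 ?mulr0 // => t _; rewrite dlap_cst mulr0.
Qed.

(** Summation by parts turns the sum into minus the discrete Dirichlet integral, a sum of squares of
    forward differences. *)
Lemma lsum_energy_ge0 h N A f : 0 < h -> h <= 1 -> supported A f -> 0 <= A ->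
  A + 2 < h * N%:R -> lsum h N (fun x => f x * dlap h f x) <= 0.
Proof.
move=> h0 h1 sf A0 AN.
have -> : lsum h N (fun x => f x * dlap h f x) =
   - (h ^- 2 * \sum_i lsum h N (fun x => (f (x + h *: e_ i) - f x) ^+ 2)).
  rewrite -mulrN -sumrN.
  pose F i x := f x * (f (x + h *: e_ i) + f (x - h *: e_ i) - 2 * f x).
  transitivity (h ^- 2 * \sum_i lsum h N (F i)).
    by rewrite -lsum_sum -lsumZ; apply: eq_lsum => t; rewrite /dlap mulrCA mulr_sumr.
  congr (_ * _); apply: eq_bigr => i _.
  have E1 : lsum h N (fun x => f (x + h *: e_ i) ^+ 2) = lsum h N (fun x => f x ^+ 2).
    apply: (lsum_axis (A := A) i h0 h1 (k := fun x => f x ^+ 2)) => //; last lra.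
    by move=> x Ax; rewrite sf ?expr0n.
  have E2 : lsum h N (fun x => f (x - h *: e_ i) * f x) = lsum h N (fun x => f x * f (x + h *: e_ i)).
    rewrite -(lsum_axisN (A := A) i h0 h1 (k := fun x => f x * f (x + h *: e_ i))) //.
      by apply: eq_lsum => t; rewrite subrK.
    by move=> x Ax; rewrite sf ?mul0r.
  have -> : lsum h N (fun x => (f (x + h *: e_ i) - f x) ^+ 2) =
      lsum h N (fun x => f (x + h *: e_ i) ^+ 2) - 2 * lsum h N (fun x => f x * f (x + h *: e_ i))
      + lsum h N (fun x => f x ^+ 2).
    rewrite -lsumZ -lsumB -lsumD; apply: eq_lsum => t; ring.
  have -> : lsum h N (F i) =
     lsum h N (fun x => f x * f (x + h *: e_ i)) + lsum h N (fun x => f (x - h *: e_ i) * f x)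
     - 2 * lsum h N (fun x => f x ^+ 2).
    rewrite -lsumZ -lsumD -lsumB; apply: eq_lsum => t; rewrite /F; ring.
  rewrite E1 E2; ring.
rewrite oppr_le0 mulr_ge0 ?invr_ge0 ?exprn_ge0 ?(ltW h0) //.
by apply: sumr_ge0 => i _; apply: lsum_ge0 => [|x]; [exact: ltW|exact: sqr_ge0].
Qed.

Definition flip (i : 'I_d) x : V := \row_j (if j == i then - x ord0 j else x ord0 j).

Lemma lsum_flip h N i f : lsum h N (fun x => f (flip i x)) = lsum h N f.
Proof.
rewrite /lsum; congr (_ * _).
pose r (t : {ffun 'I_d -> 'I_(N.*2.+1)}) := [ffun j => if j == i then rev_ord (t j) else t j].
have rinj : injective r.
  apply: (can_inj (g := r)) => t; apply/ffunP => j; rewrite !ffunE.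
  by case: (j == i); rewrite ?rev_ordK.
rewrite [RHS](reindex_inj rinj) /=; apply: eq_bigr => t _; congr (f _).
apply/rowP => j; rewrite !mxE ffunE; case: (j == i) => //=.
rewrite subSS natrB; last by rewrite -ltnS ltn_ord.
have -> : (N.*2)%:R = 2 * N%:R :> R by rewrite -mul2n natrM.
ring.
Qed.

Lemma lpoint_coord h N t i : exists z : int, @lpoint h N t ord0 i = h * z%:~R.
Proof. by exists ((t i)%:Z - N%:Z); rewrite mxE intrD mulrNz -!pmulrn. Qed.

(** The indicator is written as a condition on coordinates so that its lattice sum factors into
    one-dimensional counts. *)
Definition cube p (a : R) x : R := ([forall i, `|x ord0 i - p ord0 i| <= a])%:R.

Lemma cubeE p (a : R) x : 0 <= a -> cube p a x = ((`|x - p| <= a)%R)%:R.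
Proof.
move=> a0; congr (_%:R); congr nat_of_bool; apply/forallP/idP.
  by move=> H; apply/rv_norm_le => // i; rewrite !mxE; exact: H.
by move=> /rv_norm_le H i; have := H a0 i; rewrite !mxE.
Qed.

Lemma lsum_cube h N p (a : R) : lsum h N (cube p a) =
  \prod_(i < d) (h * \sum_(k < N.*2.+1) ((`|h * (k%:R - N%:R) - p ord0 i| <= a)%R)%:R).
Proof.
rewrite big_split /= prodr_const card_ord /lsum; congr (_ * _).
rewrite bigA_distr_bigA /=; apply: eq_bigr => t _.
rewrite /cube -natr_prod; congr (_%:R).
have [/forallP H|/forallPn[i H]] := boolP [forall i, `|lpoint h t ord0 i - p ord0 i| <= a].
  by rewrite big1 // => i _; have := H i; rewrite !mxE => ->.
by rewrite (bigD1 i) //=; move: H; rewrite !mxE => /negbTE ->.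
Qed.

Lemma cube_row_equiv h N (q a : R) (k : nat) : 0 < h ->
  (`|h * (k%:R - N%:R) - q| <= a) = ((N%:R + (q - a) / h <= k%:R) && (k%:R <= N%:R + (q + a) / h)).
Proof.
move=> h0; rewrite ler_norml; congr (_ && _).
  rewrite -lerBrDl ler_pdivrMr // mulrC; lra.
by rewrite -lerBlDl ler_pdivlMr // mulrC; lra.
Qed.

Lemma lsum_cube_le h N p (a : R) : 0 < h -> 0 <= a -> lsum h N (cube p a) <= (2 * a + h) ^+ d.
Proof.
move=> h0 a0; rewrite lsum_cube.
have -> : (2 * a + h) ^+ d = \prod_(i < d) (2 * a + h) by rewrite prodr_const card_ord.
apply: ler_prod => i _; apply/andP; split.
  by rewrite mulr_ge0 ?(ltW h0) //; apply: sumr_ge0.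
under eq_bigr do rewrite cube_row_equiv //.
have ab : N%:R + (p ord0 i - a) / h <= N%:R + (p ord0 i + a) / h.
  by rewrite lerD2l ler_pM2r ?invr_gt0 //; lra.
have := lattice_count_le N.*2.+1 ab; move=> /(ler_wpM2l (ltW h0)) /le_trans; apply.
rewrite le_eqVlt; apply/orP; left; apply/eqP; field.
by rewrite gt_eqF.
Qed.

Lemma lsum_cube_ge h N p (a : R) : 0 < h -> h <= 2 * a -> `|p| + a <= h * N%:R ->
  (2 * a - h) ^+ d <= lsum h N (cube p a).
Proof.
move=> h0 ha pN; rewrite lsum_cube.
have -> : (2 * a - h) ^+ d = \prod_(i < d) (2 * a - h) by rewrite prodr_const card_ord.
apply: ler_prod => i _; apply/andP; split; first lra.
under eq_bigr do rewrite cube_row_equiv //.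
have := rv_coord_le p i; rewrite ler_norml => /andP[p1 p2].
have A1 : 0 <= N%:R + (p ord0 i - a) / h.
  by rewrite -(pmulr_rge0 _ h0) mulrDr mulrCA divff ?mulr1 ?gt_eqF //; lra.
have A2 : N%:R + (p ord0 i + a) / h <= N.*2.+1%:R.
  rewrite -(ler_pM2l h0) mulrDr mulrCA divff ?mulr1 ?gt_eqF //.
  rewrite (_ : N.*2.+1%:R = 2 * N%:R + 1); first lra.
  by rewrite -addn1 natrD -mul2n natrM.
have := lattice_count_ge A1 A2; move=> /(ler_wpM2l (ltW h0)); apply: le_trans.
rewrite le_eqVlt; apply/orP; left; apply/eqP; field.
by rewrite gt_eqF.
Qed.

Lemma lsum_bound h N p (a c : R) f : 0 < h -> 0 <= a -> 0 <= c ->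
  (forall x, `|x - p| <= a -> `|f x| <= c) -> (forall x, a < `|x - p| -> f x = 0) ->
  `|lsum h N f| <= c * (2 * a + h) ^+ d.
Proof.
move=> h0 a0 c0 H1 H2; apply: le_trans (lsum_norm _ _ (ltW h0)) _.
apply: (@le_trans _ _ (lsum h N (fun x => c * cube p a x))).
  apply: lsum_le => [|x]; first exact: ltW.
  rewrite cubeE //; have [xa|xa] := leP `|x - p| a; first by rewrite mulr1 H1.
  by rewrite H2 // normr0 mulr0.
by rewrite lsumZ ler_wpM2l // lsum_cube_le.
Qed.

(** The vector p is rounded down to a lattice vector q. Translation by q leaves the sum exactly
    invariant, and passing from q to p costs only the modulus of continuity of f times the volume of
    the support. *)
Lemma lsum_translate A f p : 0 <= A -> continuous f -> supported A f -> forall e : R, 0 < e ->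
  exists2 r : R, 0 < r & forall h N, 0 < h -> h < r -> A + `|p| + 2 < h * N%:R ->
    `|lsum h N (fun x => f (x - p)) - lsum h N f| <= e.
Proof.
move=> A0 cf sf e e0.
pose C := (2 * (A + `|p| + 1) + 1) ^+ d.
have C0 : 0 < C by rewrite exprn_gt0 //; have := normr_ge0 p; lra.
have cK : compact [set x : V | `|x| <= A + 2 * `|p| + 2].
  apply: (@bounded_closed_compact_rv R d _ (A + 2 * `|p| + 2)) => //.
  by apply: closed_comp (@closed_le _ _) => x _; exact: norm_continuous.
have [|r r0 rP] := compact_uniform cK (fun x _ => cf x) (e := e / C); first by rewrite divr_gt0.
exists (Num.min r 1); first by rewrite lt_min r0 ltr01.
move=> h N h0; rewrite lt_min => /andP[hr h1] AN.
pose s i := Num.floor (p ord0 i / h).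
pose q : V := h *: \row_i (s i)%:~R.
have sP i : (s i)%:~R * h <= p ord0 i < ((s i)%:~R + 1) * h.
  rewrite -ler_pdivlMr // -ltr_pdivrMr // floor_le /=.
  by rewrite -intrD1 floorD1_gt.
have qp : `|p - q| <= h.
  apply/rv_norm_le => [|i]; first exact: ltW.
  by rewrite !mxE; have := sP i; rewrite ler_norml; lra.
have <- : lsum h N (fun x => f (x - q)) = lsum h N f.
  rewrite -[RHS](lsum_shift (A := A) (A' := `|p| + 1) (s := fun i => - s i)) //.
  - apply: eq_lsum => t; congr (f (_ + _)); apply/rowP => i; rewrite !mxE mulrNz; ring.
  - move=> i; rewrite mulrNz normrN -{1}(gtr0_norm h0) -normrM.
    have -> : h * (s i)%:~R = p ord0 i - (p - q) ord0 i by rewrite !mxE; ring.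
    apply: le_trans (ler_normB _ _) _; apply: lerD; first exact: rv_coord_le.
    by apply: le_trans (rv_coord_le _ _) _; apply: le_trans qp _; exact: ltW.
  - lra.
have qn : `|q| <= `|p| + h.
  have -> : q = p - (p - q) by rewrite opprB addrC subrK.
  by apply: le_trans (ler_normB _ _) _; rewrite lerD2l.
rewrite -lsumB; apply: le_trans (lsum_bound (p := 0) (a := A + `|p| + 1) (c := e / C) _ _ _ _ _ _) _ => //.
- have := normr_ge0 p; lra.
- by rewrite divr_ge0 // ltW.
- move=> x; rewrite subr0 => xA; rewrite ltW //; apply: rP => /=.
    apply: le_trans (ler_normB _ _) _; have := normr_ge0 p; lra.
  have -> : x - p - (x - q) = - (p - q) by apply/rowP => j; rewrite !mxE; ring.
  by rewrite normrN; apply: le_lt_trans hr.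
- move=> x; rewrite subr0 => xA.
  have x1 := lerB_dist x p; have x2 := lerB_dist x q.
  by rewrite !sf ?subr0 //; lra.
rewrite mulrAC ler_pdivrMr // ler_pM2l //.
by apply: lerXn2r; rewrite ?nnegrE; have := normr_ge0 p; lra.
Qed.

End LatticeSum.

(** * Green functions *)

Section PotentialTheory.
Variables (R : realType) (n : nat).
Local Notation k := n.+1.
Local Notation d := k.+2.
Local Notation V := 'rV[R]_d.
Local Notation e_ i := (delta_mx ord0 i : V).
Implicit Types (x y p a b : V) (B : set V) (g : V -> R) (lam : R).

Lemma open_epsP (O : set V) :
  (forall x, O x -> exists2 r : R, 0 < r & forall y, `|y - x| < r -> O y) -> open O.
Proof.
move=> H; rewrite openE => x /H[r r0 Hr]; apply/nbhs_ballP; exists r => // y.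
by rewrite -ball_normE /= distrC; exact: Hr.
Qed.

Lemma closed_epsP (K : set V) :
  (forall x, ~ K x -> exists2 r : R, 0 < r & forall y, `|y - x| < r -> ~ K y) -> closed K.
Proof. by move=> H; rewrite -openC; exact: open_epsP. Qed.

Lemma compact_superlevel (K : set V) (u : V -> R) (e : R) : compact K ->
  (forall x, K x -> {for x, continuous u}) -> compact [set x | K x /\ e <= u x].
Proof.
move=> cK cu; apply: (subclosed_compact _ cK) => [|x []//].
apply: closed_epsP => x; have [Kx|nKx] := pselect (K x).
  move=> H; have ux : u x < e by rewrite ltNge; apply/negP => ux; exact: H.
  have /continuous_forP /(_ (e - u x)) [|r r0 Hr] := cu x Kx; first by rewrite subr_gt0.
  exists r => // y /Hr; rewrite ltr_norml => /andP[_ yx] [_]; apply/negP; rewrite -ltNge; lra.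
move=> _; have oK : open (~` K) by rewrite openC; exact: compact_closed.
by have [r r0 Hr] := open_ball oK nKx; exists r => // y /Hr yK [].
Qed.

Lemma sqn_le_norm x : sqn x <= d%:R * `|x| ^+ 2.
Proof.
rewrite /sqn; apply: (@le_trans _ _ (\sum_(i < d) `|x| ^+ 2)).
  apply: ler_sum => i _; rewrite -[x ord0 i ^+ 2]ger0_norm ?sqr_ge0 // normrX.
  by rewrite lerXn2r ?nnegrE // rv_coord_le.
by rewrite sumr_const card_ord -[_ *+ d]mulr_natl.
Qed.

Lemma norm_le_sqn x : `|x| ^+ 2 <= sqn x.
Proof.
rewrite -(sqr_sqrtr (sqn_ge0 x)) lerXn2r ?nnegrE ?sqrtr_ge0 //.
apply/rv_norm_le => [|i]; first exact: sqrtr_ge0.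
rewrite -sqrtr_sqr ler_sqrt ?sqn_ge0 // /sqn (bigD1 i) //= lerDl.
by apply: sumr_ge0 => j _; exact: sqr_ge0.
Qed.

Lemma norm_le_of_sqn x (r : R) : 0 <= r -> sqn x <= r ^+ 2 -> `|x| <= r.
Proof.
move=> r0 h; rewrite -(@ler_pXn2r _ 2) ?nnegrE //.
exact: le_trans (norm_le_sqn x) h.
Qed.

Lemma newt0_gt0 (s : R) : 0 < s -> 0 < newt0 k s.
Proof. by move=> s0; rewrite /newt0 invr_gt0 exprn_gt0 // sqrtr_gt0. Qed.

Lemma newt0_ge0 (s : R) : 0 <= newt0 k s.
Proof. by rewrite /newt0 invr_ge0 exprn_ge0 // sqrtr_ge0. Qed.

Lemma newt0_lt (s t : R) : 0 < s -> s < t -> newt0 k t < newt0 k s.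
Proof.
move=> s0 st; have t0 := lt_trans s0 st.
rewrite /newt0 ltf_pV2 ?posrE ?exprn_gt0 ?sqrtr_gt0 //.
by rewrite ltrXn2r ?sqrtr_ge0 // ltr_sqrt.
Qed.

Lemma newton_blowup p (M : R) : exists2 r : R, 0 < r &
  forall x, x != p -> `|x - p| < r -> M < newton p x.
Proof.
pose t : R := (`|M| + 1)^-1.
have M1 : 0 < `|M| + 1 by rewrite ltr_wpDl.
have t0 : 0 < t by rewrite invr_gt0.
have t1 : t <= 1 by rewrite invf_le1 // lerDr.
have dR : 0 < (d%:R : R) by rewrite ltr0n.
exists (t / d%:R); first by rewrite divr_gt0.
move=> x xp; rewrite ltr_pdivlMr // => xr.
have s0 : 0 < sqn (x - p) by apply: sqn_gt0; rewrite subr_eq0.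
have st : Num.sqrt (sqn (x - p)) < t.
  rewrite -(gtr0_norm t0) -sqrtr_sqr ltr_sqrt ?exprn_gt0 //.
  apply: le_lt_trans (sqn_le_norm _) _.
  apply: (@le_lt_trans _ _ ((`|x - p| * d%:R) ^+ 2)).
    rewrite exprMn mulrC ler_wpM2l ?sqr_ge0 // expr2 ler_peMl ?ler1n //; exact: ltW.
  by rewrite ltrXn2r ?mulr_ge0 // ltW.
rewrite /newton /newt0; apply: le_lt_trans (ler_norm M) _.
apply: (@lt_le_trans _ _ (`|M| + 1)); first by rewrite ltrDl.
rewrite -[X in X <= _]invrK lef_pV2 ?posrE ?invr_gt0 ?exprn_gt0 ?sqrtr_gt0 //.
have q0 : 0 <= Num.sqrt (sqn (x - p)) := sqrtr_ge0 _.
rewrite exprS; apply: le_trans (ltW st).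
by rewrite ler_piMr // exprn_ile1 //; exact: le_trans (ltW st) t1.
Qed.

(* A Green function extended by 0 outside of B. *)
Definition green_like B p lam g : Prop :=
  [/\ forall x, x != p -> {for x, continuous g},
      forall e : R, 0 < e -> exists A : R, forall x, A < `|x| -> `|g x| < e,
      forall x, ~ B x -> g x = 0,
      exists u1 u2, full_C2 (B `\ p) g u1 u2 /\ forall x, (B `\ p) x -> \sum_i u2 i i x = 0
    & exists c : R, forall e : R, 0 < e -> exists2 r : R, 0 < r &
        forall x, x != p -> `|x - p| < r -> `|g x - lam * (newton p x - c)| < e].

(** The value of g at p is unconstrained, so the pole is added by hand; this makes the set closed
    without any information on g near p. *)
Definition superlevel p g (e : R) : set V := [set x | x = p \/ e <= `|g x|].

Lemma superlevel_compact B p lam g (e : R) : green_like B p lam g -> 0 < e ->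
  compact (superlevel p g e).
Proof.
move=> [cg vg _ _ _] e0; have [A HA] := vg e e0.
apply: (@bounded_closed_compact_rv R d _ (Num.max A `|p|)).
  move=> x [->|ex]; first by rewrite le_max lexx orbT.
  rewrite leNgt; apply/negP; rewrite gt_max => /andP[/HA + _].
  by rewrite ltNge ex.
apply: closed_epsP => x nx.
have xp : x != p by apply/eqP => xp; apply: nx; left.
have gx : `|g x| < e by rewrite ltNge; apply/negP => h; apply: nx; right.
have /continuous_forP /(_ (e - `|g x|)) [|r r0 Hr] := cg x xp; first by rewrite subr_gt0.
have np : 0 < `|x - p| by rewrite normr_gt0 subr_eq0.
exists (Num.min r `|x - p|); first by rewrite lt_min r0.
move=> y; rewrite lt_min => /andP[/Hr yr yp] [yE|].
  by move: yp; rewrite yE distrC ltxx.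
apply/negP; rewrite -ltNge; have := ler_normD (g y - g x) (g x); rewrite subrK; lra.
Qed.

Lemma superlevel_sub B p lam g (e : R) : green_like B p lam g -> B p -> 0 < e ->
  superlevel p g e `<=` B.
Proof.
move=> [_ _ zg _ _] Bp e0 x [->//|ex]; apply: contrapT => /zg gx.
by move: ex; rewrite gx normr0 leNgt e0.
Qed.

Lemma punctured_compact (K : set V) p (r : R) : compact K ->
  compact [set x | K x /\ r <= `|x - p|].
Proof.
move=> cK; apply: compact_superlevel => // x _; apply: (continuous_comp (f := fun x => x - p)).
  by apply: continuousB; [exact: cvg_id|exact: cst_continuous].
exact: norm_continuous.
Qed.

Lemma open_punctured B p : open B -> open (B `\ p).
Proof.
move=> oB; apply: open_epsP => x [Bx xp].
have [r r0 Hr] := open_ball oB Bx.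
have np : 0 < `|x - p| by rewrite normr_gt0 subr_eq0; apply/eqP.
exists (Num.min r `|x - p|); first by rewrite lt_min r0.
move=> y; rewrite lt_min => /andP[/Hr yr yp]; split => // yE.
by move: yp; rewrite yE distrC ltxx.
Qed.

Lemma green_like_axis B p lam g : open B -> green_like B p lam g ->
  exists u1 u2, axis_C2 (B `\ p) g u1 u2 /\ forall x, (B `\ p) x -> \sum_i u2 i x = 0.
Proof.
move=> oB [_ _ _ [u1 [u2 [H L]]] _]; exists u1, (fun i => u2 i i); split => //.
exact: full_C2_axis (@open_punctured B p oB) H.
Qed.

(** The singular parts of g and g' cancel up to a bounded error, since both have the same factor
    [lam]. Subtracting [t * newton p] drives the difference to minus infinity at the pole, where the
    maximum principle is thereby satisfied; then t tends to 0. *)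
Lemma green_like_le B p lam g g' : open B -> B p ->
  green_like B p lam g -> green_like B p lam g' -> forall x, x != p -> g x <= g' x.
Proof.
move=> oB Bp Gg Gg' x xp; have [Bx|nBx] := pselect (B x); last first.
  by case: Gg Gg' => _ _ zg _ _ [_ _ zg' _ _]; rewrite zg // zg'.
have [u1 [u2 [Hu Lu]]] := green_like_axis oB Gg.
have [v1 [v2 [Hv Lv]]] := green_like_axis oB Gg'.
have Hn := @axis_C2_sub R d _ (B `\ p) _ _ _ (fun x (h : (B `\ p) x) => introN eqP h.2) (@newton_C2 R k p).
have [_ _ _ _ [c Hc]] := Gg; have [_ _ _ _ [c' Hc']] := Gg'.
suff H (t : R) : 0 < t -> g x - g' x <= t * newton p x.
  rewrite -subr_le0 leNgt; apply/negP => gx.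
  have N0 : 0 < newton p x by apply: newt0_gt0; apply: sqn_gt0; rewrite subr_eq0.
  have := H ((g x - g' x) / (2 * newton p x)) ltac:(by rewrite divr_gt0 // mulr_gt0).
  rewrite (_ : _ * newton p x = (g x - g' x) / 2); first lra.
  by field; rewrite gt_eqF.
move=> t0; pose f y := 1 * (1 * g y + (-1) * g' y) + (- t) * newton p y.
suff : f x <= 0 by rewrite /f; lra.
have Hf := axis_C2_lin 1 (- t) (axis_C2_lin 1 (-1) Hu Hv) Hn.
apply: (max_principle _ (@open_punctured B p oB) Hf) => //.
- move=> y By; rewrite big_split /= -!mulr_sumr big_split /= -!mulr_sumr.
  rewrite Lu // Lv // newton_harmonic; last by case: By => _ /eqP.
  lra.
- move=> e e0.
  have [r1 r10 H1] := Hc 1 ltr01; have [r2 r20 H2] := Hc' 1 ltr01.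
  have [r3 r30 H3] := newton_blowup p ((2 + `|lam * (c' - c)|) / t).
  pose r := Num.min r1 (Num.min r2 r3).
  have near y : y != p -> `|y - p| < r -> f y < 0.
    move=> yp; rewrite !lt_min => /andP[/(H1 _ yp) h1 /andP[/(H2 _ yp) h2 /(H3 _ yp)]].
    rewrite ltr_pdivrMr // => h3.
    have : g y - g' y < 2 + `|lam * (c' - c)|.
      move: h1 h2; rewrite !ltr_norml => /andP[_ h1] /andP[h2 _].
      have := ler_norm (lam * (c' - c)); lra.
    by rewrite /f; lra.
  have e2 : 0 < e / 2 by rewrite divr_gt0.
  exists [set y | (superlevel p g (e / 2) `|` superlevel p g' (e / 2)) y /\ r <= `|y - p|]; split.
  + apply: punctured_compact; apply: compactU.
      exact: superlevel_compact Gg e2.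
    exact: superlevel_compact Gg' e2.
  + move=> y [yK yr]; split; first by case: yK; [exact: superlevel_sub Gg _ e2 _|exact: superlevel_sub Gg' _ e2 _].
    move=> yp; move: yr; rewrite yp subrr normr0 leNgt.
    by rewrite !lt_min r10 r20 r30.
  + move=> y [By /eqP yp] fy; split; last first.
      by rewrite leNgt; apply/negP => /(near _ yp); rewrite /f; lra.
    have N0 : 0 <= t * newton p y by rewrite mulr_ge0 ?(ltW t0) // newt0_ge0.
    have [h|h] := leP (e / 2) `|g y|; first by left; right.
    right; right; rewrite leNgt; apply/negP => h'.
    move: h h'; rewrite !ltr_norml => /andP[_ h] /andP[h' _].
    by move: fy; rewrite /f; lra.
- by split => //; apply/eqP.
Qed.

Lemma green_like_unique B p lam g g' : open B -> B p ->
  green_like B p lam g -> green_like B p lam g' -> forall x, x != p -> g x = g' x.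
Proof.
move=> oB Bp Gg Gg' x xp; apply/eqP; rewrite eq_le; apply/andP; split.
  exact: green_like_le Gg Gg' x xp.
exact: green_like_le Gg' Gg x xp.
Qed.

Lemma green_like_near_pole B p lam g : 0 < lam -> green_like B p lam g ->
  forall M : R, exists2 r : R, 0 < r & forall x, x != p -> `|x - p| < r -> M < g x.
Proof.
move=> l0 [_ _ _ _ [c Hc]] M; have [r1 r10 H1] := Hc 1 ltr01.
have [r2 r20 H2] := newton_blowup p ((M + 1) / lam + c).
exists (Num.min r1 r2); first by rewrite lt_min r10.
move=> x xp; rewrite lt_min => /andP[/(H1 _ xp) h1 /(H2 _ xp)].
rewrite -ltrBrDr ltr_pdivrMr // => h2.
by move: h1; rewrite ltr_norml => /andP[h1 _]; lra.
Qed.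

Lemma green_like_ge0 B p lam g : open B -> B p -> 0 < lam -> green_like B p lam g ->
  forall x, x != p -> 0 <= g x.
Proof.
move=> oB Bp l0 Gg x xp; have [Bx|nBx] := pselect (B x); last first.
  by case: Gg => _ _ zg _ _; rewrite zg.
have [u1 [u2 [Hu Lu]]] := green_like_axis oB Gg.
have Hf := axis_C2_lin (-1) 0 Hu Hu.
suff : -1 * g x + 0 * g x <= 0 by lra.
apply: (max_principle _ (@open_punctured B p oB) Hf) => //.
- by move=> y By; rewrite big_split /= -!mulr_sumr Lu //; lra.
- move=> e e0; have [r r0 Hr] := green_like_near_pole l0 Gg 0.
  exists [set y | superlevel p g e y /\ r <= `|y - p|]; split.
  + by apply: punctured_compact; exact: superlevel_compact Gg e0.
  + move=> y [yK yr]; split; first exact: superlevel_sub Gg _ e0 _ yK.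
    by move=> yp; move: yr; rewrite yp subrr normr0 leNgt r0.
  + move=> y [By /eqP yp] fy; split; last first.
      by rewrite leNgt; apply/negP => /(Hr _ yp); lra.
    right; rewrite -normrN; apply: le_trans (ler_norm _); lra.
- by split => //; apply/eqP.
Qed.

(* Comparison with [newton a] on an annulus centred at a. *)
Lemma green_like_pos_step B p lam g b (r0 : R) a : open B -> B p -> 0 < lam ->
  green_like B p lam g -> 0 < r0 -> (forall y, `|y - b| < r0 -> B y /\ y != p) ->
  `|a - b| < r0 / (4 * d%:R) -> 0 < g a -> 0 < g b.
Proof.
move=> oB Bp l0 Gg r00 Hb; have d0 : 0 < (4 * d%:R : R) by rewrite mulr_gt0 // ltr0n.
rewrite ltr_pdivlMr // => ab ga.
have [->//|neab] := eqVneq b a.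
have [cg _ _ _ _] := Gg.
have d1 : 1 <= (d%:R : R) by rewrite ler1n.
have abn : `|a - b| <= r0 / 4.
  have := normr_ge0 (a - b); have : 0 <= `|a - b| * (d%:R - 1) by rewrite mulr_ge0 // subr_ge0.
  lra.
have qb : sqn (b - a) < (r0 / 2) ^+ 2.
  apply: le_lt_trans (sqn_le_norm _) _; rewrite distrC.
  apply: (@le_lt_trans _ _ ((`|a - b| * d%:R) ^+ 2)).
    rewrite exprMn mulrC ler_wpM2l ?sqr_ge0 // expr2 ler_peMl //; lra.
  rewrite ltrXn2r ?mulr_ge0 //; lra.
have qb0 : 0 < sqn (b - a) by apply: sqn_gt0; rewrite subr_eq0.
have inB y : sqn (y - a) <= (r0 / 2) ^+ 2 -> B y /\ y != p.
  move=> yq; apply: Hb.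
  have : `|y - a| <= r0 / 2.
    by apply: norm_le_of_sqn yq; lra.
  have := ler_distD a y b; lra.
have ap : a != p by apply: (inB a _).2; rewrite subrr /sqn big1 ?sqr_ge0 // => i _; rewrite mxE expr0n.
have /continuous_forP /(_ (g a / 2)) [|rho rho0 Hrho] := cg a ap; first by rewrite divr_gt0.
(* The inner sphere is so small that g exceeds [g a / 2] on it and that b stays outside it. *)
pose s := Num.min ((rho / 2) ^+ 2) (sqn (b - a) / 2).
have s0 : 0 < s by rewrite lt_min exprn_gt0 ?divr_gt0.
have sb : s < sqn (b - a) by have : s <= sqn (b - a) / 2 by [rewrite ge_min lexx orbT]; lra.
have gs y : sqn (y - a) <= s -> g a / 2 < g y.
  move=> ys; have : `|y - a| < rho.
    have : `|y - a| <= rho / 2.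
      apply: norm_le_of_sqn; first lra.
      by apply: le_trans ys _; rewrite ge_min lexx.
    lra.
  move=> /Hrho; rewrite ltr_norml => /andP[h _]; lra.
(* The barrier is [c * newton a] minus its value on the outer sphere: it vanishes there, where g is
   nonnegative, and is at most [g a / 2] on the inner sphere. *)
pose S := (r0 / 2) ^+ 2; pose c := g a / 2 / newt0 k s.
have ns0 := newt0_gt0 s0.
have S0 : 0 < S by rewrite exprn_gt0 // divr_gt0.
have c0 : 0 < c by rewrite !divr_gt0.
pose O := [set y : V | s < sqn (y - a) < S].
have oO : open O.
  apply: open_epsP => x /andP[x1 x2].
  have /continuous_forP /(_ (Num.min (sqn (x - a) - s) (S - sqn (x - a)))) [|t t0 Ht] :=
    @sqn_sub_continuous R d a x; first by rewrite lt_min !subr_gt0 x1.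
  exists t => // y /Ht; rewrite lt_min !ltr_norml => /andP[/andP[y1 _] /andP[_ y2]].
  apply/andP; split; lra.
have [u1 [u2 [Hu Lu]]] := green_like_axis oB Gg.
have OB : O `<=` B `\ p by move=> y /andP[_ /ltW /inB [By yp]]; split => //; exact/eqP.
have Oa : O `<=` [set y | y != a].
  move=> y /andP[h _] /=; apply: contraTN h => /eqP ->; rewrite subrr -leNgt.
  by rewrite /sqn big1 ?(ltW s0) // => i _; rewrite mxE expr0n.
have Hf := axis_C2_lin 1 (- 1) (axis_C2_lin c 1 (axis_C2_sub Oa (@newton_C2 R k a)) (@axis_C2_cst R d O (- (c * newt0 k S)))) (axis_C2_sub OB Hu).
have : 1 * (c * newton a b + 1 * - (c * newt0 k S)) + - 1 * g b <= 0.
  apply: (max_principle _ oO Hf) => //.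
  - move=> y Oy; rewrite big_split /= -!mulr_sumr big_split /= -!mulr_sumr.
    rewrite Lu; last exact: OB.
    rewrite newton_harmonic; last exact: Oa.
    rewrite sumr_const mul0rn; lra.
  - move=> e e0.
    pose u y := 1 * (c * newton a y + 1 * - (c * newt0 k S)) + - 1 * g y.
    pose K := [set y : V | s <= sqn (y - a) <= S].
    have cK : compact K.
      apply: (@bounded_closed_compact_rv R d _ (`|a| + r0 / 2)).
        move=> y /andP[_ yS]; have : `|y - a| <= r0 / 2.
          by apply: norm_le_of_sqn yS; lra.
        have := ler_normD (y - a) a; rewrite subrK; lra.
      apply: closed_epsP => x nKx.
      have [x1|x1] := ltP (sqn (x - a)) s.
        have /continuous_forP /(_ (s - sqn (x - a))) [|t t0 Ht] := @sqn_sub_continuous R d a x; first by rewrite subr_gt0.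
        exists t => // y /Ht; rewrite ltr_norml => /andP[_ h] /andP[h' _]; lra.
      have x2 : S < sqn (x - a) by rewrite ltNge; apply/negP => h; apply: nKx; apply/andP.
      have /continuous_forP /(_ (sqn (x - a) - S)) [|t t0 Ht] := @sqn_sub_continuous R d a x; first by rewrite subr_gt0.
      exists t => // y /Ht; rewrite ltr_norml => /andP[h _] /andP[_ h']; lra.
    exists [set y | K y /\ e <= u y]; split.
    + apply: compact_superlevel => // y /andP[y1 y2].
      have ya : y != a.
        apply: contraTN y1 => /eqP ->; rewrite subrr -ltNge.
        by rewrite /sqn big1 // => i _; rewrite mxE expr0n.
      apply: continuous_forD; apply: continuous_forZ; last by apply: cg; exact: (inB y y2).2.
      apply: continuous_forD; last exact: cst_continuous.
      by apply: continuous_forZ; have [] := @newton_C2 R k a y ya.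
    + move=> y [/andP[y1 y2] ey]; apply/andP; split; rewrite lt_neqAle ?y1 ?y2 andbT; apply/eqP => E.
        have := gs y; rewrite -E lexx => /(_ isT) gy.
        move: ey; rewrite /u /newton -E mul1r mul1r => ey.
        have : c * newt0 k s = g a / 2 by rewrite /c divfK // gt_eqF.
        have : 0 <= c * newt0 k S by rewrite mulr_ge0 ?newt0_ge0 ?(ltW c0).
        lra.
      have := green_like_ge0 oB Bp l0 Gg (inB y y2).2.
      move: ey; rewrite /u /newton E; lra.
    + by move=> y /andP[y1 y2] ey; split => //; apply/andP; rewrite !ltW.
  - by apply/andP.
have : c * newt0 k S < c * newton a b by rewrite ltr_pM2l //; apply: newt0_lt.
lra.
Qed.

(** The points where g is positive, together with the pole, form an open set, which is relatively
    closed in B by [green_like_pos_step]. Strict positivity provides a positive lower bound for g on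
    compact sets, below which the truncation level is placed. *)
Lemma green_like_gt0 B p lam g : open B -> connected B -> B p -> 0 < lam ->
  green_like B p lam g -> forall x, B x -> x != p -> 0 < g x.
Proof.
move=> oB coB Bp l0 Gg; have [cg _ zg _ _] := Gg.
pose P := [set x : V | x = p \/ 0 < g x].
have PB : P `<=` B.
  move=> x [->//|gx]; apply: contrapT => /zg E; by move: gx; rewrite E ltxx.
have oP : open P.
  apply: open_epsP => x Px; have [xp|xp] := eqVneq x p.
    have [r r0 Hr] := green_like_near_pole l0 Gg 0; exists r => // y.
    rewrite xp => yr; have [->|yp] := eqVneq y p; first by left.
    by right; exact: Hr.
  have gx : 0 < g x by case: Px => // E; rewrite E eqxx in xp.
  have /continuous_forP /(_ _ gx) [r r0 Hr] := cg x xp; exists r => // y /Hr.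
  by rewrite ltr_norml => /andP[h _]; right; lra.
have EP : P = B.
  apply: coB; first by exists p; left.
    by exists P => //; rewrite setIidr.
  exists (closure P); first exact: closed_closure.
  apply/seteqP; split => [x Px|b [Bb clb]]; first by split; [exact: PB|exact: subset_closure].
  have [->|bp] := eqVneq b p; [by left|right].
  have [r r0 Hr] := open_ball (@open_punctured B p oB) (conj Bb (elimN eqP bp)).
  have d0 : 0 < (4 * d%:R : R) by rewrite mulr_gt0 // ltr0n.
  have [a [Pa ab]] : P `&` ball b (r / (4 * d%:R)) !=set0.
    by apply: clb; apply: nbhsx_ballx; rewrite divr_gt0.
  have ab' : `|a - b| < r / (4 * d%:R) by move: ab; rewrite -ball_normE /= distrC.
  apply: (@green_like_pos_step B p lam g b r a) => //.
    by move=> y /Hr [By yp]; split => //; exact/eqP.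
  case: Pa => // E.
  have : (B `\ p) a.
    apply: Hr; apply: lt_le_trans ab' _; rewrite ler_pdivrMr // ler_peMr ?(ltW r0) //.
    have : 1 <= (d%:R : R) by rewrite ler1n. lra.
  by case=> _ /(_ E).
by move=> x Bx xp; move: Bx; rewrite -EP => -[E|//]; rewrite E eqxx in xp.
Qed.

(** * Invariance under symmetric orthogonal matrices *)

Section Isometry.
Variable M : 'M[R]_d.
Hypotheses (Msym : M^T = M) (Minv : M *m M = 1%:M).

Lemma isoK x : x *m M *m M = x.
Proof. by rewrite -mulmxA Minv mulmx1. Qed.

Lemma sqnE x : sqn x = (x *m x^T) ord0 ord0.
Proof. by rewrite /sqn mxE; apply: eq_bigr => i _; rewrite !mxE expr2. Qed.

Lemma sqn_iso x : sqn (x *m M) = sqn x.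
Proof. by rewrite !sqnE trmx_mul Msym mulmxA isoK. Qed.

Lemma norm_iso x : `|x *m M| <= d%:R * `|x|.
Proof.
apply: norm_le_of_sqn; rewrite ?mulr_ge0 // sqn_iso; apply: le_trans (sqn_le_norm _) _.
by rewrite exprMn ler_wpM2r ?sqr_ge0 // expr2 ler_peMl ?ler1n.
Qed.

Lemma iso_continuous : continuous (fun x : V => x *m M).
Proof.
move=> x A /nbhs_ballP[e /= e0 eA]; apply/nbhs_ballP; exists (e / d%:R) => /=.
  by rewrite divr_gt0 // ltr0n.
move=> y; rewrite -ball_normE /= ltr_pdivlMr ?ltr0n // => yx.
apply: eA; rewrite -ball_normE /=.
by rewrite -mulmxBl; apply: le_lt_trans (norm_iso _) _; rewrite mulrC.
Qed.

Lemma continuous_for_iso (u : V -> R) x :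
  {for x *m M, continuous u} -> {for x, continuous (fun x => u (x *m M))}.
Proof. by move=> cu; apply: (continuous_comp (f := fun x => x *m M)) cu; exact: iso_continuous. Qed.

Lemma is_derive_iso (u : V -> R) x (i : 'I_d) (l : R) :
  is_derive (x *m M) (row i M) u l -> is_derive x (e_ i) (fun x => u (x *m M)) l.
Proof.
move=> /is_derive_epsP H; apply/is_derive_epsP => e /H[r r0 Hr]; exists r => // h h0 hr.
by have := Hr h h0 hr; rewrite rowE mulmxDl -scalemxAl.
Qed.

(** The i-th axis is carried to row i of M, so a partial derivative becomes a directional one, and
    continuity of the partial derivatives is needed to expand it. *)
Lemma full_C2_iso (O : set V) (u : V -> R) u1 u2 : open O -> full_C2 O u u1 u2 ->
  full_C2 [set x | O (x *m M)] (fun x => u (x *m M))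
    (fun i x => \sum_j M i j * u1 j (x *m M))
    (fun i j x => \sum_l M i l * \sum_m M j m * u2 l m (x *m M)).
Proof.
move=> oO H x Ox i.
have [r r0 Hr] := open_ball oO Ox.
have csum (F : 'I_d -> V -> R) (c : 'I_d -> R) : (forall j, {for x *m M, continuous (F j)}) ->
    {for x, continuous (fun x => \sum_j c j * F j (x *m M))}.
  move=> cF; elim: (index_enum _) => [|j s IH].
    rewrite (_ : (fun _ => _) = cst 0); first exact: cst_continuous.
    by apply/funext => y; rewrite big_nil.
  rewrite (_ : (fun _ => _) = (fun y => c j * F j (y *m M) + \sum_(j <- s) c j * F j (y *m M))).
    by apply: continuous_forD => //; apply: continuous_forZ; apply: continuous_for_iso.
  by apply/funext => y; rewrite big_cons.
have c2 l : {for x *m M, continuous (u1 l)} by case: (H _ Ox l).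
split.
- apply: is_derive_iso; apply: (is_derive_eq (C1_derive (u1 := u1) _ _ _)).
  + by exists r => // y /Hr /H Hy j; case: (Hy j).
  + by [].
  + by apply: eq_bigr => j _; rewrite mxE.
- exact: csum.
- move=> j; rewrite (_ : (fun _ => _) = \sum_l (fun x => M i l * u1 l (x *m M))).
    apply: is_derive_sum => l.
    have : is_derive x (e_ j) (fun x => u1 l (x *m M)) (\sum_m M j m * u2 l m (x *m M)).
      apply: is_derive_iso; apply: (is_derive_eq (C1_derive (u1 := u2 l) _ _ _)).
      + by exists r => // y /Hr /H /(_ l)[].
      + by move=> m; case: (H _ Ox l) => _ _ _; exact.
      + by apply: eq_bigr => m _; rewrite mxE.
    by move=> D; exact: (is_deriveZ (M i l) D).
  by apply/funext => y; rewrite fct_sumE.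
- move=> j.
  apply: (csum (fun l y => \sum_m M j m * u2 l m y) (M i)) => l.
  have cs : forall s : seq 'I_d, {for x *m M, continuous (fun y => \sum_(m <- s) M j m * u2 l m y)}.
    elim => [|m s IH].
      rewrite (_ : (fun _ => _) = cst 0); first exact: cst_continuous.
      by apply/funext => y; rewrite big_nil.
    rewrite (_ : (fun _ => _) = (fun y => M j m * u2 l m y + \sum_(m <- s) M j m * u2 l m y)).
      apply: continuous_forD => //; apply: continuous_forZ.
      by case: (H _ Ox l) => _ _ _; exact.
    by apply/funext => y; rewrite big_cons.
  exact: cs.
Qed.

Lemma laplacian_iso (u2 : 'I_d -> 'I_d -> V -> R) x :
  \sum_i \sum_l M i l * \sum_m M i m * u2 l m x = \sum_l u2 l l x.
Proof.
have E l m : \sum_i M i l * M i m = (l == m)%:R.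
  transitivity ((M^T *m M) l m); last by rewrite Msym Minv mxE.
  by rewrite mxE; apply: eq_bigr => i _; rewrite mxE.
transitivity (\sum_l \sum_m (\sum_i M i l * M i m) * u2 l m x).
  rewrite exchange_big /=; apply: eq_bigr => l _.
  under eq_bigr do rewrite mulr_sumr.
  rewrite exchange_big /=; apply: eq_bigr => m _; rewrite mulr_suml.
  by apply: eq_bigr => i _; rewrite mulrA.
apply: eq_bigr => l _; transitivity (\sum_m (l == m)%:R * u2 l m x).
  by apply: eq_bigr => m _; rewrite E.
rewrite (bigD1 l) //= big1 ?addr0 => [|m ml]; first by rewrite eqxx mul1r.
by rewrite eq_sym (negbTE ml) mul0r.
Qed.

Lemma green_like_iso B p lam g : open B -> (forall x, B x -> B (x *m M)) ->
  green_like B p lam g -> green_like B (p *m M) lam (fun x => g (x *m M)).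
Proof.
move=> oB BM [cg vg zg [u1 [u2 [H L]]] [c Hc]].
have ne x : x != p *m M -> x *m M != p.
  by apply: contraNN => /eqP <-; rewrite isoK.
have d0 : 0 < (d%:R : R) by rewrite ltr0n.
split.
- by move=> x /ne xp; apply: continuous_for_iso; exact: cg.
- move=> e /vg[A HA]; exists (d%:R * A) => x Ax; apply: HA.
  rewrite -(ltr_pM2l d0); apply: lt_le_trans Ax _.
  by rewrite -{1}(isoK x); exact: norm_iso.
- by move=> x nBx; apply: zg => /BM; rewrite isoK.
- exists (fun i x => \sum_j M i j * u1 j (x *m M)), (fun i j x => \sum_l M i l * \sum_m M j m * u2 l m (x *m M)).
  have sub x : (B `\ p *m M) x -> (B `\ p) (x *m M).
    by move=> [Bx xp]; split; [exact: BM|move=> E; apply: xp; rewrite /= -E isoK].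
  split; last by move=> x /sub /L; rewrite laplacian_iso.
  move=> x /sub Bx; exact: (full_C2_iso (@open_punctured B p oB) H Bx).
- exists c => e /Hc[r r0 Hr]; exists (r / d%:R); first by rewrite divr_gt0.
  move=> x /ne xp; rewrite ltr_pdivlMr // => xr.
  have -> : newton (p *m M) x = newton p (x *m M).
    by rewrite /newton -[in LHS]sqn_iso mulmxBl isoK.
  apply: Hr => //; rewrite -[p]isoK -mulmxBl.
  by apply: le_lt_trans (norm_iso _) _; rewrite mulrC.
Qed.

End Isometry.

Lemma norm_le_enorm x : `|x| <= enorm x.
Proof. by apply: norm_le_of_sqn; rewrite ?sqrtr_ge0 // sqr_sqrtr // sqn_ge0. Qed.

Definition extend0 B g x : R := if `[< B x >] then g x else 0.

(** Points outside B are either boundary points, where the vanishing condition makes the extension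
    continuous, or exterior points, near which the extension is identically 0. *)
Lemma is_green_green_like B p g : open B -> B p -> is_green_function B p g ->
  green_like B p (lambda R d) (extend0 B g).
Proof.
move=> oB Bp [[C2 L] bg [c Hc] ig].
have oBp := @open_punctured B p oB.
have near_in x : (B `\ p) x -> \forall y \near x, g y = extend0 B g y.
  move=> Bx; have : \forall y \near x, (B `\ p) y by exact: open_nbhs_nbhs (conj oBp Bx).
  by apply: filterS => y [By _]; rewrite /extend0 asboolT.
have Hfull : full_C2 (B `\ p) (extend0 B g) (fun i => partial i g) (fun i j => partial j (partial i g)).
  move=> x Bx i; have [H1 H2 H3 H4] := C2 x Bx; split.
  - by apply: near_eq_is_derive (near_in x Bx) _; exact: derivableP (H1 i).
  - exact: H2.
  - by move=> j; exact: derivableP (H3 i j).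
  - exact: H4.
have closB x : ~ B x -> forall e : R, 0 < e ->
    exists2 r : R, 0 < r & forall y, `|y - x| < r -> `|extend0 B g y| < e.
  move=> nBx e e0; have [clx|nclx] := pselect (closure B x).
    have bx : boundary B x by split => //; rewrite (interior_id B).1.
    have /cvg_eps /(_ e e0) := bg x bx; rewrite /within /= => /nbhs_ballP[r /= r0 Hr].
    exists r => // y yx; rewrite /extend0; case: asboolP => [By|_]; last by rewrite normr0.
    by have := Hr y; rewrite -ball_normE /= distrC subr0; apply.
  have oC : open (~` closure B) by rewrite openC; exact: closed_closure.
  have [r r0 Hr] := open_ball oC nclx; exists r => // y /Hr ny.
  by rewrite /extend0 asboolF ?normr0 // => By; apply: ny; exact: subset_closure.
split.
- move=> x /eqP xp; have [Bx|nBx] := pselect (B x).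
    by have [] := full_C2_axis oBp Hfull (conj Bx xp).
  apply/continuous_forP => e /(closB x nBx)[r r0 Hr]; exists r => // y /Hr.
  by rewrite {3}/extend0 asboolF // subr0.
- move=> e e0; have [[A [_ HA]]|nb] := pselect (bounded_set B).
    exists (A + 1) => x Ax; rewrite /extend0 asboolF ?normr0 // => Bx.
    have : `|x| <= A + 1 by apply: (HA (A + 1) _ x Bx); rewrite ltrDl.
    by rewrite leNgt Ax.
  have [A HA] := ig nb e e0; exists A => x Ax; rewrite /extend0; case: asboolP => [Bx|_].
    by apply: HA => //; apply: lt_le_trans (norm_le_enorm x).
  by rewrite normr0.
- by move=> x nBx; rewrite /extend0 asboolF.
- by exists (fun i => partial i g), (fun i j => partial j (partial i g)); split => // x /L.
- exists c => e e0; move: Hc => /cvg_eps /(_ e e0); rewrite /dnbhs /within /= => /nbhs_ballP[r /= r0 Hr].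
  have [r' r0' Hr'] := open_ball oB Bp.
  exists (Num.min r r'); first by rewrite lt_min r0.
  move=> x xp; rewrite lt_min => /andP[xr xr'].
  rewrite /extend0 asboolT; last exact: Hr'.
  have := Hr x; rewrite -ball_normE /= distrC subr0 !subSS subn0 => H.
  exact: H.
Qed.

End PotentialTheory.

(** * Truncated Green functions on lattices *)

Section EuclideanNorm.
Variables (R : realType) (n : nat).
Local Notation k := n.+1.
Local Notation d := k.+2.
Local Notation V := 'rV[R]_d.
Local Notation e_ i := (delta_mx ord0 i : V).
Implicit Types (x y p : V) (r t h : R).

Lemma enorm_ge0 x : 0 <= enorm x.
Proof. exact: sqrtr_ge0. Qed.

Lemma enorm_sqr x : enorm x ^+ 2 = sqn x.
Proof. by rewrite sqr_sqrtr // sqn_ge0. Qed.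

Lemma enorm_leE x r : 0 <= r -> (enorm x <= r) = (sqn x <= r ^+ 2).
Proof. by move=> r0; rewrite -enorm_sqr ler_pXn2r ?nnegrE // enorm_ge0. Qed.

Lemma enorm_axis x i t : enorm (x + t *: e_ i) <= enorm x + `|t|.
Proof.
rewrite enorm_leE ?addr_ge0 ?enorm_ge0 //.
have := sqn_line x 0 i t; rewrite !subr0 => ->.
have xi : t * x ord0 i <= `|t| * enorm x.
  apply: le_trans (ler_norm _) _; rewrite normrM ler_wpM2l //.
  exact: le_trans (rv_coord_le _ _) (norm_le_enorm x).
by rewrite -enorm_sqr -(real_normK (num_real t)); nra.
Qed.

Lemma enorm_step p x i t : enorm (x + t *: e_ i - p) <= enorm (x - p) + `|t|.
Proof. by rewrite addrAC; exact: enorm_axis. Qed.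

Lemma enorm_step_ge p x i t : enorm (x - p) - `|t| <= enorm (x + t *: e_ i - p).
Proof.
have := enorm_step p (x + t *: e_ i) i (- t).
by rewrite scaleNr addrK normrN; lra.
Qed.

Lemma enorm_continuous p : continuous (fun x => enorm (x - p)).
Proof.
move=> x; apply: (continuous_comp (f := fun x => sqn (x - p))).
  exact: sqn_sub_continuous.
exact: sqrt_continuous.
Qed.

Lemma enorm_eball_compact p r : compact [set x : V | enorm (x - p) <= r].
Proof.
apply: (@bounded_closed_compact_rv R d _ (`|p| + r)).
  move=> x /= xr; have := norm_le_enorm (x - p).
  have := ler_normD (x - p) p; rewrite subrK; lra.
by apply: closed_comp (@closed_le _ _) => x _; exact: enorm_continuous.
Qed.

Lemma enorm_pole p : enorm (p - p) = 0.
Proof.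
apply/eqP; rewrite eq_le enorm_ge0 andbT subrr enorm_leE //.
by rewrite /sqn big1 ?expr0n // => i _; rewrite mxE expr0n.
Qed.

(** Only increments to lattice neighbours enter [dlap]. Thus a function that agrees with another at
    x up to a constant and lies below it at the neighbours has the smaller discrete Laplacian at
    x. *)
Lemma ler_dlap h (u v : V -> R) x : 0 < h ->
  (forall i t, `|t| = h -> u (x + t *: e_ i) - u x <= v (x + t *: e_ i) - v x) ->
  dlap h u x <= dlap h v x.
Proof.
move=> h0 H; rewrite /dlap ler_wpM2l ?invr_ge0 ?exprn_ge0 ?(ltW h0) //.
apply: ler_sum => i _; have h1 := H i h (gtr0_norm h0).
have h2 := H i (- h) (etrans (normrN _) (gtr0_norm h0)).
by move: h2; rewrite scaleNr; lra.
Qed.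

Lemma dlap_supported h A (u : V -> R) : 0 < h -> supported A u -> supported (A + h) (dlap h u).
Proof.
move=> h0 su x Ax; rewrite /dlap big1 ?mulr0 // => i _.
have nrm : `|h *: e_ i| = h by rewrite normrZ rv_norm_axis mulr1 gtr0_norm.
have a1 := lerB_dist x (- (h *: e_ i)); have a2 := lerB_dist x (h *: e_ i).
rewrite opprK normrN nrm in a1; rewrite nrm in a2.
by rewrite !su; [ring|lra|lra|lra].
Qed.

End EuclideanNorm.

Section TruncatedGreen.
Variables (R : realType) (n : nat).
Local Notation k := n.+1.
Local Notation d := k.+2.
Local Notation V := 'rV[R]_d.
Local Notation e_ i := (delta_mx ord0 i : V).
Variables (B : set V) (p : V) (lam : R) (g : V -> R).
Hypotheses (oB : open B) (coB : connected B) (Bp : B p) (lam0 : 0 < lam)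
  (Gg : green_like B p lam g).
Variables (r M eps A0 : R).
Hypotheses (r0 : 0 < r) (ballB : forall x, enorm (x - p) <= 2 * r -> B x)
  (gM : forall x, x != p -> r / 2 <= enorm (x - p) -> g x <= M)
  (eps0 : 0 < eps) (epsM : 2 * eps < M)
  (geps : forall x, x != p -> enorm (x - p) <= 2 * r -> 2 * eps < g x)
  (gA : forall x, x = p \/ eps <= g x -> `|x| <= A0).
Implicit Types (x y : V) (h e : R).

(** Clipping g to [eps, M] removes the pole and the boundary; lowering it by eps gives compact
    support. At p, where g is arbitrary, the maximal value is prescribed. *)
Definition tgreen x : R := if x == p then M - eps else Num.min (Num.max (g x) eps) M - eps.

Lemma tgreen_ge0 x : 0 <= tgreen x.
Proof.
have e0 := eps0; have eM := epsM.
rewrite /tgreen; case: ifP => _; first lra.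
by rewrite subr_ge0 le_min le_max lexx orbT /=; lra.
Qed.

Lemma tgreen_le x : tgreen x <= M - eps.
Proof. by rewrite /tgreen; case: ifP => _ //; rewrite lerD2r ge_min lexx orbT. Qed.

Lemma tgreen_le_green x : x != p -> eps <= g x -> tgreen x <= g x - eps.
Proof.
by move=> xp gx; rewrite /tgreen (negbTE xp) lerD2r (max_l gx) ge_min lexx.
Qed.

Lemma tgreen_ge_green x : x != p -> g x <= M -> g x - eps <= tgreen x.
Proof.
move=> xp gx; rewrite /tgreen (negbTE xp) lerD2r le_min gx andbT.
by rewrite le_max lexx.
Qed.

Lemma tgreenE x : x != p -> eps <= g x -> g x <= M -> tgreen x = g x - eps.
Proof.
by move=> xp g1 g2; apply/eqP; rewrite eq_le tgreen_le_green // tgreen_ge_green.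
Qed.

Lemma tgreen0 x : x != p -> g x <= eps -> tgreen x = 0.
Proof.
have e0 := eps0; have eM := epsM.
move=> xp gx; rewrite /tgreen (negbTE xp) (max_r gx) min_l ?subrr //; lra.
Qed.

Lemma tgreen_supported : supported A0 tgreen.
Proof.
move=> x Ax; have xp : x != p.
  by apply: contraTN Ax => /eqP xp; rewrite -leNgt; apply: gA; left.
apply: tgreen0 => //; rewrite leNgt; apply/negP => gx.
by move: Ax; rewrite ltNge gA //; right; exact: ltW.
Qed.

Lemma A0_ge0 : 0 <= A0.
Proof. by apply: le_trans (normr_ge0 p) _; apply: gA; left. Qed.

Lemma ball_norm_le x : enorm (x - p) <= 2 * r -> `|x| <= A0.
Proof.
move=> xr; apply: gA; have [->|xp] := eqVneq x p; first by left.
by right; have := geps xp xr; have := eps0; lra.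
Qed.

Lemma outside_ne x (s : R) : 0 <= s -> s < enorm (x - p) -> x != p.
Proof. by move=> s0; apply: contraTN => /eqP ->; rewrite enorm_pole -leNgt. Qed.

(* [- dlap h tgreen] is nearly nonnegative near the pole, nearly nonpositive
   away from it, and nearly zero where the truncation is not active. *)
Definition truncation_signs e h :=
  [/\ forall x, enorm (x - p) <= r -> - e <= - dlap h tgreen x,
      forall x, r < enorm (x - p) -> - dlap h tgreen x <= e
    & forall x, r < enorm (x - p) -> 2 * eps <= g x -> `|dlap h tgreen x| <= e].

(** Where the upper clip is active the truncation is maximal, and where the lower clip is active it
    is minimal, so the sign there is exact. At the other points it agrees with g up to a constant,
    its neighbours err on the favourable side only, and the discrete Laplacian of g is uniformly
    small by harmonicity. *)
Lemma truncation_signs_near e : 0 < e ->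
  exists2 h0 : R, 0 < h0 & forall h, 0 < h -> h < h0 -> truncation_signs e h.
Proof.
have r0' := r0; have eps0' := eps0; have epsM' := epsM.
move=> e0; have [u1 [u2 [Hu Lu]]] := green_like_axis oB Gg.
have oBp := @open_punctured R n B p oB.
have [r1 r10 Hr1] := green_like_near_pole lam0 Gg M.
have [cg _ _ _ _] := Gg.
(* The ball of radius [r1] around the pole is removed: g exceeds M there, so the upper clip is
   active. *)
pose Z1 := [set x | [set x | enorm (x - p) <= r] x /\ r1 <= `|x - p|].
have cZ1 : compact Z1 by apply: punctured_compact; exact: enorm_eball_compact.
have Z1p x : Z1 x -> x != p.
  by move=> [_]; apply: contraTN => /eqP ->; rewrite subrr normr0 -ltNge.
have Z1B : Z1 `<=` B `\ p.
  move=> x xZ; split; last exact/eqP/Z1p.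
  by apply: ballB; case: xZ => /= + _; lra.
pose Z2 := [set x | superlevel p g eps x /\ r <= enorm (x - p)].
have cZ2 : compact Z2.
  apply: compact_superlevel => [|x _]; last exact: enorm_continuous.
  exact: superlevel_compact Gg eps0.
have Z2p x : Z2 x -> x != p.
  by move=> [_ xr]; apply: contraTN xr => /eqP ->; rewrite enorm_pole -ltNge.
have Z2B : Z2 `<=` B `\ p.
  move=> x xZ; split; last exact/eqP/Z2p.
  by case: xZ => /(superlevel_sub Gg Bp eps0).
have [h1 h10 H1] := dlap_uniform oBp cZ1 Z1B Hu e0.
have [h2 h20 H2] := dlap_uniform oBp cZ2 Z2B Hu e0.
(* With tolerance eps, the neighbours of a point where g is at least [2 * eps] still have g at least
   eps, so neither clip is active there. *)
have [h3 h30 H3] := compact_uniform cZ2 (fun x Zx => cg x (Z2p x Zx)) eps0.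
have g0 := green_like_ge0 oB Bp lam0 Gg.
exists (Num.min (Num.min h1 h2) (Num.min (Num.min h3 r1) (r / 2))).
  by rewrite !lt_min h10 h20 h30 r10 divr_gt0.
move=> h h0; rewrite !lt_min => /andP[/andP[hh1 hh2] /andP[/andP[hh3 hr1] hr]].
have nb x i t : `|t| = h -> `|x + t *: e_ i - x| = h.
  by move=> th; rewrite addrC addKr normrZ rv_norm_axis mulr1.
have Z2h x : Z2 x -> `|dlap h g x| <= e.
  by move=> Zx; have := H2 h x h0 hh2 Zx; rewrite Lu ?subr0 //; exact: Z2B.
have out x i t : r < enorm (x - p) -> `|t| = h ->
    x + t *: e_ i != p /\ g (x + t *: e_ i) <= M.
  move=> xr th; have := enorm_step_ge p x i t; rewrite th => st.
  have ne : x + t *: e_ i != p by apply: (@outside_ne _ (r / 2)); lra.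
  by split => //; apply: gM => //; lra.
split.
- move=> x xr; rewrite lerN2; have [xp|xp] := eqVneq x p.
    apply: le_trans (ltW e0); rewrite -(dlap_cst h 0 x); apply: ler_dlap => // i t _.
    have := tgreen_le (x + t *: e_ i).
    have -> : tgreen x = M - eps by rewrite /tgreen xp eqxx.
    lra.
  have [Mx|xM] := leP M (g x).
    apply: le_trans (ltW e0); rewrite -(dlap_cst h 0 x); apply: ler_dlap => // i t _.
    have := tgreen_le (x + t *: e_ i).
    have -> : tgreen x = M - eps by rewrite /tgreen (negbTE xp) min_r // le_max Mx.
    lra.
  have Zx : Z1 x.
    by split => //; rewrite leNgt; apply/negP => /(Hr1 _ xp); lra.
  have := H1 h x h0 hh1 Zx; rewrite Lu ?subr0; last exact: Z1B.
  move=> /ler_normlW; apply: le_trans; apply: ler_dlap => // i t th.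
  have xr2 : enorm (x - p) <= 2 * r by lra.
  have gx2 := geps xp xr2.
  rewrite (tgreenE xp _ (ltW xM)); last lra.
  have yp : x + t *: e_ i != p.
    apply: contraTneq hr1 => E; rewrite -leNgt -(nb x i t th) E distrC.
    by case: Zx.
  have := @tgreen_le_green (x + t *: e_ i) yp; have := geps yp.
  have := enorm_step p x i t; rewrite th; lra.
- move=> x xr; have xp : x != p by apply: outside_ne xr; exact: ltW.
  have [gx|gx] := leP (g x) eps.
    apply: le_trans (ltW e0); rewrite oppr_le0 -(dlap_cst h 0 x); apply: ler_dlap => // i t th.
    by rewrite (tgreen0 xp gx) !subr0 tgreen_ge0.
  have Zx : Z2 x.
    by split; [right; exact: le_trans (ltW gx) (ler_norm _)|exact: ltW].
  have := Z2h x Zx; rewrite ler_norml => /andP[gl _].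
  rewrite lerNl; apply: le_trans gl _; apply: ler_dlap => // i t th.
  rewrite (tgreenE xp (ltW gx)); last by apply: gM => //; lra.
  have [yp yM] := out x i t xr th.
  by have := tgreen_ge_green yp yM; lra.
- move=> x xr gx; have xp : x != p by apply: outside_ne xr; exact: ltW.
  have Zx : Z2 x.
    split; last exact: ltW.
    by right; apply: le_trans (ler_norm _); lra.
  have -> : dlap h tgreen x = dlap h g x.
    have E i t : `|t| = h -> tgreen (x + t *: e_ i) - tgreen x = g (x + t *: e_ i) - g x.
      move=> th; have [yp yM] := out x i t xr th.
      have := H3 x (x + t *: e_ i) Zx; rewrite nb // => /(_ hh3); rewrite ltr_norml => /andP[y1 _].
      rewrite !tgreenE //; [ring|lra| |lra].
      by apply: gM => //; lra.
    by apply/eqP; rewrite eq_le !ler_dlap // => i t /E ->.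
  exact: Z2h.
Qed.

Lemma bump_outside x : 2 * r <= enorm (x - p) -> bump r p x = 0.
Proof.
move=> xr; apply: bump_outer => //; rewrite -enorm_sqr.
have : (2 * r) ^+ 2 <= enorm (x - p) ^+ 2.
  by rewrite ler_pXn2r ?nnegrE ?enorm_ge0 ?mulr_ge0 // ltW.
have := sqr_ge0 r; rewrite exprMn; lra.
Qed.

Lemma bump_inside x : enorm (x - p) <= r -> bump r p x = 1.
Proof. by move=> xr; apply: bump_inner => //; rewrite -enorm_leE // ltW. Qed.

(** The bump separates the positive mass at the pole from the negative mass near the boundary; it is
    smooth so that the Laplacian can be moved onto it. *)
Definition charge h N := lsum h N (fun x => bump r p x * - dlap h tgreen x).

Definition volume : R := (2 * (A0 + 1) + 1) ^+ d.

Lemma volume_ge0 : 0 <= volume.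
Proof. by rewrite exprn_ge0 //; have := A0_ge0; lra. Qed.

Lemma lsum_volume h N : 0 < h -> h <= 1 -> lsum h N (cube (0 : V) (A0 + 1)) <= volume.
Proof.
move=> h0 h1; have A0' := A0_ge0; apply: le_trans (lsum_cube_le _ _ h0 _) _; first lra.
by apply: lerXn2r; rewrite ?nnegrE; lra.
Qed.

Lemma test_estimate h N e (w : V -> R) (E a eta : R) :
  0 < h -> h <= 1 -> A0 + 4 < h * N%:R -> 0 <= e -> truncation_signs e h ->
  (forall x, `|w x| <= E) -> 0 <= eta ->
  (forall x, enorm (x - p) <= r -> `|w x - a| <= eta) ->
  (forall x, r < enorm (x - p) -> g x < 2 * eps -> `|w x| <= eta) ->
  `|lsum h N (fun x => w x * - dlap h tgreen x) - a * charge h N| <=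
  2 * eta * (charge h N + 3 * e * volume) + (E + `|a|) * e * volume.
Proof.
move=> h0 h1 AN e0 [S1 S2 S3] wE eta0 win wout.
have A0' := A0_ge0; have r0' := r0.
have E0 : 0 <= E := le_trans (normr_ge0 _) (wE 0).
pose L x := - dlap h tgreen x.
have Lsup x : A0 + 1 < `|x| -> L x = 0.
  by move=> xA; rewrite /L (dlap_supported h0 tgreen_supported) ?oppr0 //; lra.
pose chi := cube (0 : V) (A0 + 1).
have chi1 x : `|x| <= A0 + 1 -> chi x = 1 by move=> xA; rewrite /chi cubeE ?subr0 ?xA //; lra.
have chi0 x : A0 + 1 < `|x| -> chi x = 0.
  by move=> xA; rewrite /chi cubeE ?subr0 1?leNgt ?xA //; lra.
have vol : lsum h N chi <= volume by exact: lsum_volume.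
have vol0 : 0 <= lsum h N chi by apply: lsum_ge0 => [|x]; [exact: ltW|rewrite /chi /cube ler0n].
pose I x : R := ((enorm (x - p) <= r)%R)%:R.
have SL : lsum h N L = 0.
  rewrite /L; have -> : lsum h N (fun x => - dlap h tgreen x) = lsum h N (fun x => -1 * dlap h tgreen x).
    by apply: eq_lsum => t; rewrite mulN1r.
  by rewrite lsumZ (lsum_dlap0 h0 h1 tgreen_supported) ?mulr0 //; lra.
have bumpL x : `|bump r p x * L x - I x * L x| <= e * chi x.
  have [xA|xA] := leP `|x| (A0 + 1); last by rewrite Lsup // !mulr0 subrr normr0 chi0 // mulr0.
  rewrite chi1 // mulr1 /I; have [xr|xr] := leP (enorm (x - p)) r.
    by rewrite bump_inside // subrr normr0.
  rewrite mul0r subr0; have [xr2|xr2] := leP (2 * r) (enorm (x - p)).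
    by rewrite bump_outside // mul0r normr0.
  have xp : x != p by apply: outside_ne xr; exact: ltW.
  have gx := geps xp (ltW xr2).
  have /andP[b0 b1] := bump_01 r p x.
  rewrite normrM (ger0_norm b0) /L normrN; apply: le_trans (S3 x xr (ltW gx)).
  by rewrite ler_piMl.
have SI : lsum h N (fun x => I x * L x) <= charge h N + e * lsum h N chi.
  rewrite -lerBlDl -lsumZ /charge -lsumB; apply: lsum_le => [|x]; first exact: ltW.
  have := bumpL x; rewrite /L ler_norml => /andP[]; lra.
(* The first two terms add up to [eta * L x] in the ball and to [- eta * L x] outside it, where L
   has the respective sign up to e. The middle term sums to 0, so only the mass inside the ball is
   left. *)
pose F x := (2 * eta) * (I x * L x) + ((- eta) * L x + ((4 * eta + E + `|a|) * e) * chi x).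
have FP x : `|w x * L x - a * (bump r p x * L x)| <= F x.
  have [xA|xA] := leP `|x| (A0 + 1); last first.
    by rewrite /F Lsup // chi0 // !mulr0 !addr0 subrr normr0.
  rewrite /F chi1 // mulr1 /I; have [xr|xr] := leP (enorm (x - p)) r.
    rewrite bump_inside // !mul1r -mulrBl normrM.
    have Lx : - e <= L x := S1 x xr.
    have Lx' : `|L x| <= L x + 2 * e by rewrite ler_norml; lra.
    have wx := win x xr; have := normr_ge0 a.
    have : `|w x - a| * `|L x| <= eta * (L x + 2 * e) by apply: ler_pM.
    have : 0 <= E * e by exact: mulr_ge0.
    have : 0 <= `|a| * e by exact: mulr_ge0.
    have : 0 <= eta * e by exact: mulr_ge0.
    by rewrite !mulrDl !mulrDr; lra.
  rewrite mul0r mulr0 add0r.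
  have Lx : L x <= e := S2 x xr.
  have Lx' : `|L x| <= 2 * e - L x by rewrite ler_norml; lra.
  have t1 : 0 <= E * e by exact: mulr_ge0.
  have t2 : 0 <= `|a| * e by exact: mulr_ge0.
  have t3 : 0 <= eta * e by exact: mulr_ge0.
  have xp : x != p by apply: outside_ne xr; exact: ltW.
  have [gx|gx] := leP (2 * eps) (g x).
    have Le : `|L x| <= e by rewrite /L normrN; exact: S3.
    have /andP[b0 b1] := bump_01 r p x.
    have : eta * L x <= eta * e by rewrite ler_wpM2l.
    have : `|w x * L x - a * (bump r p x * L x)| <= E * e + `|a| * e.
      apply: le_trans (ler_normB _ _) _; apply: lerD; rewrite normrM; apply: ler_pM => //.
      by rewrite normrM (ger0_norm b0); apply: le_trans Le; rewrite ler_piMl.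
    rewrite !mulrDl; lra.
  have -> : bump r p x = 0.
    apply: bump_outside; rewrite leNgt; apply/negP => /ltW /(geps xp); lra.
  rewrite mul0r mulr0 subr0 normrM.
  have : `|w x| * `|L x| <= eta * (2 * e - L x) by apply: ler_pM => //; exact: wout.
  rewrite mulrBr !mulrDl; lra.
have SF : lsum h N F = 2 * eta * lsum h N (fun x => I x * L x) + (4 * eta + E + `|a|) * e * lsum h N chi.
  rewrite /F lsumD lsumZ lsumD lsumZ lsumZ SL mulr0 add0r //.
rewrite /charge -lsumZ -lsumB; apply: le_trans (lsum_norm _ _ (ltW h0)) _.
apply: le_trans (lsum_le _ (ltW h0) FP) _; rewrite SF.
have : 2 * eta * lsum h N (fun x => I x * L x) <= 2 * eta * (charge h N + e * volume).
  rewrite ler_wpM2l ?mulr_ge0 //; apply: le_trans SI _.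
  by rewrite lerD2l ler_wpM2l.
have : (4 * eta + E + `|a|) * e * lsum h N chi <= (4 * eta + E + `|a|) * e * volume.
  by rewrite ler_wpM2l // mulr_ge0 // !addr_ge0 // mulr_ge0.
rewrite -/(charge h N); move: (charge h N) volume (lsum h N _) (lsum h N _) => *; lra.
Qed.

End TruncatedGreen.

(** * Lattice sums of the source *)

Section SourceSums.
Variables (R : realType) (n : nat).
Local Notation k := n.+1.
Local Notation d := k.+2.
Local Notation V := 'rV[R]_d.
Implicit Types (x y p : V) (h e rho : R).

Lemma source_ge0 rho p x : 0 <= source rho p x.
Proof.
have d0 : 0 <= d%:R :> R by [].
apply: mulr_ge0; last by rewrite le_max lexx orbT.
apply: mulr_ge0; first lra.
by rewrite /newt2 divr_ge0 ?exprn_ge0 ?sqrtr_ge0 // mulr_ge0 // mulr_ge0.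
Qed.

Lemma source_outside rho p x : 0 < rho -> rho <= enorm (x - p) -> source rho p x = 0.
Proof.
move=> r0 h; rewrite /source max_r ?mulr0 // subr_le0 -enorm_sqr.
by rewrite ler_pXn2r ?nnegrE ?enorm_ge0 // ltW.
Qed.

Lemma source_continuous rho p : continuous (source rho p : V -> R).
Proof.
move=> x.
suff H : {for x, continuous (fun y : V => (2 * d%:R + 4) * newt2 k (rho ^+ 2) * Num.max (rho ^+ 2 - sqn (y - p)) 0)}.
  exact: H.
apply: continuous_forZ.
have -> : (fun y : V => Num.max (rho ^+ 2 - sqn (y - p)) 0) =
  (fun y => 2^-1 * ((rho ^+ 2 + - 1 * sqn (y - p)) + `|rho ^+ 2 + - 1 * sqn (y - p)|)).
  by apply/funext => y; rewrite mulN1r maxr_absE subr0 addr0 mulrC.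
have c1 : {for x, continuous (fun y : V => rho ^+ 2 + - 1 * sqn (y - p))}.
  apply: continuous_forD; first exact: cst_continuous.
  by apply: continuous_forZ; exact: sqn_sub_continuous.
apply: continuous_forZ; apply: continuous_forD => //.
exact: (continuous_comp c1 (@norm_continuous _ _ _)).
Qed.

Lemma source_translate rho p : 0 < rho -> forall e, 0 < e ->
  exists2 h0 : R, 0 < h0 & forall h N, 0 < h -> h < h0 -> rho + `|p| + 2 < h * N%:R ->
    `|lsum h N (source rho p) - lsum h N (source rho (0 : V))| <= e.
Proof.
move=> r0 e e0.
have sup : supported rho (source rho (0 : V)).
  move=> x xr; apply: source_outside => //; rewrite subr0.
  exact: le_trans (ltW xr) (norm_le_enorm x).
have [h0 h00 H] := lsum_translate p (ltW r0) (@source_continuous rho 0) sup e0.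
exists h0 => // h N hp hh hN; have := H h N hp hh hN.
have -> // : (fun x => source rho 0 (x - p)) = source rho p.
by apply/funext => x; rewrite /source subr0.
Qed.

Definition source_const : R := (2 * d%:R + 4) * (k%:R * d%:R / 4).

Lemma source_const_gt0 : 0 < source_const.
Proof. by rewrite /source_const mulr_gt0 ?addr_gt0 ?divr_gt0 ?mulr_gt0 ?ltr0n. Qed.

Lemma sourceE rho p x : 0 < rho ->
  source rho p x = source_const * rho ^- d * (rho ^- 2 * Num.max (rho ^+ 2 - sqn (x - p)) 0).
Proof.
move=> r0; rewrite /source /source_const /newt2 sqrtr_sqr gtr0_norm //.
rewrite (_ : k.+4 = (d + 2)%N); last by rewrite addn2.
rewrite exprD invfM; ring.
Qed.

(** The source scales like the inverse d-th power of rho, so its total does not depend on rho to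
    leading order. The lower bound uses the cube of half-side rho/(2d), where the squared norm is at
    most a quarter of the square of rho; the upper bound uses the cube of half-side rho. *)
Lemma source_lsum_bounds : exists c0 C0 : R, [/\ 0 < c0, 0 < C0 &
  forall rho, 0 < rho -> forall h N, 0 < h -> h <= rho / (2 * d%:R) -> rho < h * N%:R ->
    c0 <= lsum h N (source rho (0 : V)) <= C0].
Proof.
have sc0 := source_const_gt0; have d0 : 0 < (d%:R : R) by rewrite ltr0n.
have d1 : 1 <= (d%:R : R) by rewrite ler1n.
exists (source_const * (3 / 4) * (2 * d%:R)^-1 ^+ d), (source_const * 3 ^+ d); split.
- apply: mulr_gt0; first by apply: mulr_gt0 => //; lra.
  by rewrite exprn_gt0 // invr_gt0; lra.
- by rewrite mulr_gt0 ?exprn_gt0.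
move=> rho r0 h N h0 hr rN; apply/andP; split.
- pose a := rho / (2 * d%:R).
  have a0 : 0 < a by rewrite divr_gt0 // mulr_gt0.
  have E : lsum h N (fun x => source_const * rho ^- d * (3 / 4) * cube (0 : V) a x) <= lsum h N (source rho (0 : V)).
    apply: lsum_le => [|x]; first exact: ltW.
    rewrite cubeE ?(ltW a0) // subr0; have [xa|xa] := leP `|x| a; last by rewrite mulr0 source_ge0.
    rewrite mulr1 sourceE // ler_wpM2l ?mulr_ge0 ?invr_ge0 ?exprn_ge0 ?(ltW sc0) ?(ltW r0) // subr0.
    rewrite [leRHS]mulrC ler_pdivlMr ?exprn_gt0 //.
    have : sqn x <= rho ^+ 2 / 4.
      apply: le_trans (sqn_le_norm x) _.
      have : `|x| ^+ 2 <= a ^+ 2 by rewrite ler_pXn2r ?nnegrE // ltW.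
      move=> /(ler_wpM2l (ltW d0)) /le_trans; apply.
      rewrite /a; have -> : d%:R * (rho / (2 * d%:R)) ^+ 2 = rho ^+ 2 / 4 / d%:R.
        by field; rewrite gt_eqF.
      by rewrite ler_pdivrMr // ler_peMr ?divr_ge0 ?sqr_ge0.
    by rewrite le_max => h1; apply/orP; left; lra.
  apply: le_trans E; rewrite lsumZ.
  have L : a ^+ d <= lsum h N (cube (0 : V) a).
    have ha : h <= a by exact: hr.
    have ar : a <= rho by rewrite /a ler_pdivrMr ?mulr_gt0 // ler_peMr ?(ltW r0) //; lra.
    apply: (@le_trans _ _ ((2 * a - h) ^+ d)).
      by apply: lerXn2r; rewrite ?nnegrE; lra.
    by apply: lsum_cube_ge => //; [lra|rewrite normr0 add0r; lra].
  apply: le_trans (ler_wpM2l _ L); last first.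
    by rewrite !mulr_ge0 ?invr_ge0 ?exprn_ge0 ?(ltW sc0) ?(ltW r0).
  rewrite /a exprMn le_eqVlt; apply/orP; left; apply/eqP; field.
  by rewrite expf_neq0 // gt_eqF.
- have E : lsum h N (source rho (0 : V)) <= lsum h N (fun x => source_const * rho ^- d * cube (0 : V) rho x).
    apply: lsum_le => [|x]; first exact: ltW.
    rewrite cubeE ?(ltW r0) // subr0; have [xa|xa] := leP `|x| rho; last first.
      rewrite mulr0 source_outside // subr0; apply: le_trans (ltW xa) (norm_le_enorm x).
    rewrite sourceE // ler_wpM2l ?mulr_ge0 ?invr_ge0 ?exprn_ge0 ?(ltW sc0) ?(ltW r0) // subr0.
    rewrite [leLHS]mulrC ler_pdivrMr ?exprn_gt0 // mul1r ge_max sqr_ge0 andbT.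
    by rewrite gerBl sqn_ge0.
  apply: (le_trans E); rewrite lsumZ.
  have hr' : h <= rho.
    by apply: (le_trans hr); rewrite ler_pdivrMr ?mulr_gt0 // ler_peMr ?(ltW r0) //; lra.
  have U : lsum h N (cube (0 : V) rho) <= (3 * rho) ^+ d.
    apply: le_trans (lsum_cube_le _ _ h0 (ltW r0)) _.
    by apply: lerXn2r; rewrite ?nnegrE; lra.
  apply: (le_trans (ler_wpM2l _ U)).
    by rewrite !mulr_ge0 ?invr_ge0 ?exprn_ge0 ?(ltW sc0) ?(ltW r0).
  rewrite exprMn le_eqVlt; apply/orP; left; apply/eqP; field.
  by rewrite expf_neq0 // gt_eqF.
Qed.

End SourceSums.

(** * The charge of a truncated Green function *)

Section PoleCharge.
Variables (R : realType) (n : nat).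
Local Notation k := n.+1.
Local Notation d := k.+2.
Local Notation V := 'rV[R]_d.
Local Notation e_ i := (delta_mx ord0 i : V).
Variables (B : set V) (p : V) (lam : R) (g : V -> R).
Hypotheses (lam0 : 0 < lam).
Variables (r M eps A0 c etaH : R).
Hypotheses (r0 : 0 < r) (r1 : r <= 1)
  (gM : forall x, x != p -> r / 2 <= enorm (x - p) -> g x <= M)
  (eps0 : 0 < eps) (epsM : 2 * eps < M)
  (geps : forall x, x != p -> enorm (x - p) <= 2 * r -> 2 * eps < g x)
  (gA : forall x, x = p \/ eps <= g x -> `|x| <= A0)
  (etaH0 : 0 <= etaH)
  (gH : forall x, x != p -> enorm (x - p) <= 2 * r -> `|g x - lam * (newton p x - c)| <= etaH).
Implicit Types (x y : V) (h e : R).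

(** The first factor bounds the Laplacian of the bump, with 1 added for the discretization error,
    both in units of the inverse square of r. The second comes from the volume of its support, a
    lattice sum of at most (5r)^d, where r^d is at most r^2 for r <= 1. *)
Definition bump_const : R := (72 * d%:R + 8 * (30 * 30) + 1) * 5 ^+ d.

Lemma bump_const_ge0 : 0 <= bump_const.
Proof. by rewrite mulr_ge0 ?exprn_ge0 // !addr_ge0 ?mulr_ge0. Qed.

Local Notation tg := (tgreen p g M eps).

(** The Laplacian is moved onto the bump, whose discrete Laplacian lives in an annulus away from the
    pole. There the truncation differs from [lam] times the smoothed kernel by a constant up to
    [etaH], and constants pair to 0. Moving the Laplacian back onto the smoothed kernel produces the
    source. *)
Lemma charge_estimate e : 0 < e ->
  exists2 h0 : R, 0 < h0 & forall h N, 0 < h -> h < h0 -> A0 + 4 < h * N%:R ->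
    `|charge p g r M eps h N - lam * lsum h N (source (r / 2) p)| <= etaH * bump_const + e.
Proof.
move=> e0; have r0' := r0; have r1' := r1; have eps0' := eps0; have epsM' := epsM.
have A00 : 0 <= A0 := A0_ge0 gA.
pose phi : V -> R := bump r p.
pose Psi : V -> R := newton_smooth (r / 2) p.
have rh0 : 0 < r / 2 by lra.
pose K := [set x : V | enorm (x - p) <= 2 * r].
have cK : compact K := @enorm_eball_compact R n p (2 * r).
have KT : K `<=` setT by [].
have r2 : 0 < (r ^+ 2)^-1 by rewrite invr_gt0 exprn_gt0.
have [h1 h10 H1] := dlap_uniform openT cK KT (@bump_C2 R d r p) r2.
have P5 : 0 < (5 ^+ d : R) by rewrite exprn_gt0.
pose e' := e / (lam * 5 ^+ d).
have e'0 : 0 < e' by rewrite divr_gt0 // mulr_gt0.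
have [h2 h20 H2] := dlap_uniform openT cK KT (@newton_smooth_C2 R k (r / 2) p rh0) e'0.
exists (Num.min (Num.min h1 h2) (r / 4)); first by rewrite !lt_min h10 h20; lra.
move=> h N h0; rewrite !lt_min => /andP[/andP[hh1 hh2] hr] AN.
have h1' : h <= 1 by lra.
have nbU x i t : `|t| = h -> enorm (x + t *: e_ i - p) <= enorm (x - p) + h.
  by move=> <-; exact: enorm_step.
have nbL x i t : `|t| = h -> enorm (x - p) - h <= enorm (x + t *: e_ i - p).
  by move=> <-; exact: enorm_step_ge.
have dlap_flat (cc : R) x : phi x = cc -> (forall i t, `|t| = h -> phi (x + t *: e_ i) = cc) -> dlap h phi x = 0.
  move=> px pn; rewrite -(dlap_cst h cc x); apply/eqP; rewrite eq_le.
  by rewrite !ler_dlap // => i t th; rewrite pn // px.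
have phi1 x : enorm (x - p) <= r -> phi x = 1 by exact: bump_inside.
(* Since h < r/4, the neighbours of a point beyond 2r stay beyond 7r/4, and the square of 7/4 still
   exceeds 2, where the cutoff ends. *)
have phi0 x : 7 / 4 * r <= enorm (x - p) -> phi x = 0.
  move=> xr; apply: bump_outer => //; rewrite -enorm_sqr.
  have : (7 / 4 * r) ^+ 2 <= enorm (x - p) ^+ 2.
    by rewrite ler_pXn2r ?nnegrE ?enorm_ge0 ?mulr_ge0 ?divr_ge0 // ltW.
  have := sqr_ge0 r; rewrite exprMn; lra.
have dphi_in x : enorm (x - p) <= r / 2 -> dlap h phi x = 0.
  move=> xr; apply: (dlap_flat 1) => [|i t th]; first by apply: phi1; lra.
  by apply: phi1; have := nbU x i t th; lra.
have dphi_out x : 2 * r <= enorm (x - p) -> dlap h phi x = 0.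
  move=> xr; apply: (dlap_flat 0) => [|i t th]; first by apply: phi0; lra.
  by apply: phi0; have := nbL x i t th; lra.
pose Cb : R := (72 * d%:R + 8 * (30 * 30) + 1) * (r ^+ 2)^-1.
have Cb0 : 0 <= Cb by rewrite mulr_ge0 ?(ltW r2) // !addr_ge0 ?mulr_ge0.
have dphi x : `|dlap h phi x| <= Cb.
  have [xr|xr] := leP (enorm (x - p)) (2 * r); last by rewrite dphi_out ?normr0 // ltW.
  have := H1 h x h0 hh1 xr; have := @bump_laplacian_bound R d r p x r0.
  have -> : Cb = (r ^+ 2)^-1 + (72 * d%:R + 8 * (30 * 30)) * (r ^+ 2)^-1 by rewrite /Cb; ring.
  move=> b1 b2.
  rewrite -[dlap _ _ _](subrK (\sum_i bump2 r p i x)); apply: le_trans (ler_normD _ _) _.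
  exact: lerD.
have supphi : supported A0 phi.
  move=> x xA; apply: bump_outside => //; rewrite leNgt; apply/negP => xr.
  move: xA; rewrite ltNge; apply/negP; rewrite negbK.
  exact: (ball_norm_le eps0 geps gA (ltW xr)).
pose chi := cube p (2 * r).
have chiE x : enorm (x - p) <= 2 * r -> chi x = 1.
  move=> xr; rewrite /chi cubeE; last lra.
  by rewrite (le_trans (norm_le_enorm _) xr).
have chi_ge0 x : 0 <= chi x by rewrite /chi /cube ler0n.
have Schi : lsum h N chi <= 5 ^+ d * r ^+ 2.
  apply: le_trans (lsum_cube_le _ _ h0 _) _; first lra.
  apply: (@le_trans _ _ ((5 * r) ^+ d)); first by apply: lerXn2r; rewrite ?nnegrE; lra.
  rewrite exprMn ler_wpM2l ?(ltW P5) // (_ : r ^+ d = r ^+ k * r ^+ 2); last by rewrite -exprD addn2.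
  by rewrite ler_piMl ?sqr_ge0 // exprn_ile1 // ltW.
have Schi0 : 0 <= lsum h N chi by apply: lsum_ge0 => //; exact: ltW.
pose Hc := - lam * c - eps.
pose F x := (tg x - lam * Psi x - Hc) * dlap h phi x.
have EC : 0 <= etaH * Cb := mulr_ge0 etaH0 Cb0.
have FB x : `|F x| <= etaH * Cb * chi x.
  have [xr|xr] := leP (enorm (x - p)) (r / 2).
    by rewrite /F dphi_in // mulr0 normr0; exact: mulr_ge0 EC (chi_ge0 x).
  have [xr2|xr2] := leP (2 * r) (enorm (x - p)).
    by rewrite /F dphi_out // mulr0 normr0; exact: mulr_ge0 EC (chi_ge0 x).
  have xp : x != p by apply: outside_ne xr; lra.
  rewrite chiE ?(ltW xr2) // mulr1 /F normrM; apply: ler_pM => //.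
  have gx := geps xp (ltW xr2).
  rewrite (tgreenE xp); [|lra|by apply: gM => //; exact: ltW].
  rewrite /Psi newton_smooth_far; last first.
    by rewrite -enorm_sqr ler_pXn2r ?nnegrE ?enorm_ge0 // ltW.
  have := gH xp (ltW xr2); congr (`|_| <= _); rewrite /Hc; ring.
have E1 : charge p g r M eps h N = - lsum h N (fun x => tg x * dlap h phi x).
  rewrite (lsum_dlap_sym phi h0 h1' (tgreen_supported eps0 epsM gA)) //; last lra.
  by rewrite -mulN1r -lsumZ; apply: eq_lsum => t; rewrite mulrN mulN1r.
have E2 : lsum h N (fun x => tg x * dlap h phi x) =
    lam * lsum h N (fun x => phi x * dlap h Psi x) + lsum h N F.
  rewrite (lsum_dlap_sym Psi h0 h1' supphi) //; last lra.
  transitivity (lsum h N (fun x => (lam * (Psi x * dlap h phi x) + Hc * dlap h phi x) + F x)).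
    by apply: eq_lsum => t; rewrite /F; ring.
  have Z : lsum h N (dlap h phi) = 0 by apply: (lsum_dlap0 h0 h1' supphi) => //; lra.
  by rewrite lsumD lsumD (lsumZ h N lam) (lsumZ h N Hc) Z mulr0 addr0.
have E3 : `|lsum h N F| <= etaH * bump_const.
  apply: le_trans (lsum_norm _ _ (ltW h0)) _.
  apply: le_trans (lsum_le _ (ltW h0) FB) _; rewrite lsumZ -mulrA ler_wpM2l //.
  apply: le_trans (ler_wpM2l Cb0 Schi) _.
  rewrite /Cb /bump_const le_eqVlt; apply/orP; left; apply/eqP; field.
  by rewrite gt_eqF.
have E4 : `|lsum h N (fun x => phi x * dlap h Psi x) + lsum h N (source (r / 2) p)| <= e' * 5 ^+ d.
  rewrite -lsumD; apply: le_trans (lsum_norm _ _ (ltW h0)) _.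
  apply: (@le_trans _ _ (lsum h N (fun x => e' * chi x))).
    apply: lsum_le => [|x]; first exact: ltW.
    have [xr|xr] := leP (enorm (x - p)) (2 * r); last first.
      have -> : phi x = 0 by apply: phi0; lra.
      have -> : source (r / 2) p x = 0 by apply: source_outside => //; lra.
      by rewrite mul0r addr0 normr0; exact: mulr_ge0 (ltW e'0) (chi_ge0 x).
    rewrite chiE // mulr1; have := H2 h x h0 hh2 xr.
    rewrite newton_smooth_laplacian // opprK => hx.
    have -> : source (r / 2) p x = phi x * source (r / 2) p x.
      have [xr2|xr2] := leP (enorm (x - p)) r; first by rewrite phi1 // mul1r.
      by rewrite source_outside ?mulr0 //; lra.
    have /andP[b0 b1] := bump_01 r p x.
    rewrite -mulrDr normrM (ger0_norm b0); apply: le_trans hx.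
    by rewrite ler_piMl.
  rewrite lsumZ ler_wpM2l ?(ltW e'0) //; apply: (le_trans Schi).
  by rewrite ler_piMr ?(ltW P5) // exprn_ile1 // ltW.
rewrite E1 E2.
have -> : - (lam * lsum h N (fun x => phi x * dlap h Psi x) + lsum h N F) - lam * lsum h N (source (r / 2) p) =
  - (lsum h N F + lam * (lsum h N (fun x => phi x * dlap h Psi x) + lsum h N (source (r / 2) p))) by ring.
rewrite normrN; apply: le_trans (ler_normD _ _) _; apply: lerD => //.
rewrite normrM gtr0_norm //; apply: le_trans (ler_wpM2l (ltW lam0) E4) _.
by rewrite /e' le_eqVlt; apply/orP; left; apply/eqP; field; rewrite !gt_eqF.
Qed.

End PoleCharge.

Section PoleLemma.
Variables (R : realType) (n : nat).
Local Notation k := n.+1.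
Local Notation d := k.+2.
Local Notation V := 'rV[R]_d.
Implicit Types (B K : set V) (p x : V).

(* On fine lattices, [- dlap h] of a truncated Green function acts on a test
   function w that is nearly constant near the pole and small near the
   boundary as evaluation at the pole, times a charge independent of the pole. *)
Lemma green_truncation (lam : R) : 0 < lam -> exists2 C : R, 0 < C &
  forall B p g, open B -> connected B -> B p -> green_like B p lam g ->
  forall eta : R, 0 < eta -> eta <= 1 ->
  exists2 r1 : R, 0 < r1 & forall r, 0 < r -> r < r1 ->
  forall K, compact K -> K `<=` B ->
  exists (G : V -> R) (A0 E0 : R),
    [/\ 0 <= A0, supported A0 G, forall x, `|G x| <= E0,
        forall x, r < enorm (x - p) -> `|G x - g x| <= eta &
        forall (w : V -> R) (E a eta1 : R), 0 < eta1 -> (forall x, `|w x| <= E) ->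
        (forall x, enorm (x - p) <= r -> `|w x - a| <= eta1) ->
        (forall x, r < enorm (x - p) -> ~ K x -> `|w x| <= eta1) ->
        exists2 h0 : R, 0 < h0 & forall h N, 0 < h -> h < h0 -> A0 + `|p| + 4 < h * N%:R ->
          `|lsum h N (fun x => w x * - dlap h G x) -
            a * (lam * lsum h N (source (r / 2) (0 : V)))| <= C * (eta1 + `|a| * eta)].
Proof.
move=> lam0; have [c0 [C0 [c00 C00 source_bd]]] := source_lsum_bounds R n.
pose Cb := @bump_const R n; have Cb0 : 0 <= Cb := @bump_const_ge0 R n.
have lC : 0 < lam * C0 by exact: mulr_gt0.
(* The charge is at most [lam * C0 + Cb + 1], and the discretization adds 3 to it. This part
   multiplies [eta1]; the summand [Cb + 1] multiplies [eta] and accounts for replacing the charge by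
   that of the source. *)
exists (2 * (lam * C0 + Cb + 4) + 1 + (Cb + 1)); first lra.
move=> B p g oB coB Bp Gg eta eta0 eta1.
have [cg vg zg _ [c Hc]] := Gg.
have [s1 s10 Hs1] := open_ball oB Bp.
have [s2 s20 Hs2] := Hc eta eta0.
exists (Num.min 1 (Num.min (s1 / 2) (s2 / 2))); first by rewrite !lt_min ltr01 !divr_gt0.
move=> r r0; rewrite !lt_min => /andP[r1 /andP[rs1 rs2]] K cK KB.
have ballB x : enorm (x - p) <= 2 * r -> B x.
  by move=> xr; apply: Hs1; apply: le_lt_trans (norm_le_enorm _) _; lra.
have gH x : x != p -> enorm (x - p) <= 2 * r -> `|g x - lam * (newton p x - c)| <= eta.
  by move=> xp xr; apply/ltW/Hs2 => //; apply: le_lt_trans (norm_le_enorm _) _; lra.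
have ne_far x (s : R) : 0 < s -> s <= enorm (x - p) -> x != p.
  by move=> s0; apply: contraTN => /eqP ->; rewrite enorm_pole -ltNge.
pose K1 := [set x | superlevel p g 1 x /\ r / 2 <= enorm (x - p)].
have rh0 : 0 < r / 2 by lra.
have cK1 : compact K1.
  by apply: compact_superlevel => [|x _]; [exact: superlevel_compact Gg ltr01|exact: enorm_continuous].
have [M M0 HM] := compact_bounded_fun cK1 (fun x (Kx : K1 x) => cg x (ne_far x _ rh0 Kx.2)).
have gM x : x != p -> r / 2 <= enorm (x - p) -> g x <= M + 1.
  move=> xp xr; have [h|h] := leP 1 `|g x|.
    have K1x : K1 x by split => //; right.
    by have := HM x K1x; have := ler_norm (g x); lra.
  by have := ler_norm (g x); lra.
have [s3 s30 Hs3] := green_like_near_pole lam0 Gg 1.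
(* The part of K and of the ball of radius 2r close to the pole is left out, since g exceeds 1 there
   anyway. *)
pose K2 := [set x | (K `|` [set x : V | enorm (x - p) <= 2 * r]) x /\ s3 <= `|x - p|].
have K2p x : K2 x -> x != p.
  by move=> [_]; apply: contraTN => /eqP ->; rewrite subrr normr0 -ltNge.
have cK2 : compact K2.
  by apply: punctured_compact; apply: compactU => //; exact: enorm_eball_compact.
have [m m0 Hm] := compact_min_pos cK2 (fun x Kx => cg x (K2p x Kx)) (fun x Kx =>
  green_like_gt0 oB coB Bp lam0 Gg (match Kx.1 with or_introl h => KB x h | or_intror h => ballB x h end) (K2p x Kx)).
(* Then [2 * eps] is below g on K and on the ball of radius 2r, so the boundary layer avoids K,
   while the lowering by eps stays within the tolerance eta. *)
pose eps := Num.min m eta / 4.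
have me0 : 0 < Num.min m eta by rewrite lt_min m0.
have mm : Num.min m eta <= m by rewrite ge_min lexx.
have meta : Num.min m eta <= eta by rewrite ge_min lexx orbT.
have eps0 : 0 < eps by rewrite /eps; lra.
have epsM : 2 * eps < M + 1 by rewrite /eps; lra.
have gKeps x : x != p -> (K x \/ enorm (x - p) <= 2 * r) -> 2 * eps < g x.
  move=> xp xK; have [h|h] := ltP `|x - p| s3.
    by have := Hs3 x xp h; rewrite /eps; lra.
  have K2x : K2 x by [].
  by have := Hm x K2x; rewrite /eps; lra.
have geps x : x != p -> enorm (x - p) <= 2 * r -> 2 * eps < g x.
  by move=> xp xr; apply: gKeps => //; right.
have [A0 A00 HA0] := compact_norm_bounded (superlevel_compact Gg eps0).
have gA x : x = p \/ eps <= g x -> `|x| <= A0.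
  move=> h; apply: HA0; case: h => [->|h]; [by left|right].
  exact: le_trans h (ler_norm _).
have g0 := green_like_ge0 oB Bp lam0 Gg.
exists (tgreen p g (M + 1) eps), A0, (M + 1); split.
- exact: ltW.
- exact: (tgreen_supported eps0 epsM gA).
- move=> x; rewrite ger0_norm; last exact: (tgreen_ge0 p g eps0 epsM).
  by apply: le_trans (tgreen_le _ _ _ _ _) _; lra.
- move=> x xr; have xp : x != p by apply: (ne_far x r) => //; exact: ltW.
  have gx0 := g0 x xp.
  have [gx|gx] := leP (g x) eps.
    rewrite (tgreen0 eps0 epsM xp gx) sub0r normrN ger0_norm //.
    by move: gx; rewrite /eps; lra.
  rewrite (tgreenE xp (ltW gx)); last by apply: gM => //; lra.
  by rewrite addrAC subrr add0r normrN gtr0_norm // /eps; lra.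
move=> w E a eta' eta'0 wE win wout.
pose vol := volume n A0; have vol0 : 0 <= vol := volume_ge0 gA.
have E0 : 0 <= E := le_trans (normr_ge0 _) (wE 0).
have na := normr_ge0 a.
pose T := (E + `|a| + 1) * (vol + 1).
have T0 : 0 < T by rewrite mulr_gt0 //; clear - E0 na vol0; lra.
(* The tolerance e is fixed after E, a and the volume, so that all terms containing e are absorbed
   by [eta']. *)
pose e := Num.min 1 eta' / T.
have me1 : 0 < Num.min 1 eta' by rewrite lt_min ltr01.
have m1 : Num.min 1 eta' <= 1 by rewrite ge_min lexx.
have m2 : Num.min 1 eta' <= eta' by rewrite ge_min lexx orbT.
have e0 : 0 < e by rewrite divr_gt0.
have eT : e * T = Num.min 1 eta' by rewrite /e divfK // gt_eqF.
have b1 : e * vol <= 1.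
  apply: le_trans m1; rewrite -eT ler_pM2l // /T.
  have : 0 <= (E + `|a|) * (vol + 1) by rewrite mulr_ge0 //; clear - E0 na vol0; lra.
  rewrite !mulrDl; clear - E0 na vol0; lra.
have b2 : (E + `|a|) * e * vol <= eta'.
  apply: le_trans m2; rewrite -eT mulrAC mulrC ler_pM2l // /T mulrDr mulr1.
  have : 0 <= (E + `|a|) by clear - E0 na; lra.
  rewrite !mulrDl mul1r; clear - E0 na vol0; lra.
have [h1 h10 H1] := truncation_signs_near oB Bp lam0 Gg r0 ballB gM eps0 epsM geps e0.
have eta2 : 0 < eta / 2 by clear - eta0; lra.
have [h2 h20 H2] := charge_estimate lam0 r0 (ltW r1) gM eps0 epsM geps gA (ltW eta0) gH eta2.
have el : 0 < eta / 2 / lam by rewrite divr_gt0.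
have [h3 h30 H3] := source_translate p rh0 el.
exists (Num.min (Num.min h1 h2) (Num.min (Num.min h3 1) (r / 2 / (2 * d%:R)))).
  by rewrite !lt_min h10 h20 h30 ltr01 divr_gt0 // mulr_gt0 // ltr0n.
move=> h N h0; rewrite !lt_min => /andP[/andP[hh1 hh2] /andP[/andP[hh3 hh4] hh5]] hN.
have np := normr_ge0 p.
have AN : A0 + 4 < h * N%:R by clear - hN np; lra.
have S := H1 h h0 hh1.
have := H2 h N h0 hh2 AN; set kap := charge _ _ _ _ _ _ _ => kapE.
have kapT : `|lsum h N (source (r / 2) p) - lsum h N (source (r / 2) (0 : V))| <= eta / 2 / lam.
  by apply: H3 => //; clear - hN A00 r1; lra.
have hN1 : r / 2 < h * N%:R by clear - hN A00 np r1; lra.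
have /andP[_ src] := source_bd (r / 2) rh0 h N h0 (ltW hh5) hN1.
pose s0 := lam * lsum h N (source (r / 2) (0 : V)).
have s0C : s0 <= lam * C0 by rewrite ler_pM2l.
have kaps : `|kap - s0| <= eta * (Cb + 1).
  have -> : kap - s0 = (kap - lam * lsum h N (source (r / 2) p)) +
    lam * (lsum h N (source (r / 2) p) - lsum h N (source (r / 2) (0 : V))) by rewrite /s0; ring.
  apply: le_trans (ler_normD _ _) _.
  have : `|lam * (lsum h N (source (r / 2) p) - lsum h N (source (r / 2) (0 : V)))| <= eta / 2.
    by rewrite normrM gtr0_norm // mulrC -ler_pdivlMr.
  have -> : eta * (Cb + 1) = eta * Cb + eta by ring.
  by move: kapE; rewrite -/Cb; clear; lra.
have wout' x : r < enorm (x - p) -> g x < 2 * eps -> `|w x| <= eta'.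
  move=> xr gx; apply: wout => // Kx.
  have xp : x != p by apply: (ne_far x r) => //; exact: ltW.
  by have := gKeps x xp (or_introl Kx); clear - gx; lra.
have := test_estimate r0 eps0 epsM geps gA h0 (ltW hh4) AN (ltW e0) S wE (ltW eta'0) win wout'.
rewrite -/kap -/vol => TE.
have kapC : kap <= lam * C0 + Cb + 1.
  have : eta * (Cb + 1) <= Cb + 1 by rewrite ler_piMl //; clear - Cb0; lra.
  by move: kaps; rewrite ler_norml => /andP[_]; clear - s0C; lra.
rewrite -/s0.
have -> : lsum h N (fun x => w x * - dlap h (tgreen p g (M + 1) eps) x) - a * s0 =
  (lsum h N (fun x => w x * - dlap h (tgreen p g (M + 1) eps) x) - a * kap) + a * (kap - s0) by ring.
apply: le_trans (ler_normD _ _) _.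
have t1 : `|a * (kap - s0)| <= `|a| * (eta * (Cb + 1)) by rewrite normrM ler_wpM2l.
have t2 : 2 * eta' * (kap + 3 * e * vol) <= 2 * eta' * (lam * C0 + Cb + 4).
  by rewrite ler_pM2l ?mulr_gt0 //; clear - b1 kapC; lra.
have ae : 0 <= `|a| * eta by rewrite mulr_ge0 // ltW.
have aeC : 0 <= `|a| * eta * (2 * (lam * C0 + Cb + 4) + 1) by rewrite mulr_ge0 //; clear - Cb0 lC; lra.
have eC : 0 <= eta' * (Cb + 1).
  by rewrite mulr_ge0 //; [exact: ltW|clear - Cb0; lra].
clear - TE t1 t2 ae aeC eC b2 eta'0; lra.
Qed.

End PoleLemma.

(** * Reflection positivity *)

Section ReflectionPositivity.
Variables (R : realType) (n : nat).
Local Notation k := n.+1.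
Local Notation d := k.+2.
Local Notation V := 'rV[R]_d.
Local Notation e_ i := (delta_mx ord0 i : V).
Implicit Types (x y p : V) (f g : V -> R).

Lemma finite_small (I : finType) (P : I -> R -> Prop) :
  (forall i, exists2 r1 : R, 0 < r1 & forall r, 0 < r -> r < r1 -> P i r) ->
  exists2 r1 : R, 0 < r1 & forall r, 0 < r -> r < r1 -> forall i, P i r.
Proof.
move=> H; have /choice[r1 Hr1] : forall i, exists r1 : R, 0 < r1 /\
    forall r, 0 < r -> r < r1 -> P i r.
  by move=> i; have [r1 r10 H1] := H i; exists r1.
exists (\big[Order.min/1]_i r1 i).
  by apply/lt_bigmin => // i _; have [] := Hr1 i.
move=> r r0 rr i; have [_] := Hr1 i; apply => //.
by apply: lt_le_trans rr _; exact: bigmin_le_cond.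
Qed.

Variable i0 : 'I_d.
Local Notation sigma := (@flip R d i0).

Lemma flipK : involutive sigma.
Proof. by move=> x; apply/rowP => j; rewrite !mxE; case: (j == i0); rewrite ?opprK. Qed.

Lemma flip_coord x : sigma x ord0 i0 = - x ord0 i0.
Proof. by rewrite mxE eqxx. Qed.

Lemma flip_id x : x ord0 i0 = 0 -> sigma x = x.
Proof.
by move=> x0; apply/rowP => j; rewrite mxE; case: eqP => // ->; rewrite x0 oppr0.
Qed.

Lemma flipB x y : sigma x - sigma y = sigma (x - y).
Proof. by apply/rowP => j; rewrite !mxE; case: (j == i0); rewrite ?opprK // opprD opprK. Qed.

Lemma norm_flip x : `|sigma x| = `|x|.
Proof.
suff H y : `|sigma y| <= `|y|.
  by apply/eqP; rewrite eq_le H /= -{1}(flipK x) H.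
apply/rv_norm_le => // j; rewrite mxE; case: (j == i0); rewrite ?normrN; exact: rv_coord_le.
Qed.

Lemma flip_axis x (h : R) i :
  sigma (x + h *: e_ i) = sigma x + (if i == i0 then - h else h) *: e_ i.
Proof.
apply/rowP => j; rewrite !mxE eqxx /=; have [->|ji] := eqVneq j i.
  by case: (i == i0); rewrite ?mulr1 // opprD.
by rewrite !mulr0 !addr0.
Qed.

Lemma dlap_flip (h : R) f x : dlap h (fun y => f (sigma y)) x = dlap h f (sigma x).
Proof.
rewrite /dlap; congr (_ * _); apply: eq_bigr => i _.
rewrite -scaleNr !flip_axis; case: (i == i0) => //.
by rewrite opprK !scaleNr; ring.
Qed.

Lemma dlap_sum (I : finType) (c : I -> R) (F : I -> V -> R) (h : R) x :
  dlap h (fun y => \sum_i c i * F i y) x = \sum_i c i * dlap h (F i) x.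
Proof.
rewrite /dlap; under [RHS]eq_bigr do rewrite mulrCA mulr_sumr.
rewrite -mulr_sumr exchange_big /=; congr (_ * _); apply: eq_bigr => j _.
by rewrite mulr_sumr -big_split -sumrB /=; apply: eq_bigr => i _; ring.
Qed.

Lemma flip_continuous : continuous (sigma : V -> V).
Proof.
move=> x A /nbhs_ballP[e /= e0 eA]; apply/nbhs_ballP; exists e => //= y.
rewrite -ball_normE /= => yx; apply: eA; rewrite -ball_normE /=.
by rewrite flipB norm_flip.
Qed.

Lemma compact_flip (K : set V) : compact K -> compact [set x | K (sigma x)].
Proof.
move=> cK; suff -> : [set x | K (sigma x)] = sigma @` K.
  apply: continuous_compact cK; apply: continuous_subspaceT; exact: flip_continuous.
apply/seteqP; split => [x Kx|_ [x Kx <-]] /=; last by rewrite flipK.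
by exists (sigma x) => //; rewrite flipK.
Qed.

Lemma compact_fin_union (I : finType) (K : I -> set V) : (forall i, compact (K i)) ->
  compact [set x | exists i, K i x].
Proof.
move=> cK; suff -> : [set x | exists i, K i x] = \big[setU/set0]_(i <- enum I | true) K i.
  exact: bigsetU_compact.
apply/seteqP; split => x; rewrite -bigcup_seq_cond /=.
  by move=> [i Kx]; exists i => //=; rewrite mem_enum.
by move=> [i _ Kx]; exists i.
Qed.

Definition fold f x := if x ord0 i0 <= 0 then f x else f (sigma x).

(* Summation by parts and the symmetry [lsum_flip] turn the Dirichlet form of
   [fold f] into the integral of [fold_weight f] against [- dlap h f]; in the
   application the latter is concentrated at points of the positive half-space,
   where [fold_weight f] is the reflection of f. *)
Definition fold_weight f x :=
  if x ord0 i0 < 0 then 2 * f x - f (sigma x) else fold f x.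

Lemma fold_energy (h : R) N A f : 0 < h -> h <= 1 -> supported A f -> 0 <= A ->
  A + 2 < h * N%:R ->
  0 <= lsum h N (fun x => fold_weight f x * - dlap h f x).
Proof.
move=> h0 h1 sf A0 AN.
have se : supported A (fold f).
  by move=> x Ax; rewrite /fold sf // sf ?norm_flip // if_same.
pose m x := (if x ord0 i0 < 0 then f (sigma x) - f x else 0) * dlap h f x.
have E1 : lsum h N (fun x => f x * dlap h (fold f) x) = lsum h N (fun x => fold f x * dlap h f x).
  by rewrite (lsum_dlap_sym f h0 h1 se A0 AN).
(* The difference [f - fold f] vanishes on the closed negative half-space, and on the other side
   [fold f] is [f] composed with the reflection. Reflecting the sum places the correction [m] in the
   negative half-space. *)
have E2 : lsum h N (fun x => (f x - fold f x) * dlap h (fold f) x) = lsum h N m.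
  rewrite -(lsum_flip h N i0 m); apply: eq_lsum => t; set x := lpoint h t.
  rewrite /m flip_coord flipK oppr_lt0 /fold.
  have [x0|x0] := leP (x ord0 i0) 0; first by rewrite subrr !mul0r.
  congr (_ * _); rewrite -dlap_flip /dlap; congr (_ * _).
  (* A lattice point with positive coordinate is at distance at least h from the mirror, so its
     neighbours stay in the closed half-space and none of them sees the fold. *)
  have xh : h <= x ord0 i0.
    have [z zE] := lpoint_coord h t i0; move: x0; rewrite /x zE pmulr_rgt0 // ltr0z => z0.
    by rewrite ler_peMr ?(ltW h0) // ler1z.
  clearbody x; have ge y : 0 <= y ord0 i0 -> (if y ord0 i0 <= 0 then f y else f (sigma y)) = f (sigma y).
    by move=> y0; case: leP => // y1; rewrite flip_id //; apply/eqP; rewrite eq_le y1.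
  apply: eq_bigr => i _; have hi (s : bool) : 0 <= (x + (if s then h else - h) *: e_ i) ord0 i0.
    by case: s; rewrite !mxE; case: (_ && _); rewrite ?mulr1 ?mulr0; lra.
  by rewrite !ge //; [exact: ltW|rewrite -scaleNr; exact: (hi false)|exact: (hi true)].
have -> : lsum h N (fun x => fold_weight f x * - dlap h f x) =
    - lsum h N (fun x => fold f x * dlap h (fold f) x).
  have -> : lsum h N (fun x => fold f x * dlap h (fold f) x) =
     lsum h N (fun x => f x * dlap h (fold f) x) - lsum h N (fun x => (f x - fold f x) * dlap h (fold f) x).
    by rewrite -lsumB; apply: eq_lsum => t; ring.
  rewrite E1 E2 -lsumB -mulN1r -lsumZ; apply: eq_lsum => t.
  rewrite /fold_weight /m /fold; case: (ltP _ 0) => [/ltW ->|_]; ring.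
by rewrite oppr_ge0 (lsum_energy_ge0 h0 h1 se A0 AN).
Qed.

Lemma reflection_positivity (lam : R) (B : set V) (I : finType) (c : I -> R) (p : I -> V)
    (g : I -> V -> R) : 0 < lam -> open B -> connected B ->
  (forall x, B x -> B (sigma x)) -> (forall i, B (p i)) -> (forall i, 0 < p i ord0 i0) ->
  (forall i, green_like B (p i) lam (g i)) ->
  0 <= \sum_i \sum_j c i * c j * g j (sigma (p i)).
Proof.
move=> lam0 oB coB Bs Bp p0 Gg.
have [C C0 HC] := green_truncation n lam0.
have [c0 [C1 [c00 _ source_bd]]] := source_lsum_bounds R n.
pose a i := \sum_j c j * g j (sigma (p i)).
have -> : \sum_i \sum_j c i * c j * g j (sigma (p i)) = \sum_i c i * a i.
  by apply: eq_bigr => i _; rewrite mulr_sumr; apply: eq_bigr => j _; rewrite mulrA.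
pose S := 1 + \sum_i `|c i|.
have S0 : 0 < S by rewrite ltr_pwDl // sumr_ge0.
have bound (u : I -> R) (b : R) : (forall i, `|u i| <= b) -> 0 <= b -> `|\sum_i c i * u i| <= S * b.
  move=> ub b0; apply: le_trans (ler_norm_sum _ _ _) _.
  apply: (@le_trans _ _ (\sum_i `|c i| * b)).
    by apply: ler_sum => i _; rewrite normrM ler_wpM2l.
  by rewrite -mulr_suml ler_wpM2r // lerDr.
pose D := \sum_i `|c i| * (C * (6 * S + `|a i|)).
have D0 : 0 <= D.
  by apply: sumr_ge0 => i _; rewrite !mulr_ge0 // ?addr_ge0 ?mulr_ge0 // ltW.
(* Only a lower bound for the common charge is at hand, which is of use when the sum is negative;
   the minimum with 0 keeps just this case. *)
suff main (eta : R) : 0 < eta -> eta <= 1 -> - (eta * D) <= Num.min 0 (\sum_i c i * a i) * (lam * c0).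
  set Q := \sum_i c i * a i in main *; rewrite leNgt; apply/negP => Q0.
  have T0 : 0 < - Q * (lam * c0) by rewrite mulr_gt0 ?oppr_gt0 // mulr_gt0.
  have D1 : 0 < 2 * (D + 1) by lra.
  pose eta := Num.min 1 (- Q * (lam * c0) / (2 * (D + 1))).
  have e1 : eta <= 1 by rewrite ge_min lexx.
  have e2 : eta * (2 * (D + 1)) <= - Q * (lam * c0) by rewrite -ler_pdivlMr // ge_min lexx orbT.
  have e0 : 0 < eta by rewrite lt_min ltr01 divr_gt0.
  have := main eta e0 e1; rewrite (min_r (ltW Q0)).
  have eD : 0 <= eta * D by rewrite mulr_ge0 // ltW.
  clear - e0 e2 T0 eD; lra.
move=> eta0 eta1.
have [r1 r10 Hr1] := @finite_small I _ (fun i => HC B (p i) (g i) oB coB (Bp i) (Gg i) eta eta0 eta1).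
(* The first condition keeps the r-ball around each pole on the positive side of the mirror, the
   second puts it inside the superlevel set, and the third makes the reflected Green functions
   nearly constant on it. One r serves all poles, so that they share the same source. *)
pose near i r := [/\ 2 * r < p i ord0 i0,
  forall x, x != p i -> `|x - p i| <= r -> eta < `|g i x| &
  forall x j, enorm (x - p i) <= r -> `|g j (sigma x) - g j (sigma (p i))| <= eta].
have [r2 r20 Hr2] : exists2 r2 : R, 0 < r2 & forall r, 0 < r -> r < r2 -> forall i, near i r.
  apply: finite_small => i.
  have [s s0 Hs] := green_like_near_pole lam0 (Gg i) 1.
  have [t t0 Ht] : exists2 t : R, 0 < t & forall r, 0 < r -> r < t -> forall j x,
      enorm (x - p i) <= r -> `|g j (sigma x) - g j (sigma (p i))| <= eta.
    apply: finite_small => j; have [cg _ _ _ _] := Gg j.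
    have ne : sigma (p i) != p j.
      apply/eqP => /(congr1 (fun y : V => y ord0 i0)); rewrite flip_coord => E.
      by have := p0 i; have := p0 j; rewrite -E; lra.
    have /continuous_forP/(_ eta eta0)[t t0 Ht] := cg _ ne.
    exists t => // r _ rt x xr; apply/ltW/Ht; rewrite flipB norm_flip.
    exact: le_lt_trans (norm_le_enorm _) (le_lt_trans xr rt).
  exists (Num.min (p i ord0 i0 / 2) (Num.min s t)); first by rewrite !lt_min divr_gt0 // s0.
  move=> r r0; rewrite !lt_min => /andP[rp /andP[rs rt]]; split.
  - by move: rp; rewrite ltr_pdivlMr // mulrC.
  - move=> x xp xr; apply: le_lt_trans eta1 _; apply: lt_le_trans (ler_norm _).
    by apply: Hs => //; exact: le_lt_trans rs.
  - by move=> x j; exact: Ht.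
pose r := Num.min r1 r2 / 2.
have m0 : 0 < Num.min r1 r2 by rewrite lt_min r10.
have r0 : 0 < r by rewrite divr_gt0.
have rr1 : r < r1 by apply: (@lt_le_trans _ _ (Num.min r1 r2)); rewrite ?ge_min ?lexx // /r; lra.
have rr2 : r < r2 by apply: (@lt_le_trans _ _ (Num.min r1 r2)); rewrite ?ge_min ?lexx ?orbT // /r; lra.
have Hnear := Hr2 r r0 rr2.
pose K0 := [set x : V | exists i, superlevel (p i) (g i) eta x].
have cK0 : compact K0 by apply: compact_fin_union => i; exact: superlevel_compact (Gg i) eta0.
have K0B : K0 `<=` B by move=> x [i]; exact: superlevel_sub (Gg i) (Bp i) eta0 x.
pose K := K0 `|` [set x | K0 (sigma x)].
have cK : compact K by apply: compactU => //; exact: compact_flip.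
have KB : K `<=` B by move=> x [/K0B//|/K0B /Bs]; rewrite flipK.
have outK x i : ~ K0 x -> [/\ x != p i, r < enorm (x - p i) & `|g i x| <= eta].
  move=> nK; have xp : x != p i by apply/eqP => xp; apply: nK; exists i; left.
  have gx : `|g i x| < eta by rewrite ltNge; apply/negP => gx; apply: nK; exists i; right.
  split => //; last exact: ltW.
  rewrite ltNge; apply/negP => xr; have [_ + _] := Hnear i => /(_ x xp).
  by rewrite ltNge (ltW gx) => /(_ (le_trans (norm_le_enorm _) xr)).
have [GA HGA] := choice (fun i => Hr1 r r0 rr1 i K cK KB).
have [A HA] := choice HGA; have [E HE] := choice HA => {HGA HA}.
pose f x := \sum_i c i * GA i x.
have A0 i : 0 <= A i by have [] := HE i.
have E0 i : 0 <= E i by have [_ _ /(_ 0) h _ _] := HE i; exact: le_trans h.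
have GE i x : r < enorm (x - p i) -> `|GA i x - g i x| <= eta by have [_ _ _ + _] := HE i; apply.
pose At := \sum_i A i; pose Et := \sum_i E i.
have AAt i : A i <= At by rewrite /At (bigD1 i) //= lerDl sumr_ge0.
have EEt i : E i <= Et by rewrite /Et (bigD1 i) //= lerDl sumr_ge0.
have At0 : 0 <= At by rewrite sumr_ge0.
have Et0 : 0 <= Et by rewrite sumr_ge0.
have sf : supported At f.
  move=> x xA; rewrite /f big1 // => i _; have [_ sG _ _ _] := HE i.
  by rewrite sG ?mulr0 //; exact: le_lt_trans xA.
have fE x : `|f x| <= S * Et.
  by apply: bound => // i; have [_ _ h _ _] := HE i; exact: le_trans (h x) (EEt i).
have f_out x : ~ K0 x -> `|f x| <= S * (2 * eta).
  move=> nK; apply: bound => [i|]; last by rewrite mulr_ge0 // ltW.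
  have [xp xr gx] := outK x i nK; have := GE i x xr.
  by have := ler_normD (GA i x - g i x) (g i x); rewrite subrK; lra.
pose w := fold_weight f.
(* The factor 3 comes from the branch [2 * f x - f (sigma x)] of the weight; with the bound
   [2 * eta * S] for f off [K0] it yields [6 * S * eta]. *)
have w_le x (b : R) : `|f x| <= b -> `|f (sigma x)| <= b -> `|w x| <= 3 * b.
  move=> b1 b2; rewrite /w /fold_weight /fold; have b0 := le_trans (normr_ge0 _) b1.
  case: ifP => _; last by case: ifP => _; clear - b1 b2 b0; lra.
  have := ler_normB (2 * f x) (f (sigma x)); rewrite normrM ger0_norm //; clear - b1 b2; lra.
have wE x : `|w x| <= 3 * (S * Et) by exact: w_le.
have w_out x : ~ K x -> `|w x| <= 6 * S * eta.
  move=> nK; apply: le_trans (w_le x (S * (2 * eta)) _ _) _; try apply: f_out.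
  - by move=> Kx; apply: nK; left.
  - by move=> Kx; apply: nK; right.
  - by have -> : 3 * (S * (2 * eta)) = 6 * S * eta by ring.
have w_in i x : enorm (x - p i) <= r -> `|w x - a i| <= 6 * S * eta.
  move=> xr; have [rp _ near_i] := Hnear i.
  have xi : `|x ord0 i0 - p i ord0 i0| <= r.
    by apply: le_trans xr; apply: le_trans (norm_le_enorm _); have := rv_coord_le (x - p i) i0; rewrite !mxE.
  have x0 : r < x ord0 i0 by move: xi; rewrite ler_norml; clear - rp; lra.
  have -> : w x = f (sigma x).
    rewrite /w /fold_weight /fold; case: ltP => [|_]; first by clear - x0 r0; lra.
    by case: leP => //; clear - x0 r0; lra.
  rewrite /f /a -sumrB.
  have -> : \sum_j (c j * GA j (sigma x) - c j * g j (sigma (p i))) =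
      \sum_j c j * (GA j (sigma x) - g j (sigma (p i))) by apply: eq_bigr => j _; ring.
  apply: (@le_trans _ _ (S * (2 * eta))).
    apply: bound => [j|]; last by rewrite mulr_ge0 // ltW.
    (* The reflected point lies more than r below the mirror while all poles lie above it, so the
       truncations there are close to the Green functions. *)
    have rj : r < enorm (sigma x - p j).
      apply: lt_le_trans (norm_le_enorm _); apply: lt_le_trans (rv_coord_le _ i0).
      rewrite -normrN; apply: lt_le_trans (ler_norm _); rewrite !mxE eqxx -/(x ord0 i0).
      by have := p0 j; clear - x0; lra.
    have := ler_normD (GA j (sigma x) - g j (sigma x)) (g j (sigma x) - g j (sigma (p i))).
    have := GE j _ rj; have := near_i x j xr.
    by rewrite addrA subrK; clear; lra.
  have := mulr_gt0 S0 eta0; clear; lra.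
have eS0 : 0 < 6 * S * eta by rewrite !mulr_gt0.
have [h0 h00 Hh] : exists2 h0 : R, 0 < h0 & forall h, 0 < h -> h < h0 -> forall i N,
    A i + `|p i| + 4 < h * N%:R ->
    `|lsum h N (fun x => w x * - dlap h (GA i) x) -
      a i * (lam * lsum h N (source (r / 2) (0 : V)))| <= C * (6 * S * eta + `|a i| * eta).
  apply: finite_small => i; have [_ _ _ _ +] := HE i.
  move=> /(_ w _ (a i) _ eS0 wE (w_in i) (fun x _ => w_out x))[h0 h00 H]; exists h0 => // h ? ? N.
  exact: H.
pose h := Num.min h0 (Num.min 1 (r / 2 / (2 * d%:R))) / 2.
have m1 : 0 < Num.min h0 (Num.min 1 (r / 2 / (2 * d%:R))).
  by rewrite !lt_min h00 ltr01 !divr_gt0 // mulr_gt0 // ltr0n.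
have hpos : 0 < h by rewrite divr_gt0.
have : h < Num.min h0 (Num.min 1 (r / 2 / (2 * d%:R))) by rewrite /h; clear - m1; lra.
rewrite !lt_min => /andP[hh0 /andP[hh1 hhr]].
pose T := At + \sum_i `|p i| + 4 + r.
have P0 : 0 <= \sum_i `|p i| by apply: sumr_ge0.
have T0 : 0 < T by rewrite /T; clear - P0 At0 r0; lra.
pose N := Num.bound (T / h).
have TN : T < h * N%:R.
  by rewrite mulrC -ltr_pdivrMr //; apply: archi_boundP; rewrite divr_ge0 // ltW.
have E1 : At + 2 < h * N%:R by apply: le_lt_trans TN; rewrite /T; clear - P0 r0; lra.
have E2 i : A i + `|p i| + 4 < h * N%:R.
  have : `|p i| <= \sum_i `|p i| by rewrite (bigD1 i) //= lerDl sumr_ge0.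
  move=> Pi; apply: le_lt_trans TN; rewrite /T; have := AAt i; clear - Pi r0; lra.
have E3 : r / 2 < h * N%:R by apply: le_lt_trans TN; rewrite /T; clear - P0 At0 r0; lra.
have := fold_energy hpos (ltW hh1) sf At0 E1; rewrite -/w.
have -> : lsum h N (fun x => w x * - dlap h f x) =
    \sum_i c i * lsum h N (fun x => w x * - dlap h (GA i) x).
  have -> : \sum_i c i * lsum h N (fun x => w x * - dlap h (GA i) x) =
      \sum_i lsum h N (fun x => c i * (w x * - dlap h (GA i) x)).
    by apply: eq_bigr => i _; rewrite lsumZ.
  rewrite -lsum_sum; apply: eq_lsum => t; rewrite /f dlap_sum -sumrN mulr_sumr.
  by apply: eq_bigr => i _; ring.
set X := fun i => lsum h N (fun x => w x * - dlap h (GA i) x).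
have /andP[src _] := source_bd (r / 2) (divr_gt0 r0 (ltr0n R 2)) h N hpos (ltW hhr) E3.
set s0 := lam * lsum h N (source (r / 2) (0 : V)).
have s0c : lam * c0 <= s0 by rewrite ler_pM2l.
have err : `|\sum_i c i * X i - (\sum_i c i * a i) * s0| <= eta * D.
  rewrite mulr_suml -sumrB; apply: le_trans (ler_norm_sum _ _ _) _.
  rewrite mulr_sumr; apply: ler_sum => i _.
  have -> : c i * X i - c i * a i * s0 = c i * (X i - a i * s0) by ring.
  rewrite normrM; have := Hh h hpos hh0 i N (E2 i) => /(ler_wpM2l (normr_ge0 (c i))).
  by have -> : eta * (`|c i| * (C * (6 * S + `|a i|))) = `|c i| * (C * (6 * S * eta + `|a i| * eta)) by ring.
move: err; rewrite ler_norml => /andP[_ e1] X0.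
set Q := \sum_i c i * a i in e1 *.
have [Q0|Q0] := leP 0 Q.
  by rewrite mul0r oppr_le0 mulr_ge0 // ltW.
have {}X0 : 0 <= \sum_i c i * X i := X0.
have : Q * s0 <= Q * (lam * c0) by rewrite ler_nM2l.
clear - e1 X0; lra.
Qed.

End ReflectionPositivity.

(** * Rotation invariance *)

Section Rotations.
Variables (R : realType) (n : nat).
Local Notation k := n.+1.
Local Notation d := k.+2.
Local Notation V := 'rV[R]_d.
Implicit Types (x y p : V) (B : set V) (r t : R).

Local Notation i1 := (lift ord0 ord0 : 'I_d).

(** The reflection of the first two coordinates that sends the angle t to c - t. It is a symmetric
    involution, and two of them compose to a rotation. *)
Definition refl_mx (c : R) : 'M[R]_d :=
  \matrix_(i, j) if (i < 2)%N && (j < 2)%N then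
      (if i + j == 0 then cos c else if i + j == 1 then sin c else - cos c)%N
    else (i == j)%:R.

Lemma refl_mx_sym c : (refl_mx c)^T = refl_mx c.
Proof. by apply/matrixP => i j; rewrite !mxE andbC addnC [j == i]eq_sym. Qed.

Lemma mul_refl_mx c x (j : 'I_d) : (x *m refl_mx c) ord0 j =
  if j == 0%N :> nat then x ord0 ord0 * cos c + x ord0 i1 * sin c
  else if j == 1%N :> nat then x ord0 ord0 * sin c - x ord0 i1 * cos c
  else x ord0 j.
Proof.
rewrite mxE big_ord_recl big_ord_recl !mxE /=.
have tail0 : (j < 2)%N -> \sum_(i < n.+1) x ord0 (lift ord0 (lift ord0 i)) * refl_mx c (lift ord0 (lift ord0 i)) j = 0.
  move=> j2; rewrite big1 // => i _; rewrite !mxE /= [_ == j](_ : _ = false) ?mulr0 //.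
  by apply/negbTE; rewrite -val_eqE /= /bump /=; move: j2; case: (nat_of_ord j) => [|[]].
case: j tail0 => [[|[|j]] hj] /= tail0.
- by rewrite tail0 // addr0 /=.
- by rewrite tail0 // addr0 /= mulrN.
- rewrite !mulr0 !add0r; have hj' : (j < n.+1)%N by [].
  rewrite (bigD1 (Ordinal hj')) //= big1 => [|i ij].
    rewrite mxE /= -val_eqE /= eqxx mulr1 addr0; congr (x _ _); exact/val_inj.
  rewrite mxE /= -val_eqE /= /bump /= !eqSS.
  by rewrite -val_eqE /= in ij; rewrite (negbTE ij) mulr0.
Qed.

Lemma refl_mxK c : refl_mx c *m refl_mx c = 1%:M.
Proof.
have K x : x *m refl_mx c *m refl_mx c = x.
  apply/rowP => j; rewrite !mul_refl_mx /=; have := cos2Dsin2 c => cs.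
  case: ifP => [/eqP j0|jn0].
    have -> : j = ord0 by exact/val_inj.
    rewrite -[RHS]mulr1 -cs; ring.
  case: ifP => [/eqP j1|//]; last by rewrite jn0 => ->.
  have -> : j = i1 by exact/val_inj.
  rewrite -[RHS]mulr1 -cs; ring.
by apply/row_matrixP => i; rewrite !rowE mulmxA K mulmx1.
Qed.

Lemma cyl_refl r t c (x' : V) : cyl r t x' *m refl_mx c = cyl r (c - t) x'.
Proof.
apply/rowP => j; rewrite mul_refl_mx !mxE /= cosB sinB.
by case: ifP => [_|->]; [ring|case: ifP => [_|-> //]; ring].
Qed.

Lemma polar (a b : R) : exists r t, [/\ 0 <= r, a = r * cos t & b = r * sin t].
Proof.
pose r := Num.sqrt (a ^+ 2 + b ^+ 2); have r0 : 0 <= r by exact: sqrtr_ge0.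
have rr : r ^+ 2 = a ^+ 2 + b ^+ 2 by rewrite sqr_sqrtr // addr_ge0 ?sqr_ge0.
have [rz|rn] := eqVneq r 0.
  exists 0, 0; rewrite !mul0r; move: rr; rewrite rz expr0n /= => /esym/eqP.
  by rewrite paddr_eq0 ?sqr_ge0 // !sqrf_eq0 => /andP[/eqP -> /eqP ->].
have uv : (a / r) ^+ 2 + (b / r) ^+ 2 = 1.
  by rewrite !exprMn -mulrDl -rr -exprMn divff // expr1n.
have u1 : -1 <= a / r <= 1.
  by rewrite -ler_norml -(@ler_pXn2r _ 2) ?nnegrE // expr1n -normrX ger0_norm ?sqr_ge0 // -uv lerDl sqr_ge0.
have su : sin (acos (a / r)) = `|b / r|.
  by rewrite sin_acos // -sqrtr_sqr; congr Num.sqrt; rewrite -uv; ring.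
have [b0|b0] := leP 0 (b / r).
  exists r, (acos (a / r)); split => //; first by rewrite acosK // mulrC divfK.
  by rewrite su ger0_norm // mulrC divfK.
exists r, (- acos (a / r)); split => //; first by rewrite cosN acosK // mulrC divfK.
by rewrite sinN su ltr0_norm // opprK mulrC divfK.
Qed.

Lemma cyl_coordinates x : exists r t x', [/\ 0 <= r, J x' & x = cyl r t x'].
Proof.
have [r [t [r0 x0 x1]]] := polar (x ord0 ord0) (x ord0 i1).
exists r, t, (\row_i if (i < 2)%N then 0 else x ord0 i); split => //.
  by move=> i i2; rewrite mxE i2.
apply/rowP => j; rewrite !mxE.
case: ifP => [/eqP j0|jn0]; first by rewrite -x0; congr (x _ _); exact/val_inj.
case: ifP => [/eqP j1|jn1]; first by rewrite -x1; congr (x _ _); exact/val_inj.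
by case: (nat_of_ord j) jn0 jn1 => [|[]].
Qed.

Lemma rotation_domain_refl B c x : rotation_domain B -> B x -> B (x *m refl_mx c).
Proof.
move=> [_ rot]; have [r [t [x' [r0 Jx ->]]]] := cyl_coordinates x.
by move=> /rot H; rewrite cyl_refl; exact: H.
Qed.

Lemma flip_refl x : flip i1 x = x *m refl_mx 0.
Proof.
apply/rowP => j; rewrite mul_refl_mx mxE cos0 sin0 !mulr0 !mulr1 addr0 sub0r -val_eqE /=.
case: ifP => [/eqP j1|j1].
  by have -> : j = i1 by exact/val_inj.
case: ifP => // /eqP j0; congr (x _ _); exact/val_inj.
Qed.

Lemma flip_cyl r t (x' : V) : flip i1 (cyl r t x') = cyl r (- t) x'.
Proof. by rewrite flip_refl cyl_refl sub0r. Qed.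

Lemma cyl_periodic r t (x' : V) : cyl r (t + 2 * pi) x' = cyl r t x'.
Proof. by rewrite /cyl [2 * pi]mulr_natl cosD2pi sinD2pi. Qed.

Lemma cyl_inj r r' t t' (x' y' : V) : 0 <= r -> 0 <= r' -> J x' -> J y' ->
  cyl r t x' = cyl r' t' y' -> r = r' /\ x' = y'.
Proof.
move=> r0 r'0 Jx Jy E.
have E0 := congr1 (fun x : V => x ord0 ord0) E.
have E1 := congr1 (fun x : V => x ord0 i1) E.
rewrite !mxE /= in E0 E1; split.
  apply/eqP; rewrite -(@eqrXn2 _ 2) //; apply/eqP.
  rewrite -[LHS]mulr1 -[RHS]mulr1 -{1}(cos2Dsin2 t) -(cos2Dsin2 t') !mulrDr -!exprMn.
  by rewrite E0 E1.
apply/rowP => i; have [i2|i2] := ltnP i 2; first by rewrite Jx // Jy.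
have := congr1 (fun x : V => x ord0 i) E; rewrite !mxE.
by case: (nat_of_ord i) i2 => [|[]].
Qed.

End Rotations.

Lemma exchange_pairs (R : nmodType) (I T : finType) (f : I -> T -> I -> T -> R) :
  \sum_(u : I * T) \sum_(v : I * T) f u.1 u.2 v.1 v.2 = \sum_i \sum_j \sum_a \sum_b f a i b j.
Proof.
rewrite -(pair_big_dep xpredT (fun _ => xpredT) (fun a i => \sum_(v : I * T) f a i v.1 v.2)) /=.
rewrite exchange_big /=; apply: eq_bigr => i _; rewrite [RHS]exchange_big /=.
apply: eq_bigr => a _.
by rewrite -(pair_big_dep xpredT (fun _ => xpredT) (fun b j => f a i b j)) /= exchange_big.
Qed.

Section GreenRotation.
Variables (R : realType) (n : nat).
Local Notation d := n.+3.
Local Notation V := 'rV[R]_d.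
Implicit Types (x y p : V) (B : set V) (r t : R).

Lemma Gamma_ge0 (s : R) : 0 <= Gamma s.
Proof.
by apply: Rintegral_ge0 => t _; rewrite mulr_ge0 ?powR_ge0 ?expR_ge0.
Qed.

Lemma lambda_ge0 : 0 <= lambda R d.
Proof.
rewrite /lambda invr_ge0; apply: mulr_ge0; first by rewrite subr_ge0 ler_nat.
by rewrite divr_ge0 ?Gamma_ge0 // mulr_ge0 // powR_ge0.
Qed.

(** By uniqueness, this identifies the Green function off its pole when the normalizing factor is
    0. *)
Lemma green_like0 B p : open B -> green_like B p 0 (fun=> 0 : R).
Proof.
move=> oB; split => //.
- by move=> x _; exact: cst_continuous.
- by move=> e e0; exists 0 => x _; rewrite normr0.
- exists (fun _ _ => 0), (fun _ _ _ => 0); split; last by move=> x _; rewrite big1.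
  by move=> x _ i; split => //= *; try exact: is_derive_cst; exact: cst_continuous.
- by exists 0 => e e0; exists 1 => // x _ _; rewrite mul0r subrr normr0.
Qed.

Variable B : set V.
Hypotheses (hadm : admissible B) (hrot : rotation_domain B).

Definition green0 p := extend0 B (green B p).

Let oB : open B. Proof. by have [[_ + _] _] := hadm. Qed.

Lemma green0_like p : B p -> green_like B p (lambda R d) (green0 p).
Proof.
move=> Bp; apply: is_green_green_like => //; have [_ /(_ p Bp)[g Hg]] := hadm.
exact: (xgetPex _ (ex_intro _ g Hg)).
Qed.

Lemma green0E p x : B x -> green0 p x = green B p x.
Proof. by move=> Bx; rewrite /green0 /extend0 asboolT. Qed.

Lemma green0_refl c p x : B p -> x != p ->
  green0 (p *m refl_mx n c) (x *m refl_mx n c) = green0 p x.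
Proof.
move=> Bp xp; have xK := isoK (refl_mxK n c).
have BM y : B y -> B (y *m refl_mx n c) by exact: rotation_domain_refl.
have H := green_like_iso (refl_mx_sym n c) (refl_mxK n c) oB BM (green0_like Bp).
have := green_like_unique oB (BM p Bp) H (green0_like (BM p Bp)).
move=> /(_ (x *m refl_mx n c)) <-; first by rewrite xK.
by apply: contraNN xp => /eqP E; rewrite -(xK x) E xK.
Qed.

(** The rotation by c is the reflection t to -t followed by the reflection t to c - t. *)
Lemma green0_turn r r' t t' c (x' y' : V) : B (cyl r t x') -> cyl r' t' y' != cyl r t x' ->
  green0 (cyl r (t + c) x') (cyl r' (t' + c) y') = green0 (cyl r t x') (cyl r' t' y').
Proof.
move=> Bp ne; rewrite -(green0_refl 0 Bp ne) !cyl_refl.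
have E s (s' : R) (z' : V) : cyl s (s' + c) z' = cyl s (0 - s') z' *m refl_mx n c.
  by rewrite cyl_refl sub0r opprK addrC.
rewrite !E green0_refl //; first by rewrite -cyl_refl; exact: rotation_domain_refl.
apply: contraNN ne => /eqP /(congr1 (fun z => z *m refl_mx n 0)).
by rewrite !cyl_refl !sub0r !opprK => /eqP.
Qed.

Lemma green0_reflection_positivity (I : finType) (c : I -> R) (p : I -> V) :
  (forall i, B (p i)) -> (forall i, 0 < p i ord0 (lift ord0 ord0)) ->
  0 <= \sum_i \sum_j c i * c j * green0 (p j) (flip (lift ord0 ord0) (p i)).
Proof.
move=> Bp p0; have [[_ _ coB] _] := hadm.
(* Only nonnegativity of [lambda] has been established. If it is 0, the Green functions vanish off
   their poles and so does the sum. *)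
have [l0|l0] := eqVneq (lambda R d) 0.
  rewrite big1 // => i _; rewrite big1 // => j _.
  have := green0_like (Bp j); rewrite l0 => Gj.
  rewrite (green_like_unique oB (Bp j) Gj (green_like0 (p j) oB)) ?mulr0 //.
  apply/eqP => /(congr1 (fun y : V => y ord0 (lift ord0 ord0))); rewrite flip_coord => E.
  by have := p0 i; have := p0 j; rewrite -E; lra.
apply: (@reflection_positivity R n (lift ord0 ord0) (lambda R d) B I c p (fun j => green0 (p j))) => //.
- by rewrite lt_neqAle eq_sym l0 lambda_ge0.
- by move=> x Bx; rewrite flip_refl; exact: rotation_domain_refl.
- by move=> i; exact: green0_like.
Qed.

Variables (I : finType) (D r : I -> R) (y : I -> V).
Hypotheses (r0 : forall a, 0 < r a) (Jy : forall a, J (y a)) (By : forall a t, B (cyl (r a) t (y a))).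

Definition pair_kernel t := \sum_a \sum_b D a * D b * green0 (cyl (r b) 0 (y b)) (cyl (r a) t (y a)).

Lemma pair_kernel_periodic t : pair_kernel (t + 2 * pi) = pair_kernel t.
Proof.
by apply: eq_bigr => a _; apply: eq_bigr => b _; rewrite cyl_periodic.
Qed.

Lemma cyl_apart a b t t' : cos t != cos t' \/ sin t != sin t' -> cyl (r a) t (y a) != cyl (r b) t' (y b).
Proof.
move=> H; apply/eqP => E; have [Er _] := cyl_inj (ltW (r0 a)) (ltW (r0 b)) (Jy a) (Jy b) E.
have E0 := congr1 (fun x : V => x ord0 ord0) E.
have E1 := congr1 (fun x : V => x ord0 (lift ord0 ord0)) E.
have rn : r b != 0 by rewrite gt_eqF.
by case: H; rewrite !mxE /= Er in E0 E1 *; [move: E0|move: E1] => /(mulfI rn) ->; rewrite eqxx.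
Qed.

(** Each circle carries its weight at angle s/2 and the opposite weight at t/2, angles at which x_2
    is positive. After reflection of one factor the interaction depends only on the sum of the two
    angles, so reflection positivity reads K(s) - 2 K((s + t)/2) + K(t) >= 0. *)
Lemma pair_kernel_midpoint s t : 0 < s < 2 * pi -> 0 < t < 2 * pi ->
  2 * pair_kernel ((s + t) / 2) <= pair_kernel s + pair_kernel t.
Proof.
move=> /andP[s0 s1] /andP[t0 t1].
pose al (u : bool) := if u then s / 2 else t / 2.
have al0 u : 0 < al u < pi by rewrite /al; case: u; apply/andP; split; lra.
pose c (u : bool) : R := if u then 1 else -1.
have sal u : 0 < sin (al u) by have /andP[? ?] := al0 u; exact: sin_gt0_pi.
have := @green0_reflection_positivity (I * bool)%type (fun i => D i.1 * c i.2)
  (fun i => cyl (r i.1) (al i.2) (y i.1)) (fun i => By _ _).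
have pos i : 0 < (cyl (r i.1) (al i.2) (y i.1) : V) ord0 (lift ord0 ord0).
  by rewrite mxE /= mulr_gt0.
move=> /(_ pos).
have -> : \sum_(i : I * bool) \sum_(j : I * bool) D i.1 * c i.2 * (D j.1 * c j.2) *
    green0 (cyl (r j.1) (al j.2) (y j.1)) (flip (lift ord0 ord0) (cyl (r i.1) (al i.2) (y i.1))) =
  \sum_u \sum_v c u * c v * pair_kernel (al u + al v).
  transitivity (\sum_(i : I * bool) \sum_(j : I * bool) D i.1 * c i.2 * (D j.1 * c j.2) *
    green0 (cyl (r j.1) 0 (y j.1)) (cyl (r i.1) (al i.2 + al j.2) (y i.1))).
    apply: eq_bigr => i _; apply: eq_bigr => j _; congr (_ * _).
    have ap a b u v : cyl (r a) (- al u) (y a) != cyl (r b) (al v) (y b).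
      apply: cyl_apart; right; rewrite sinN; apply/eqP => E.
      by have := sal u; have := sal v; rewrite -E; lra.
    (* The reflection t to [al j.2] - t moves the pole to angle 0 and the other point from
       [- al i.2] to the sum of the angles. *)
    rewrite flip_cyl -(green0_refl (al j.2)) // !cyl_refl.
    by rewrite subrr opprK addrC.
  rewrite (exchange_pairs (fun a u b v => D a * c u * (D b * c v) *
    green0 (cyl (r b) 0 (y b)) (cyl (r a) (al u + al v) (y a)))).
  apply: eq_bigr => u _; apply: eq_bigr => v _; rewrite mulr_sumr.
  by apply: eq_bigr => a _; rewrite mulr_sumr; apply: eq_bigr => b _; ring.
rewrite !big_bool /al /c /=.
have -> : s / 2 + s / 2 = s by field.
have -> : t / 2 + t / 2 = t by field.
have -> : s / 2 + t / 2 = (s + t) / 2 by field.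
have -> : t / 2 + s / 2 = (s + t) / 2 by field.
lra.
Qed.

End GreenRotation.

(** * Equal spacing *)

Section EqualSpacing.
Variables (R : realType) (K : R -> R) (T : R).
Hypothesis T0 : 0 < T.
Hypothesis K_periodic : forall t, K (t + T) = K t.
Hypothesis K_midpoint : forall s t : R, 0 < s < T -> 0 < t < T -> 2 * K ((s + t) / 2) <= K s + K t.

Let jensen (m : nat) := forall u : nat -> R, (forall i, 0 < u i < T) ->
  m%:R * K ((\sum_(i < m) u i) / m%:R) <= \sum_(i < m) K (u i).

Lemma mean_itv (m : nat) (u : nat -> R) : (forall i, 0 < u i < T) -> (0 < m)%N ->
  0 < (\sum_(i < m) u i) / m%:R < T.
Proof.
move=> uT m0; have mR : 0 < (m%:R : R) by rewrite ltr0n.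
rewrite ltr_pdivlMr // mul0r ltr_pdivrMr //; apply/andP; split.
  case: m m0 {mR} => // m _; rewrite big_ord_recl ltr_pwDl //; first by have /andP[] := uT 0%N.
  by apply: sumr_ge0 => i _; have /andP[/ltW] := uT (lift ord0 i).
have -> : T * m%:R = \sum_(i < m) T by rewrite sumr_const card_ord mulr_natr.
case: m m0 {mR} => // m _; rewrite !big_ord_recl ltr_leD //; first by have /andP[] := uT 0%N.
by apply: ler_sum => i _; have /andP[_ /ltW] := uT (lift ord0 i).
Qed.

Lemma jensen_double m : (0 < m)%N -> jensen m -> jensen (m + m).
Proof.
move=> m0 J u uT; have mR : 0 < (m%:R : R) by rewrite ltr0n.
have uT' i : 0 < u (m + i)%N < T by [].
rewrite !big_split_ord /=.
have H1 := J u uT; have H2 := J _ uT'.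
have := K_midpoint (mean_itv uT m0) (mean_itv uT' m0) => /(ler_wpM2l (ltW mR)).
have -> : ((\sum_(i < m) u i) / m%:R + (\sum_(i < m) u (m + i)%N) / m%:R) / 2 =
    (\sum_(i < m) u i + \sum_(i < m) u (m + i)%N) / (m + m)%:R.
  have -> : (m + m)%:R = 2 * m%:R :> R by rewrite natrD mulr_natl.
  by field; rewrite gt_eqF.
rewrite natrD; move: H1 H2; rewrite /=; lra.
Qed.

(** Appending the mean as one more value leaves the mean unchanged, and its own contribution
    cancels. *)
Lemma jensen_pred m : (0 < m)%N -> jensen m.+1 -> jensen m.
Proof.
move=> m0 J u uT; have mR : 0 < (m%:R : R) by rewrite ltr0n.
pose b := (\sum_(i < m) u i) / m%:R.
have bT : 0 < b < T by exact: mean_itv.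
have E (F : R -> R) : \sum_(i < m.+1) F (if (i < m)%N then u i else b) = \sum_(i < m) F (u i) + F b.
  by rewrite big_ord_recr /= ltnn; congr (_ + _); apply: eq_bigr => i _; rewrite ltn_ord.
have := J (fun i => if (i < m)%N then u i else b); rewrite (E id) (E K) /=.
have -> : (\sum_(i < m) u i + b) / m.+1%:R = b.
  have -> : \sum_(i < m) u i = b * m%:R by rewrite /b divfK // gt_eqF.
  by rewrite -addn1 natrD -{2}[b]mulr1 -mulrDr mulfK // gt_eqF //; lra.
rewrite -/b -[m.+1]addn1 natrD => H.
have {}H : (m%:R + 1%:R) * K b <= \sum_(i < m) K (u i) + K b by apply: H => i; case: ifP.
by move: H; rewrite mulrDl mul1r lerD2r.
Qed.

(** Cauchy's forward-backward induction: up through the powers of 2, then down one at a time. No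
    continuity of K is involved. *)
Lemma midpoint_jensen m : (0 < m)%N -> jensen m.
Proof.
move=> m0; have J2 j : jensen (2 ^ j).
  elim: j => [|j IH]; last by rewrite expnS mul2n -addnn; apply: jensen_double => //; rewrite expn_gt0.
  by move=> u _; rewrite expn0 !big_ord1 mul1r divr1.
have [j mj] : exists j, (m <= 2 ^ j)%N by exists m; exact/ltnW/ltn_expl.
have down i : (0 < m)%N -> jensen (m + i) -> jensen m.
  elim: i m {m0 mj} => [|i IH] m m0; first by rewrite addn0.
  by rewrite addnS -addSn => /IH J; apply: jensen_pred => //; exact: J.
by apply: (down (2 ^ j - m)%N) => //; rewrite subnKC.
Qed.

Variable m : nat.
Implicit Types (theta : 'I_m.+1 -> R) (i j s : 'I_m.+1).

Definition ring_energy theta := \sum_i \sum_(j | j != i) K (theta i - theta j).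

Lemma ring_energy_shift theta :
  ring_energy theta = \sum_(s | s != 0) \sum_i K (theta (i + s) - theta i).
Proof.
rewrite /ring_energy (exchange_big_dep xpredT) //= [RHS]exchange_big /=.
apply: eq_bigr => j _.
rewrite [LHS](reindex_inj (addrI j)) /=; apply: eq_bigl => s.
by rewrite eq_sym -subr_eq0 addrAC subrr add0r.
Qed.

Lemma ord_add_val i s :
  (i + s)%R%:R = i%:R + s%:R - m.+1%:R * (if ((i + s)%R < i)%N then 1 else 0) :> R.
Proof.
have E : nat_of_ord (i + s)%R = ((i + s) %% m.+1)%N by [].
rewrite E; have [h|h] := ltnP (i + s) m.+1.
  by rewrite modn_small // ltnNge leq_addr /= mulr0 subr0 natrD.
have -> : ((i + s) %% m.+1 = i + s - m.+1)%N.
  by rewrite -{1}(subnK h) modnDr modn_small // ltn_subLR // -addnS leq_add // ltnW.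
have -> : (i + s - m.+1 < i)%N by rewrite ltn_subLR // addnC ltn_add2r.
by rewrite natrB // natrD mulr1.
Qed.

(** The counterclockwise arc from point i to point i + s; T is added when the cyclic index wraps
    around. *)
Definition gap theta s i := theta (i + s) - theta i + (if ((i + s)%R < i)%N then T else 0).

Lemma K_gap theta s i : K (gap theta s i) = K (theta (i + s) - theta i).
Proof. by rewrite /gap; case: ifP; rewrite ?K_periodic // addr0. Qed.

(** The differences of any function of the index sum to 0 around the cycle. Applied to the index
    itself, this shows that exactly s of the arcs wrap around. *)
Lemma gap_sum theta s : \sum_i gap theta s i = T * s%:R.
Proof.
have E (f : 'I_m.+1 -> R) : \sum_i (f (i + s) - f i) = 0.
  by rewrite sumrB [X in _ - X](reindex_inj (addIr s)) /= subrr.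
have nat_gap i : ((i + s)%R%:R : R) - i%:R = s%:R - m.+1%:R * (if ((i + s)%R < i)%N then 1 else 0).
  by rewrite ord_add_val; ring.
have := E (fun i => i%:R); under eq_bigr do rewrite nat_gap.
rewrite sumrB sumr_const card_ord -mulr_sumr => /eqP; rewrite subr_eq0 -[s%:R *+ _]mulr_natl => /eqP.
have mn : m.+1%:R != 0 :> R by rewrite pnatr_eq0.
move=> /(mulfI mn) ->.
rewrite /gap big_split /= E add0r mulr_sumr; apply: eq_bigr => i _.
by case: ifP; rewrite ?mulr1 ?mulr0.
Qed.

Lemma equal_spacing theta :
  (forall i, 0 <= theta i /\ theta i < T) -> (forall i j, (i < j)%N -> theta i < theta j) ->
  ring_energy (fun i => T * i%:R / m.+1%:R) <= ring_energy theta.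
Proof.
move=> theta_range theta_incr; rewrite !ring_energy_shift; apply: ler_sum => s s0.
have mR : 0 < (m.+1%:R : R) by rewrite ltr0n.
have ge i : 0 < gap theta s i < T.
  have ne : nat_of_ord (i + s) != i by rewrite val_eqE -subr_eq0 addrAC subrr add0r.
  have := theta_range i; have := theta_range (i + s); rewrite /gap.
  by case: ltngtP ne => // [/theta_incr|/theta_incr] ? _ [? ?] [? ?]; apply/andP; split; lra.
have -> : \sum_i K (T * (i + s)%R%:R / m.+1%:R - T * i%:R / m.+1%:R) = m.+1%:R * K (T * s%:R / m.+1%:R).
  rewrite (eq_bigr (fun=> K (T * s%:R / m.+1%:R))) => [|i _].
    by rewrite sumr_const card_ord mulr_natl.
  rewrite -(K_gap (fun i => T * i%:R / m.+1%:R)); congr K.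
  by rewrite /gap ord_add_val; case: ifP => _; field; rewrite gt_eqF.
have := @midpoint_jensen m.+1 isT (fun l : nat => gap theta s (inord l)) (fun l => ge _).
under eq_bigr do rewrite inord_val.
under [X in _ <= X -> _]eq_bigr do rewrite inord_val K_gap.
by rewrite gap_sum.
Qed.

End EqualSpacing.

(** The hypotheses give cos(s - t) = 1, which equals 1 - 2 sin^2((s - t)/2); the half difference
    lies in ]0, pi[ unless s = t. *)
Lemma angle_inj (R : realType) (s t : R) : 0 <= s < 2 * pi -> 0 <= t < 2 * pi ->
  cos s = cos t -> sin s = sin t -> s = t.
Proof.
wlog st : s t / t <= s.
  by move=> H hs ht hc hsi; have [/H|/ltW/H ts] := leP t s; [apply|apply/esym/ts].
move=> /andP[s0 s1] /andP[t0 t1] ec es; apply/eqP; rewrite eq_le st andbT leNgt; apply/negP => ts.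
have su : 0 < sin ((s - t) / 2) by apply: sin_gt0_pi; apply/andP; split; lra.
have : cos ((s - t) / 2 + (s - t) / 2) = 1.
  by rewrite -splitr cosB ec es -!expr2 cos2Dsin2.
have := cos2Dsin2 ((s - t) / 2); rewrite cosD -!expr2 => e1 e2.
have : 0 < sin ((s - t) / 2) ^+ 2 by rewrite exprn_gt0.
lra.
Qed.

(** * Energies of configurations on circles *)

Section CircleEnergy.
Variables (R : realType) (n : nat).
Local Notation d := n.+3.
Local Notation V := 'rV[R]_d.
Variable B : set V.
Hypotheses (hadm : admissible B) (hrot : rotation_domain B).
Variables (I : finType) (D r : I -> R) (y : I -> V).
Hypotheses (r0 : forall a, 0 < r a) (Jy : forall a, J (y a)) (By : forall a t, B (cyl (r a) t (y a))).
Hypothesis circle_inj : forall a b, r a = r b -> y a = y b -> a = b.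

Variables (m : nat) (theta : 'I_m.+1 -> R).
Hypotheses (theta_range : forall i, 0 <= theta i /\ theta i < 2 * pi)
  (theta_incr : forall i j : 'I_m.+1, (i < j)%N -> theta i < theta j).

Definition ring_point (u : I * 'I_m.+1) := cyl (r u.1) (theta u.2) (y u.1).

Lemma ring_point_inj : injective ring_point.
Proof.
move=> [a i] [b j] E; have [Er Ey] := cyl_inj (ltW (r0 a)) (ltW (r0 b)) (Jy a) (Jy b) E.
have Eab := circle_inj Er Ey; subst b; congr pair.
have rn : r a != 0 by rewrite gt_eqF.
have E0 := congr1 (fun x : V => x ord0 ord0) E.
have E1 := congr1 (fun x : V => x ord0 (lift ord0 ord0)) E.
rewrite !mxE /= in E0 E1.
have Et : theta i = theta j.
  by apply: angle_inj; [exact/andP|exact/andP|exact: (mulfI rn)|exact: (mulfI rn)].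
apply/val_inj/eqP; case: ltngtP => // /theta_incr; by rewrite Et ltxx.
Qed.

(** Pairs in different half-planes, including those on one circle, make up [ring_energy]. In each
    half-plane the remaining pairs can be turned to angle 0, so they contribute the same amount m +
    1 times. *)
Lemma circle_energy : \sum_u \sum_(v | v != u) D u.1 * D v.1 * green B (ring_point v) (ring_point u) =
  ring_energy (pair_kernel B D r y) theta +
  m.+1%:R * \sum_a \sum_(b | b != a) D a * D b * green0 B (cyl (r b) 0 (y b)) (cyl (r a) 0 (y a)).
Proof.
set C := (X in _ + m.+1%:R * X).
transitivity (\sum_(u : I * 'I_m.+1) \sum_(v : I * 'I_m.+1)
  if (v.1, v.2) != (u.1, u.2) then
    D u.1 * D v.1 * green0 B (cyl (r v.1) 0 (y v.1)) (cyl (r u.1) (theta u.2 - theta v.2) (y u.1)) else 0).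
  apply: eq_bigr => u _; rewrite big_mkcond; apply: eq_bigr => v _.
  rewrite -!surjective_pairing; case: ifP => // vu; congr (_ * _).
  rewrite -green0E //; last exact: By.
  rewrite -[X in green0 B (cyl _ X _)](subrr (theta v.2)) (green0_turn hadm hrot) //.
  by apply/eqP => /(@ring_point_inj u v) E; rewrite E eqxx in vu.
rewrite (exchange_pairs (fun a i b j => if (b, j) != (a, i) then
    D a * D b * green0 B (cyl (r b) 0 (y b)) (cyl (r a) (theta i - theta j) (y a)) else 0)).
have -> : m.+1%:R * C = \sum_(i < m.+1) C by rewrite sumr_const card_ord mulr_natl.
rewrite -big_split /=; apply: eq_bigr => i _; rewrite (bigD1 i) //= addrC; congr (_ + _).
  apply: eq_bigr => j ji; apply: eq_bigr => a _; apply: eq_bigr => b _.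
  by rewrite xpair_eqE (negbTE ji) andbF.
rewrite /C subrr; apply: eq_bigr => a _; rewrite [RHS]big_mkcond; apply: eq_bigr => b _.
by rewrite xpair_eqE eqxx andbT.
Qed.

Lemma green_energy_circles (k : nat) (x : 'I_k -> V) (delta : 'I_k -> R) (f : 'I_k -> I * 'I_m.+1) :
  bijective f -> (forall l, x l = ring_point (f l)) -> (forall l, delta l = D (f l).1) ->
  green_energy x delta B = ring_energy (pair_kernel B D r y) theta +
  m.+1%:R * \sum_a \sum_(b | b != a) D a * D b * green0 B (cyl (r b) 0 (y b)) (cyl (r a) 0 (y a)).
Proof.
move=> bf xE dE; rewrite -circle_energy (reindex f) /=; last exact: onW_bij.
apply: eq_bigr => l _; rewrite (reindex f) /=; last exact: onW_bij.
apply: eq_big => [j|j _]; first by rewrite (inj_eq (bij_inj bf)).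
by rewrite !xE !dE.
Qed.

Lemma ring_point_bij (k : nat) (P : set V) (x : 'I_k -> V) :
  set_bij [set: 'I_k] P x -> (forall p, P p <-> exists u, p = ring_point u) ->
  exists2 f : 'I_k -> I * 'I_m.+1, bijective f & forall l, x l = ring_point (f l).
Proof.
move=> [xP xinj xsurj] PE.
have /choice[f fE] : forall l, exists u, x l = ring_point u by move=> l; apply/PE/xP.
have /choice[g gE] : forall u, exists l, x l = ring_point u.
  by move=> u; have [l _ lE] := xsurj _ ((PE _).2 (ex_intro _ u erefl)); exists l.
exists f => //; exists g => u.
  by apply: xinj; rewrite ?in_setT // gE fE.
by apply: ring_point_inj; rewrite -fE gE.
Qed.

End CircleEnergy.

Lemma circle_cyl (R : realType) (n : nat) (r t : R) (y : 'rV[R]_n.+3) : 0 <= t < 2 * pi ->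
  circle r y (cyl r t y).
Proof. by move=> /andP[t0 t1]; exists t => //=; rewrite in_itv /= t0 ltW. Qed.

Lemma energy_bound (R : realType) (n : nat)
  (B : set 'rV[R]_n.+3) (hadm : admissible B) (hrot : rotation_domain B)
  (Omega : set (set 'rV[R]_n.+3)) (Omega_fin : finite_set Omega)
  (Omega_circle : forall S, Omega S -> is_circle S)
  (Omega_B : forall S, Omega S -> S `<=` B)
  (m : nat) (theta : 'I_m.+1 -> R)
  (theta_range : forall j, 0 <= theta j /\ theta j < 2 * pi)
  (theta_incr : forall i j : 'I_m.+1, (i < j)%N -> theta i < theta j)
  (k : nat) (x xs : 'I_k -> 'rV[R]_n.+3)
  (hx : set_bij [set: 'I_k] (intersection_points Omega theta) x)
  (hxs : set_bij [set: 'I_k]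
    (intersection_points Omega (fun j : 'I_m.+1 => 2 * pi * j%:R / m.+1%:R)) xs)
  (delta : 'I_k -> R)
  (hdelta : forall (i j : 'I_k) (S : set 'rV[R]_n.+3),
    Omega S -> S (x i) -> S (x j) -> delta i = delta j)
  (hnum : forall i : 'I_k,
    exists S : set 'rV[R]_n.+3, [/\ Omega S, S (x i) & S (xs i)]) :
  green_energy x delta B >= green_energy xs delta B.
Proof.
have pi0 := pi_gt0 R.
have /finite_seqP[ss sE] := Omega_fin.
(* Removing duplicates from the enumeration makes the indexing of circles injective, and distinct
   indices then have distinct radii or centres. *)
pose I := 'I_(size (undup ss)).
pose S (a : I) := nth set0 (undup ss) a.
have SO a : Omega (S a) by rewrite sE /= -mem_undup mem_nth.
have Ssurj S0 : Omega S0 -> exists a, S0 = S a.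
  rewrite sE /= -mem_undup => S0s; have h : (index S0 (undup ss) < size (undup ss))%N by rewrite index_mem.
  by exists (Ordinal h); rewrite /S nth_index.
have Sinj : injective S.
  by move=> a b /eqP; rewrite nth_uniq ?undup_uniq // => /eqP /val_inj.
have /choice[r /choice[y ry]] : forall a, exists r, exists y, [/\ 0 < r, J y & S a = circle r y].
  by move=> a; have [r [y H]] := Omega_circle _ (SO a); exists r, y.
have r0 a : 0 < r a by have [] := ry a.
have Jy a : J (y a) by have [] := ry a.
have SE a : S a = circle (r a) (y a) by have [] := ry a.
have circle_inj a b : r a = r b -> y a = y b -> a = b.
  by move=> er ey; apply: Sinj; rewrite !SE er ey.
have By a t : B (cyl (r a) t (y a)).
  have [_ rot] := hrot; apply: (rot _ 0); [exact: ltW|exact: Jy|].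
  apply: (Omega_B _ (SO a)); rewrite SE; apply: circle_cyl; lra.
have points (th : 'I_m.+1 -> R) : (forall j, 0 <= th j /\ th j < 2 * pi) -> forall p,
    intersection_points Omega th p <-> exists u, p = ring_point r y th u.
  move=> thr p; split.
    move=> [S0 [j [/Ssurj[a ->] + [r' [y' [r'0 Jy' pE]]]]]]; rewrite SE => -[t _ tE].
    have := tE; rewrite pE => /(cyl_inj (ltW (r0 a)) r'0 (Jy a) Jy')[<- <-].
    by exists (a, j).
  move=> [[a j] ->]; exists (S a), j; split; first exact: SO.
    by rewrite SE; apply: circle_cyl; exact/andP.
  by exists (r a), (y a); split => //; exact: ltW.
have onS a t b : S b (cyl (r a) t (y a)) -> a = b.
  rewrite SE => -[t' _ /esym/(cyl_inj (ltW (r0 _)) (ltW (r0 _)) (Jy _) (Jy _))[er ey]].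
  exact: circle_inj.
pose ths (j : 'I_m.+1) : R := 2 * pi * j%:R / m.+1%:R.
have mR : 0 < (m.+1%:R : R) by rewrite ltr0n.
have ths_range j : 0 <= ths j /\ ths j < 2 * pi.
  split; first by rewrite divr_ge0 // mulr_ge0 // mulr_ge0 // ltW.
  by rewrite ltr_pdivrMr // ltr_pM2l ?mulr_gt0 // ltr_nat.
have ths_incr (i j : 'I_m.+1) : (i < j)%N -> ths i < ths j.
  by move=> ij; rewrite ltr_pM2r ?invr_gt0 // ltr_pM2l ?mulr_gt0 // ltr_nat.
have [f fbij fE] := ring_point_bij r0 Jy circle_inj theta_range theta_incr hx (points _ theta_range).
have [fs fsbij fsE] := ring_point_bij r0 Jy circle_inj ths_range ths_incr hxs (points _ ths_range).
have [g fK gK] := fbij.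
(* The weight of a circle is read off in the half-plane of index 0; any other would do, because the
   charge is constant on circles. *)
pose D a := delta (g (a, ord0)).
have dE l : delta l = D (f l).1.
  apply: (hdelta _ _ (S (f l).1)); first exact: SO.
    by rewrite fE SE; apply: circle_cyl; exact/andP.
  by rewrite fE gK SE; apply: circle_cyl; exact/andP.
(* The numbering condition puts both configurations on the same circles with the same weights, so
   the two kernels and the two constant terms coincide. *)
have same l : (fs l).1 = (f l).1.
  have [S0 [/Ssurj[a ->] + +]] := hnum l; rewrite fE fsE => /onS -> /onS ->.
  by [].
have dsE l : delta l = D (fs l).1 by rewrite same.
rewrite (green_energy_circles hadm hrot r0 Jy By circle_inj theta_range theta_incr fbij fE dE).
rewrite (green_energy_circles hadm hrot r0 Jy By circle_inj ths_range ths_incr fsbij fsE dsE).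
rewrite lerD2r; apply: equal_spacing => //.
- exact: pair_kernel_periodic.
- exact: pair_kernel_midpoint.
Qed.

Theorem theorem1 (R : realType) (d : nat) (hd : (3 <= d)%N)
  (B : set 'rV[R]_d) (hadm : admissible B) (hrot : rotation_domain B)
  (Omega : set (set 'rV[R]_d)) (Omega_fin : finite_set Omega)
  (Omega_circle : forall S, Omega S -> is_circle S)
  (Omega_B : forall S, Omega S -> S `<=` B)
  (m : nat) (hm : (0 < m)%N) (theta : 'I_m -> R)
  (theta_range : forall j, 0 <= theta j /\ theta j < 2 * pi)
  (theta_incr : forall i j : 'I_m, (i < j)%N -> theta i < theta j)
  (n : nat) (x xs : 'I_n -> 'rV[R]_d)
  (hx : set_bij [set: 'I_n] (intersection_points Omega theta) x)
  (hxs : set_bij [set: 'I_n]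
    (intersection_points Omega (fun j : 'I_m => 2 * pi * j%:R / m%:R)) xs)
  (delta : 'I_n -> R)
  (hdelta : forall (k l : 'I_n) (S : set 'rV[R]_d),
    Omega S -> S (x k) -> S (x l) -> delta k = delta l)
  (hnum : forall k : 'I_n,
    exists S : set 'rV[R]_d, [/\ Omega S, S (x k) & S (xs k)]) :
  green_energy x delta B >= green_energy xs delta B.
Proof.
case: d hd B hadm hrot Omega Omega_fin Omega_circle Omega_B x xs hx hxs hdelta hnum => [|[|[|d]]] // _.
move=> B hadm hrot Omega Ofin Ocircle OB.
case: m hm theta theta_range theta_incr => // m _ theta trange tincr x xs hx hxs.
exact: energy_bound.
Qed.
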